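(* Let $r\geq 132434$ and $s\geq 1$ be integers, let $F(x,y)\in\mathbb Z[x,y]$ be an irreducible binary form of degree $r$ having at most $s+1$ non-zero coefficients, and let $h\geq1$ be an integer. Then $$N(F,h)\leq 2\left(1+\log^*h^{1/r}\right)\left(3+4h^{1/r}+\frac{e^{105}h^{2/r}}{|D(F)|^{1/(r(r-1))}}\right)\times$$ $$\left(1+40\left(6+z(r)+25(sr)^{1/2}\right)+48s\left(15+\frac{1}{\log(r-1)}\log\log^*(2h^{1/r})\right)\right).$$
   Context: Write $F(x,y)=a_0x^r+\cdots+a_ry^r=a_0\prod_{i=1}^r(x-\alpha_iy)$ with $\alpha_i$ the roots of $F(x,1)$; $D(F)=a_0^{2r-2}\prod_{1\le i<j\le r}(\alpha_i-\alpha_j)^2$ is its discriminant. For an integer $h\ge1$, $N(F,h)$ is the number of pairs $(x,y)\in\mathbb Z^2$, $(x,y)\ne(0,0)$, with $|F(x,y)|\le h$. For real $x$, $\log^*x=1$ if $x\le e$ and $\log^*x=\log x$ if $x>e$. Also $z(r)=68\log^3r+150\log^2r+\log r$. *)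

(* Defs.v *)
(* [mpoly] must be imported before MathComp-Analysis: in the other order
   their notations clash. *)
From mathcomp Require Export all_boot all_order all_algebra.
From mathcomp Require Export mpoly complex.
From mathcomp Require Export all_classical all_reals all_analysis.

Set Implicit Arguments.
Unset Strict Implicit.
Unset Printing Implicit Defensive.

Import Order.TTheory GRing.Theory Num.Theory.
Local Open Scope ring_scope.

(* Binary forms are elements of {mpoly int[2]}; the variable of index 0 is x
   and the one of index 1 is y. *)
Definition xy_val (T : Type) (x y : T) (i : 'I_2) : T :=
  if i == ord0 then x else y.

Definition irreducible_elt (A : idomainType) (p : A) : Prop :=
  [/\ p != 0, p \isn't a GRing.unit &
      forall a b : A, p = a * b -> a \is a GRing.unit \/ b \is a GRing.unit].

(* As usual for Thue inequalities, a form with integer coefficients is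
   irreducible when it is so over the rationals; its content may exceed 1. *)
Definition irreducible_form (F : {mpoly int[2]}) : Prop :=
  irreducible_elt (map_mpoly intr F : {mpoly rat[2]}).

Definition nb_coeffs (F : {mpoly int[2]}) : nat := size (msupp F).

(* a_0, the coefficient of x^r *)
Definition form_a0 (r : nat) (F : {mpoly int[2]}) : int :=
  F@_(U_(ord0 : 'I_2) *+ r)%MM.

(* F(x,1) *)
Definition form_x1 (R : realType) (F : {mpoly int[2]}) : {poly R[i]} :=
  mmap (intr : int -> {poly R[i]}) (xy_val 'X 1) F.

(* The complex roots of F(x,1), with multiplicity; there are r of them when
   F has degree r and a_0 != 0. *)
Definition form_roots (R : realType) (F : {mpoly int[2]}) : seq R[i] :=
  sval (closed_field_poly_normal (form_x1 R F)).

Definition form_disc (R : realType) (r : nat) (F : {mpoly int[2]}) : R[i] :=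
  let alpha := form_roots R F in
  (form_a0 r F)%:~R ^+ (2 * r - 2) *
  \prod_(i < r) \prod_(j < r | (i < j)%N) (alpha`_i - alpha`_j) ^+ 2.

Definition form_disc_abs (R : realType) (r : nat) (F : {mpoly int[2]}) : R :=
  Normc.normc (form_disc R r F).

Definition sol_set (F : {mpoly int[2]}) (h : nat) : set (int * int) :=
  [set p : int * int | p != (0, 0) /\ `|F.@[xy_val p.1 p.2]| <= h%:Z]%classic.

(* N(F,h); the value is +oo when the set of solutions is infinite, so that
   bounding it by a real number includes finiteness. *)
Definition nb_sol (R : realType) (F : {mpoly int[2]}) (h : nat) : \bar R :=
  counting (sol_set F h).

Definition logstar (R : realType) (x : R) : R :=
  if x <= expR 1 then 1 else ln x.

Definition zfun (R : realType) (r : nat) : R :=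
  68 * ln r%:R ^+ 3 + 150 * ln r%:R ^+ 2 + ln r%:R.

(* h^{1/r} *)
Definition hroot (R : realType) (h r : nat) : R := h%:R `^ (r%:R^-1).

(* Main.v *)
Require Import Defs.
From mathcomp Require Import cyclic separable cyclotomic polyrcf.
From mathcomp Require Import zify ring lra.

(* Dividing the solutions with gcd d by d leaves primitive ones, with H = h^(1/r)
   replaced by H/d. The restriction of F to a sublattice of index m has its
   discriminant multiplied by m^(r(r-1)), and 2m such sublattices cover all
   primitive points. With m close to e^100 H^2 / |D(F)|^(1/(r(r-1))), one may assume
   that |D(F)| exceeds (e^100 H^2)^(r(r-1)), and that the product of the heights n_i
   of the linear factors L_i of F is nearly minimal under SL_2(Z).

   Put X = max(|x|, |y|) and d_i = |L_i(x, y)| / (n_i X). As F has few terms,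
   Descartes' rule bounds the number of real zeros of F and of its derivatives by
   O(s), and a set S of at most 12(s+1) roots contains, for every real point, a
   root whose d is within a factor r^5 of the smallest one. Solutions attached to
   the same root of S satisfy the gap principle |det| >= 1. In the range of small
   X, near-minimality applied to a basis starting with the solution bounds the
   product of the 1 + 1/(X^2 d_i) from below, while the gaps bound the sum of their
   logarithms, whence O(sqrt(rs)) solutions. For medium X one factor satisfies d_i
   < X^(-4) and log X doubles at each step; for large X one factor absorbs almost
   the whole product and log X grows by the factor (r-1)/2 at each step, up to the
   point where Thue's method (Siegel's lemma and a Wronskian) leaves at most two
   solutions for each root. *)

Import Order.TTheory GRing.Theory Num.Theory.
Local Open Scope ring_scope.
Local Notation normc := Normc.normc.
Set Implicit Arguments.
Unset Strict Implicit.
Unset Printing Implicit Defensive.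

(** * Sparse binary forms *)

(** A change of basis destroys sparsity, yet both reductions, to a large discriminant and to nearly
    minimal heights, are changes of basis. What survives is the bound on the number of real zeros of
    the form and of its directional derivatives, since real Moebius maps only move these zeros. It
    is therefore computed on the original polynomial, which the statements keep next to the basis of
    the sublattice. Solutions are real points, which is why O(s) roots can serve all of them. The
    count itself is made in logarithms. If M is |a_0| times the product of the heights and tau =
    log(M / H^r), a solution has sum of log d_i at most -tau - r log X, and the condition on the
    discriminant says that the logarithms of the normalised resultants, summed over ordered pairs of
    factors, reach (r - 1)(100 r - 2 tau). Each of them is at most 1, so tau >= 99 r / 2: this is
    the purpose of e^100, as tau then dominates all losses of size O(r). The ranges are cut at log X
    = sqrt(s r) tau / r and at 40 tau; the first value balances the small solutions against the
    medium ones. *)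

Definition hom (S : comNzRingType) (r : nat) (p : {poly S}) (x y : S) : S :=
  \sum_(i < r.+1) p`_i * x ^+ i * y ^+ (r - i).

Lemma homD (S : comNzRingType) r (p q : {poly S}) x y :
  hom r (p + q) x y = hom r p x y + hom r q x y.
Proof. by rewrite /hom -big_split /=; apply: eq_bigr => i _; rewrite coefD !mulrDl. Qed.

Lemma homZ (S : comNzRingType) r c (p : {poly S}) x y :
  hom r (c *: p) x y = c * hom r p x y.
Proof. by rewrite /hom mulr_sumr; apply: eq_bigr => i _; rewrite coefZ !mulrA. Qed.

Lemma hom_sum (S : comNzRingType) r I (s : seq I) (P : pred I) (F : I -> {poly S}) x y :
  hom r (\sum_(i <- s | P i) F i) x y = \sum_(i <- s | P i) hom r (F i) x y.
Proof.
elim/big_rec2: _ => [|i u v _ <-]; last by rewrite homD.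
by rewrite /hom big1 // => i _; rewrite coef0 !mul0r.
Qed.

Lemma homXn (S : comNzRingType) r k (x y : S) : (k <= r)%N ->
  hom r 'X^k x y = x ^+ k * y ^+ (r - k).
Proof.
move=> lekr; rewrite /hom (bigD1 (inord k)) //= inordK // coefXn eqxx mul1r.
rewrite big1 ?addr0 // => i; rewrite coefXn -val_eqE /= inordK //.
by move=> /negbTE->; rewrite !mul0r.
Qed.

(** The degree is an argument of [hom] and is not read off the polynomial: upper bounds on the sizes
    suffice, and a vanishing leading coefficient only contributes powers of [y]. *)
Lemma homM (S : comNzRingType) d e (p q : {poly S}) x y :
  (size p <= d.+1)%N -> (size q <= e.+1)%N ->
  hom (d + e) (p * q) x y = hom d p x y * hom e q x y.
Proof.
move=> sp sq.
have {1}-> : p = \sum_(i < d.+1) p`_i *: 'X^i.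
  rewrite -[LHS](coefK p) poly_def (big_ord_widen d.+1 (fun i => p`_i *: 'X^i)) //.
  rewrite big_mkcond; apply: eq_bigr => i _; case: ltnP => // h.
  by rewrite nth_default // scale0r.
have {1}-> : q = \sum_(i < e.+1) q`_i *: 'X^i.
  rewrite -[LHS](coefK q) poly_def (big_ord_widen e.+1 (fun i => q`_i *: 'X^i)) //.
  rewrite big_mkcond; apply: eq_bigr => i _; case: ltnP => // h.
  by rewrite nth_default // scale0r.
rewrite mulr_suml hom_sum [in RHS]/hom mulr_suml; apply: eq_bigr => i _.
rewrite mulr_sumr hom_sum mulr_sumr; apply: eq_bigr => j _.
rewrite -scalerAl -scalerAr !homZ -exprD.
have li := ltn_ord i; have lj := ltn_ord j.
rewrite homXn; last lia.
have -> : (d + e - (i + j) = (d - i) + (e - j))%N by lia.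
rewrite !exprD; ring.
Qed.

Lemma hom_prodXsubC (S : comNzRingType) (s : seq S) c x y :
  hom (size s) (c *: \prod_(a <- s) ('X - a%:P)) x y = c * \prod_(a <- s) (x - a * y).
Proof.
rewrite homZ; congr (_ * _); elim: s => [|a s IH].
  by rewrite !big_nil /hom big_ord1 coef1 /= mulr1 mulr1.
rewrite !big_cons /= -add1n homM ?size_XsubC ?size_prod_XsubC // IH; congr (_ * _).
rewrite /hom !big_ord_recl big_ord0 /= !coefB !coefX !coefC /=; ring.
Qed.

Lemma hom_rmorph (S T : comNzRingType) (f : {rmorphism S -> T}) r (p : {poly S}) x y :
  f (hom r p x y) = hom r (map_poly f p) (f x) (f y).
Proof.
rewrite /hom rmorph_sum; apply: eq_bigr => i _.
by rewrite !rmorphM !rmorphXn /= coef_map.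
Qed.

Lemma hom1r (S : comNzRingType) r (p : {poly S}) x : (size p <= r.+1)%N ->
  hom r p x 1 = p.[x].
Proof.
move=> sp; rewrite (horner_coef_wide _ sp) /hom.
by apply: eq_bigr => i _; rewrite expr1n mulr1.
Qed.

Lemma hom_scale (S : comNzRingType) r (p : {poly S}) c x y :
  hom r p (c * x) (c * y) = c ^+ r * hom r p x y.
Proof.
rewrite /hom mulr_sumr; apply: eq_bigr => i _.
rewrite !exprMn; have li := ltn_ord i.
have -> : c ^+ r = c ^+ i * c ^+ (r - i) by rewrite -exprD; congr (_ ^+ _); lia.
ring.
Qed.

Lemma hom_field (K : fieldType) r (p : {poly K}) x y : (size p <= r.+1)%N -> y != 0 ->
  hom r p x y = y ^+ r * p.[x / y].
Proof.
move=> sp y0; rewrite -(hom1r _ sp) -hom_scale mulr1.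
by congr (hom _ _ _ _); field.
Qed.

Definition nterms (S : nzSemiRingType) (m : nat) (p : {poly S}) : nat :=
  (\sum_(i < m) (p`_i != 0)%R)%N.

(** Rolle between consecutive zeros. The bound [a < x] keeps the new zeros distinct in the
    induction, and positive in Descartes' argument. *)
Lemma rolle_count (R : rcfType) (p : {poly R}) (a : R) (s : seq R) :
  path <%R a s -> all (root p) (a :: s) ->
  exists t, [/\ uniq t, size t = size s, all (root p^`()) t &
             forall x, x \in t -> a < x ].
Proof.
elim: s a => [|b s IH] a /=; first by exists [::].
case/andP=> ab pb /and3P[ra rb rs].
have [|t [ut st rt tb]] := IH b pb; first by rewrite /= rb.
have [|c cab dc] := poly_rolle ab (p := p).
  by rewrite (rootP ra) (rootP rb).
move: cab; rewrite in_itv /= => /andP[ac cb].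
exists (c :: t); split=> //=.
- rewrite ut andbT; apply/negP => /tb; rewrite ltNge => /negP; apply; exact: ltW.
- by rewrite st.
- by rewrite rt andbT; apply/rootP.
- move=> x; rewrite inE => /orP[/eqP->//|/tb bx]; exact: lt_trans bx.
Qed.

(** If the constant term vanishes, division by X keeps the positive zeros and the number of terms;
    otherwise differentiation kills exactly one term and, by Rolle, loses at most one zero. *)
Lemma descartes_pos (R : rcfType) m (p : {poly R}) (s : seq R) :
  (size p <= m)%N -> p != 0 -> uniq s -> all (root p) s -> all (fun x => 0 < x) s ->
  (size s < nterms m p)%N.
Proof.
elim: m p s => [|m IH] p s sp p0 us rs ps.
  by move: p0; rewrite -size_poly_eq0; move: sp; rewrite leqn0 => ->.
rewrite /nterms big_ord_recl; under eq_bigr => i _ do rewrite lift0.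
have [p00|p00] /= := eqVneq p`_0 0.
  have pX : p = (\poly_(i < m) p`_i.+1) * 'X.
    apply/polyP => -[|i]; rewrite coefMX //= coef_poly; case: ltnP => // h.
    by rewrite nth_default //; apply: leq_trans sp _.
  set q := \poly_(i < m) _ in pX.
  have := IH q s; rewrite /nterms (_ : (\sum_(i < m) _ = \sum_(i < m) (p`_i.+1 != 0)%R)%N).
    apply=> //; first exact: size_poly.
    - by apply: contraNneq p0 => q0; rewrite pX q0 mul0r.
    - apply/allP => x xs; move/allP: rs => /(_ x xs); rewrite pX rootM rootX.
      by case/orP => // /eqP x0; move/allP: ps => /(_ x xs); rewrite x0 ltxx.
  by apply: eq_bigr => i _; rewrite coef_poly ltn_ord.
rewrite add1n ltnS.
set t := sort <=%R s.
have ut : uniq t by rewrite sort_uniq.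
have st : sorted <%R t by rewrite lt_sorted_uniq_le ut sort_le_sorted.
have rt : all (root p) t by rewrite all_sort.
have pt : all (fun x => 0 < x) t by rewrite all_sort.
have -> : size s = size t by rewrite size_sort.
case: {us rs ps ut s} t st rt pt => [//|a t] /= st rt pt.
have [u [uu su ru bu]] := rolle_count st rt.
rewrite -su.
have -> : (\sum_(i < m) (p`_i.+1 != 0)%R = nterms m p^`())%N.
  by apply: eq_bigr => i _; rewrite coef_deriv mulrn_eq0.
apply: IH => //.
- by have := lt_size_deriv p0; lia.
- apply/negP => /eqP d0.
  have p1 : (size p <= 1)%N.
    apply/leq_sizeP => -[//|j] _; have := coef_deriv p j; rewrite d0 coef0.
    by move/esym/eqP; rewrite mulrn_eq0 /= => /eqP.
  case/andP: rt => ra _; move: ra; rewrite (size1_polyC p1).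
  by rewrite rootC (negbTE p00).
- by apply/allP => x /bu; case/andP: pt => a0 _; exact: lt_trans.
Qed.

(** For t terms, Descartes applied to p(x) and p(-x) gives at most t - 1 zeros of each sign, and 0
    adds one: 2 t - 1 in all. *)
Lemma sparse_roots (R : rcfType) m (p : {poly R}) (s : seq R) :
  (size p <= m)%N -> p != 0 -> uniq s -> all (root p) s ->
  (size s < (nterms m p).*2)%N.
Proof.
move=> sp p0 us rs.
set q := \poly_(i < m) ((-1) ^+ i * p`_i).
have qh x : q.[x] = p.[- x].
  rewrite horner_poly (horner_coef_wide _ sp); apply: eq_bigr => i _.
  by rewrite [(- x) ^+ i]exprNn mulrA [p`_i * _]mulrC.
have q0 : q != 0.
  apply: contraNneq p0 => q0; apply/eqP/polyP => i; rewrite coef0.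
  have := congr1 (fun u : {poly R} => u`_i) q0; rewrite coef0 coef_poly.
  case: ltnP => h; last by rewrite nth_default //; apply: leq_trans sp _.
  by move/eqP; rewrite mulf_eq0 signr_eq0 => /eqP.
have nq : nterms m q = nterms m p.
  apply: eq_bigr => i _; rewrite coef_poly ltn_ord mulf_eq0 signr_eq0 //.
pose sp1 := [seq x <- s | 0 < x]; pose sn := [seq x <- s | x < 0].
have h1 : (size sp1 < nterms m p)%N.
  apply: descartes_pos => //; first exact: filter_uniq.
  - by apply/allP => x; rewrite mem_filter => /andP[_ xs]; exact: (allP rs).
  - exact: filter_all.
have h2 : (size [seq - x | x <- sn] < nterms m q)%N.
  apply: descartes_pos => //; first exact: size_poly.
  - by rewrite map_inj_uniq; [exact: filter_uniq|exact: oppr_inj].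
  - apply/allP => y /mapP[x]; rewrite mem_filter => /andP[_ xs] ->.
    by rewrite rootE qh opprK; exact: (allP rs).
  - apply/allP => y /mapP[x]; rewrite mem_filter => /andP[x0 _] ->.
    by rewrite oppr_gt0.
rewrite size_map nq in h2.
have h3 : (count_mem (0%R : R) s <= 1)%N by rewrite count_uniq_mem //; case: (_ \in _).
have : size s = (size sp1 + size sn + count_mem (0%R : R) s)%N.
  rewrite !size_filter; elim: (s) => //= x t ->.
  by case: (ltgtP x 0) => /=; lia.
move=> ->; rewrite -addnn; apply: leq_trans (leq_add h1 h2).
by rewrite addSn addnS !ltnS -[leqRHS]addn1 leq_add2l.
Qed.

(* The Moebius substitution is injective on projective points; only the point
   sent to infinity escapes the count for [p] itself. *)
Lemma hom_sparse_roots (R : rcfType) r (p : {poly R}) (a b c d : R) (s : seq R) :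
  (size p <= r.+1)%N -> p != 0 -> a * d - b * c != 0 -> uniq s ->
  all (fun x => hom r p (a * x + b) (c * x + d) == 0) s ->
  (size s <= (nterms r.+1 p).*2)%N.
Proof.
move=> sp p0 det us hs.
pose t := [seq x <- s | c * x + d != 0].
have h1 : (size [seq ((a * x + b) / (c * x + d))%R | x <- t] < (nterms r.+1 p).*2)%N.
  apply: sparse_roots => //.
    rewrite map_inj_in_uniq; first exact: filter_uniq.
    move=> x y; rewrite !mem_filter => /andP[x0 _] /andP[y0 _] /eqP.
    rewrite eqr_div // => /eqP e; apply/eqP; rewrite -subr_eq0.
    have : (a * d - b * c) * (x - y) = 0.
      have -> : (a * d - b * c) * (x - y) =
        (a * x + b) * (c * y + d) - (a * y + b) * (c * x + d) by ring.
      by rewrite e subrr.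
    by move/eqP; rewrite mulf_eq0 (negbTE det).
  apply/allP => y /mapP[x]; rewrite mem_filter => /andP[x0 xs] ->.
  move/allP: hs => /(_ x xs); rewrite hom_field // mulf_eq0 expf_eq0 (negbTE x0) andbF /=.
  by rewrite rootE.
rewrite size_map in h1.
pose t0 := [seq x <- s | c * x + d == 0].
have : (size t0 <= 1)%N.
  have: uniq t0 by exact: filter_uniq.
  have : all (fun x => c * x + d == 0) t0 by exact: filter_all.
  case: t0 => [//|x [//|y l]] /=.
  case/andP=> /eqP hx /andP[/eqP hy _]; rewrite inE negb_or => /andP[/andP[xy _] _].
  case/negP: xy; apply/eqP.
  have c0 : c != 0.
    apply: contraNneq det => c0; move: hx; rewrite c0 mul0r add0r => ->.
    by rewrite !mulr0 subrr.
  by apply: (mulfI c0); apply: (addIr d); rewrite hx hy.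
have : size s = (size t + size t0)%N.
  by rewrite /t /t0 !size_filter; elim: (s) => //= x l ->; case: (_ == 0) => /=; lia.
move=> -> h; apply: leq_trans h1.
by rewrite -[leqRHS]addn1 leq_add2l.
Qed.

(** * Roots near the real line *)

Lemma normc_ge0 (R : rcfType) (z : R[i]) : 0 <= normc z.
Proof. by case: z => a b; rewrite /normc sqrtr_ge0. Qed.

Lemma normc_eq0 (R : rcfType) (z : R[i]) : (normc z == 0) = (z == 0).
Proof.
apply/eqP/eqP => [/Normc.eq0_normc //|->]; exact: Normc.normc0.
Qed.

Lemma normc_gt0 (R : rcfType) (z : R[i]) : (0 < normc z) = (z != 0).
Proof. by rewrite lt_def normc_ge0 andbT normc_eq0. Qed.

Lemma normcX (R : rcfType) (z : R[i]) n : normc (z ^+ n) = normc z ^+ n.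
Proof. by elim: n => [|n IH]; rewrite ?expr0 ?Normc.normc1 // !exprS Normc.normcM IH. Qed.

Lemma normc_opp (R : rcfType) (z : R[i]) : normc (- z) = normc z.
Proof. exact: normcN. Qed.

Lemma normc_le_add (R : rcfType) (x y : R[i]) : normc (x + y) <= normc x + normc y.
Proof. exact: le_normcD. Qed.

Lemma normc_prod (R : rcfType) I (s : seq I) (P : pred I) (F : I -> R[i]) :
  normc (\prod_(i <- s | P i) F i) = \prod_(i <- s | P i) normc (F i).
Proof. exact: (big_morph _ (@Normc.normcM R) (Normc.normc1 R)). Qed.

Lemma normc_sum (R : rcfType) I (s : seq I) (P : pred I) (F : I -> R[i]) :
  normc (\sum_(i <- s | P i) F i) <= \sum_(i <- s | P i) normc (F i).
Proof.
elim/big_rec2: _ => [|i u v _ h]; first by rewrite Normc.normc0.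
by apply: le_trans (normc_le_add _ _) _; rewrite lerD2l.
Qed.

Lemma le_normcB (R : rcfType) (x y : R[i]) : normc (x - y) <= normc x + normc y.
Proof. by rewrite -[normc y]normc_opp normc_le_add. Qed.

Lemma normc_real (R : rcfType) (x : R) : normc (real_complex R x) = `|x|.
Proof. by rewrite /= expr0n addr0 sqrtr_sqr. Qed.

Lemma intr_complex (R : rcfType) (z : int) : z%:~R = real_complex R z%:~R.
Proof. by rewrite rmorph_int. Qed.

Lemma normc_int (R : rcfType) (z : int) : normc (z%:~R : R[i]) = `|z|%:~R.
Proof. by rewrite intr_complex normc_real intr_norm. Qed.

Lemma normcBC (R : rcfType) (x y : R[i]) : normc (x - y) = normc (y - x).
Proof. by rewrite -opprB normc_opp. Qed.

Lemma prim_root_complex (R : rcfType) n : (0 < n)%N ->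
  {z : R[i] | n.-primitive_root z}.
Proof.
move=> n0.
have [rs h] := closed_field_poly_normal ('X^n - 1 : {poly R[i]}).
have monX : ('X^n - 1 : {poly R[i]}) \is monic by rewrite monicXnsubC.
rewrite (monicP monX) scale1r in h.
have nn0 : n%:R != 0 :> R[i] by rewrite pnatr_eq0 -lt0n.
have ur : uniq rs by rewrite -separable_prod_XsubC -h separable_Xn_sub_1.
have sr : size rs = n.
  have := congr1 (fun p : {poly R[i]} => size p) h.
  by rewrite /= size_prod_XsubC size_XnsubC // => -[].
have all_u : all n.-unity_root rs.
  apply/allP => x xs; rewrite /root_of_unity h root_prod_XsubC //.
have := has_prim_root n0 all_u ur; rewrite sr leqnn => /(_ isT) hp.
by exists (rs`_(find n.-primitive_root rs)); apply: nth_find.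
Qed.

(** Averaging P(w) w^(-j) over the n-th roots of unity isolates the j-th coefficient; the exponent
    [n - j] replaces -j. *)
Lemma coef_le_roots_of_unity (R : rcfType) (P : {poly R[i]}) n (B : R) :
  (size P <= n)%N -> (forall w, w ^+ n = 1 -> normc P.[w] <= B) ->
  forall j, (j < n)%N -> normc P`_j <= B.
Proof.
move=> sP hB j jn; have n0 : (0 < n)%N by lia.
have [z hz] := prim_root_complex R n0.
have key : n%:R * P`_j = \sum_(m < n) P.[z ^+ m] * z ^+ (m * (n - j)).
  under eq_bigr => m _ do rewrite (horner_coef_wide _ sP) mulr_suml.
  rewrite exchange_big /= (bigD1 (Ordinal jn)) //= [X in _ + X]big1 ?addr0.
    under eq_bigr => m _ do rewrite -exprM -mulrA -exprD -mulnDr subnKC 1?ltnW // mulnC exprM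
       (prim_expr_order hz) expr1n mulr1.
    by rewrite sumr_const card_ord mulr_natl.
  move=> k kj.
  under eq_bigr => m _ do rewrite -exprM -mulrA -exprD -mulnDr mulnC exprM.
  rewrite -mulr_sumr; set w := z ^+ _.
  have w1 : w != 1.
    apply: contraNneq kj => /eqP; rewrite -(prim_order_dvd hz) => hd.
    have kn := ltn_ord k.
    apply/eqP/val_inj => /=; case/dvdnP: hd => q; case: q => [|[|q]]; first lia.
      lia.
    rewrite !mulSn; lia.
  have : (w - 1) * \sum_(i < n) w ^+ i = 0.
    by rewrite -subrX1 /w -exprM mulnC exprM (prim_expr_order hz) expr1n subrr.
  by move/eqP; rewrite mulf_eq0 subr_eq0 (negbTE w1) => /eqP->; rewrite mulr0.
have nz : normc z = 1.
  apply/eqP; rewrite -(@pexpr_eq1 _ _ n) ?normc_ge0 //.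
  by rewrite -normcX (prim_expr_order hz) Normc.normc1.
have nR : (0 : R) < n%:R by rewrite ltr0n.
rewrite -(ler_pM2l nR).
have -> : n%:R * normc P`_j = normc (n%:R * P`_j).
  rewrite Normc.normcM; congr (_ * _).
  by have := normc_int R n; rewrite /= => ->.
rewrite key; apply: le_trans (normc_sum _ _ _) _.
apply: le_trans (_ : \sum_(m < n) B <= _); last first.
  by rewrite sumr_const card_ord mulr_natl.
apply: ler_sum => m _; rewrite Normc.normcM normcX nz expr1n mulr1; apply: hB.
by rewrite -exprM mulnC exprM (prim_expr_order hz) expr1n.
Qed.

Lemma normc_X_sub1 (R : rcfType) (w : R[i]) j : normc w <= 1 ->
  normc (w ^+ j - 1) <= j%:R * normc (w - 1).
Proof.
move=> w1; elim: j => [|j IH]; first by rewrite expr0 subrr Normc.normc0 mul0r.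
have -> : w ^+ j.+1 - 1 = w * (w ^+ j - 1) + (w - 1) by rewrite exprS; ring.
apply: le_trans (normc_le_add _ _) _.
rewrite Normc.normcM -natr1 mulrDl mul1r lerD2r; apply: le_trans IH.
by rewrite ler_piMl ?normc_ge0.
Qed.

(** On the unit circle, (w + 1/w) / 2 is the real part of w. *)
Lemma joukowsky_unit (R : rcfType) (w : R[i]) : normc w = 1 ->
  exists2 a : R, -1 <= a <= 1 & w ^+ 2 + 1 = 2 * (w * real_complex R a).
Proof.
case: w => a b; rewrite /normc => h.
have h2 : a ^+ 2 + b ^+ 2 = 1.
  rewrite -[LHS](sqr_sqrtr _) ?h ?expr1n //; nra.
exists a; first by apply/andP; split; nra.
have -> : (2 : R[i]) = real_complex R 2 by rewrite rmorph_nat.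
apply/eqP; rewrite expr2 eq_complex /=; apply/andP; split; apply/eqP; nra.
Qed.

(** The two solutions z + s and z - s, where s^2 = z^2 - 1, have product 1, so one of them lies in
    the closed unit disc. *)
Lemma joukowsky_root (R : rcfType) (z : R[i]) :
  exists2 w : R[i], normc w <= 1 & w ^+ 2 + 1 = 2 * (w * z).
Proof.
pose s := sqrtc (z ^+ 2 - 1).
have s2 : s ^+ 2 = z ^+ 2 - 1 by exact: sqr_sqrtc.
have h : normc (z + s) * normc (z - s) = 1.
  rewrite -Normc.normcM mulrC -subr_sqr s2.
  have -> : z ^+ 2 - (z ^+ 2 - 1) = 1 by ring.
  exact: Normc.normc1.
have [h1|h1] := lerP (normc (z + s)) 1.
  exists (z + s) => //.
  have -> : (z + s) ^+ 2 + 1 = z ^+ 2 + 2 * z * s + s ^+ 2 + 1 by ring.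
  by rewrite s2; ring.
exists (z - s).
  have := normc_ge0 (z - s); nra.
have -> : (z - s) ^+ 2 + 1 = z ^+ 2 - 2 * z * s + s ^+ 2 + 1 by ring.
by rewrite s2; ring.
Qed.

Lemma map_horner_eval_polyC (S : comNzRingType) (p : {poly S}) w :
  map_poly (horner_eval w) (map_poly polyC p) = p.
Proof.
rewrite -map_poly_comp; apply: map_poly_id => x _ /=.
by rewrite horner_evalE hornerC.
Qed.

(* Writing z = (w + 1/w) / 2 turns g into a polynomial P of degree 2r in w whose
   coefficients are bounded, by averaging over roots of unity, by max |g| on
   [-1, 1]; hence P cannot vanish near w = 1. *)
Lemma root_far_from_endpoint (R : rcfType) r (g : {poly R}) (z : R[i]) :
  (0 < r)%N -> (size g <= r.+1)%N ->
  (forall x, -1 <= x <= 1 -> `|g.[x]| <= `|g.[1]|) -> g.[1] != 0 ->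
  root (map_poly (real_complex R) g) z ->
  1 <= 18 * r%:R ^+ 4 * normc (z - 1).
Proof.
move=> r0 sg hg g1 rz.
set gC := map_poly (real_complex R) g in rz.
have sgC : (size gC <= r.+1)%N by rewrite size_map_poly.
have gCx x : gC.[real_complex R x] = real_complex R g.[x] by rewrite horner_map.
pose P : {poly R[i]} := hom r (map_poly polyC gC) (2^-1 *: ('X^2 + 1)) 'X.
have Pw w : P.[w] = hom r gC (2^-1 * (w ^+ 2 + 1)) w.
  rewrite -[LHS]/(horner_eval w P) /P hom_rmorph map_horner_eval_polyC.
  by rewrite /= !horner_evalE hornerZ hornerD hornerXn hornerC hornerX.
have two0 : (2 : R[i]) != 0 by rewrite pnatr_eq0.
have Pz w x : w ^+ 2 + 1 = 2 * (w * x) -> P.[w] = w ^+ r * gC.[x].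
  move=> hw; rewrite Pw hw mulKf // -{2}[w]mulr1 hom_scale hom1r //.
set B := `|g.[1]|; have B0 : 0 < B by rewrite normr_gt0.
have sP : (size P <= r.*2.+1)%N.
  rewrite /P /hom; apply: leq_trans (size_sum _ _ _) _; apply/bigmax_leqP => i _.
  rewrite coef_map /= -mulrA mul_polyC; apply: leq_trans (size_scale_leq _ _) _.
  rewrite exprZn -scalerAl; apply: leq_trans (size_scale_leq _ _) _.
  apply: leq_trans (size_polyMleq _ _) _; rewrite size_polyXn addnS /=.
  apply: leq_trans (leq_add (size_poly_exp_leq _ _) (leqnn _)) _.
  have -> : ('X^2 + 1 : {poly R[i]}) = 'X^2 - (- 1)%:P by rewrite polyCN opprK.
  by rewrite size_XnsubC //=; have := ltn_ord i; lia.
have Pj j : (j < r.*2.+1)%N -> normc P`_j <= B.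
  apply: (coef_le_roots_of_unity sP) => w wn.
  have nw : normc w = 1.
    apply/eqP; rewrite -(@pexpr_eq1 _ _ r.*2.+1) ?normc_ge0 //.
    by rewrite -normcX wn Normc.normc1.
  have [a ha hw] := joukowsky_unit nw.
  by rewrite (Pz _ _ hw) Normc.normcM normcX nw expr1n mul1r gCx normc_real; apply: hg.
have P1 : P.[1] = real_complex R g.[1].
  rewrite (Pz 1 1); first by rewrite expr1n mul1r -gCx.
  by rewrite expr1n; ring.
have [w w1 hw] := joukowsky_root z.
have Pw0 : P.[w] = 0 by rewrite (Pz _ _ hw) (rootP rz) mulr0.
have rB : (0 : R) < r%:R by rewrite ltr0n.
(* In the unit disc |w^j - 1| <= j |w - 1|, and the j up to 2 r add up to r (2 r + 1) <= 3 r^2. *)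
have key : 1 <= 3 * r%:R ^+ 2 * normc (w - 1).
  rewrite -(ler_pM2l B0) mulr1.
  rewrite [leLHS](_ : B = normc (P.[w] - P.[1])); last by rewrite Pw0 sub0r normc_opp P1 normc_real.
  rewrite !(horner_coef_wide _ sP) -sumrB.
  apply: le_trans (normc_sum _ _ _) _.
  apply: le_trans (_ : \sum_(j < r.*2.+1) B * (j%:R * normc (w - 1)) <= _).
    apply: ler_sum => j _; rewrite expr1n -mulrBr Normc.normcM.
    by apply: ler_pM; rewrite ?normc_ge0 ?Pj // normc_X_sub1.
  rewrite -mulr_sumr. rewrite (ler_pM2l B0) -mulr_suml; apply: ler_wpM2r; first exact: normc_ge0.
  have -> : \sum_(i < r.*2.+1) (i%:R : R) = (\sum_(i < r.*2.+1) i)%N%:R by rewrite natr_sum.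
  have -> : (\sum_(i < r.*2.+1) i = r * r.*2.+1)%N.
    by rewrite -(big_mkord xpredT id) bin2_sum bin2 /= mulnC -doubleMl doubleK.
  rewrite -natrX -natrM ler_nat; nia.
(* The substitution has a critical point at w = 1, as (w - 1)^2 = 2 w (z - 1). Distances are thus
   squared, and 3 r^2 becomes 9 r^4 * 2. *)
have hw2 : normc (w - 1) ^+ 2 <= 2 * normc (z - 1).
  rewrite -normcX.
  have -> : (w - 1) ^+ 2 = 2 * (w * (z - 1)).
    rewrite mulrBr mulrBr -hw; ring.
  rewrite !Normc.normcM.
  have -> : normc (2 : R[i]) = 2 by have := normc_int R 2.
  by rewrite ler_pM2l // ler_piMl // normc_ge0.
have n0 := normc_ge0 (w - 1); have nz := normc_ge0 (z - 1).
have h4 : 1 <= (3 * r%:R ^+ 2 * normc (w - 1)) ^+ 2 by rewrite exprn_ege1.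
apply: le_trans h4 _.
have -> : (3 * r%:R ^+ 2 * normc (w - 1)) ^+ 2 = 9 * r%:R ^+ 4 * normc (w - 1) ^+ 2 by ring.
have r4 : (0 : R) <= r%:R ^+ 4 by rewrite exprn_ge0 ?ler0n.
have -> : 18 * r%:R ^+ 4 * normc (z - 1) = 9 * r%:R ^+ 4 * (2 * normc (z - 1)) by ring.
by apply: ler_wpM2l => //; lra.
Qed.

(** Affine transport of the preceding bound: t = 1 is sent to [xi], and the sign of [L] decides on
    which side of [xi] the segment of length 2 |L| lies. *)
Lemma root_far_from_max (R : rcfType) r (g : {poly R}) (z : R[i]) (xi L : R) :
  (0 < r)%N -> (size g <= r.+1)%N -> L != 0 ->
  (forall t, -1 <= t <= 1 -> `|g.[xi - L + L * t]| <= `|g.[xi]|) -> g.[xi] != 0 ->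
  root (map_poly (real_complex R) g) z ->
  `|L| <= 18 * r%:R ^+ 4 * normc (z - real_complex R xi).
Proof.
move=> r0 sg L0 hg g0 rz.
pose l : {poly R} := L *: 'X + (xi - L)%:P.
have lx x : l.[x] = xi - L + L * x by rewrite hornerD hornerZ hornerX hornerC addrC.
have LC0 : real_complex R L != 0 by rewrite fmorph_eq0.
pose z' := (z - real_complex R (xi - L)) / real_complex R L.
have sl : size l = 2.
  by rewrite /l size_polyDl size_scale // size_polyX // (leq_ltn_trans (size_polyC_leq1 _)).
have := @root_far_from_endpoint R r (g \Po l) z' r0.
have -> : (size (g \Po l) <= r.+1)%N.
  by apply: leq_trans (size_comp_poly_leq _ _) _; rewrite sl muln1; case: (size g) sg.
move=> /(_ isT); rewrite !horner_comp !lx.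
have -> : xi - L + L * 1 = xi by ring.
move=> /(_ _ g0).
have -> : z' - 1 = (z - real_complex R xi) / real_complex R L.
  by rewrite /z' rmorphB /=; field.
rewrite Normc.normcM Normc.normcV normc_real => h.
have Lp : 0 < `|L| by rewrite normr_gt0.
rewrite -[X in X <= _]mul1r -ler_pdivlMr // -[leRHS]mulrA; apply: h.
  by move=> x hx; rewrite horner_comp lx; apply: hg.
rewrite map_comp_poly rootE horner_comp.
suff -> : (map_poly (real_complex R) l).[z'] = z by [].
rewrite /l rmorphD /= map_polyZ /= map_polyX map_polyC /= hornerD hornerZ hornerX hornerC.
by rewrite /z' mulrC divfK // addrNK.
Qed.

Lemma critical_point_near_root (R : rcfType) r (g : {poly R}) (z : R[i]) (xi : R) :
  (0 < r)%N -> (size g <= r.+1)%N ->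
  root (map_poly (real_complex R) g) z ->
  exists2 c, root (g * g^`()) c & `|c - xi| <= 37 * r%:R ^+ 4 * normc (z - real_complex R xi).
Proof.
move=> r0 sg rz.
set rho := normc _; set E := 37 * r%:R ^+ 4.
have [gxi|gxi] := eqVneq g.[xi] 0.
  exists xi; first by rewrite rootM rootE gxi eqxx.
  by rewrite subrr normr0 !mulr_ge0 ?exprn_ge0 ?ler0n // normc_ge0.
have rho0 : 0 < rho.
  rewrite normc_gt0 subr_eq0; apply: contraNneq gxi => zx.
  by move: rz; rewrite zx rootE horner_map fmorph_eq0.
have r4 : (1 : R) <= r%:R ^+ 4 by rewrite exprn_ege1 // ler1n.
(* Since 37 / 2 > 18, no segment of length 2 [D] ending at [xi] can have its maximum of |g| at [xi]:
   the root would be further away than [rho]. *)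
pose D := E * rho / 2.
have D0 : 0 < D by rewrite /D /E; nra.
pose p := g * g^`().
have [p0|p0] := eqVneq p 0.
  exists xi; first by rewrite -/p p0 root0.
  by rewrite subrr normr0 mulr_ge0 // ?ltW // /E; nra.
(* Where g g' keeps its sign, g^2 is monotone, and this sign tells on which side of [xi] the segment
   with maximum at [xi] is found. *)
have hp x : (g ^+ 2)^`().[x] = 2 * p.[x].
  by rewrite expr2 derivM hornerD !hornerM; ring.
have nroot : {in `[xi - 2 * D, xi + 2 * D], forall x, ~~ root p x} ->
    (exists2 L, `|L| = D & forall t, -1 <= t <= 1 -> `|g.[xi - L + L * t]| <= `|g.[xi]|).
  move=> no.
  have xin : xi \in `[xi - 2 * D, xi + 2 * D] by rewrite in_itv /=; apply/andP; split; lra.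
  have sgn x : x \in `[xi - 2 * D, xi + 2 * D] -> Num.sg p.[x] = Num.sg p.[xi].
    by move=> xi'; apply: (polyrN0_itv no).
  have absq x y : g.[x] ^+ 2 <= g.[y] ^+ 2 -> `|g.[x]| <= `|g.[y]|.
    by move=> h; rewrite -ler_sqr ?nnegrE // !real_normK ?num_real.
  have pxi : p.[xi] != 0 by move: (no xi xin); rewrite rootE.
  case: (ltgtP p.[xi] 0) pxi => // pxi _.
  - exists (- D); first by rewrite normrN gtr0_norm.
    move=> t ht; apply: absq; rewrite -!horner_exp.
    have mono : {in `[xi - 2 * D, xi + 2 * D] &, {homo horner (- g ^+ 2) : x y / x <= y}}.
      apply: ler_hornerW => x; rewrite in_itv /= => /andP[h1 h2].
      rewrite derivN hornerN hp -mulrN mulr_ge0 // oppr_ge0 -sgr_le0 sgn ?sgr_le0 ?ltW //.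
      by rewrite in_itv /=; apply/andP; split; lra.
    have := mono xi (xi - - D + - D * t); rewrite !hornerN lerN2; apply=> //.
      by rewrite in_itv /=; apply/andP; split; nra.
    by nra.
  - exists D; first by rewrite gtr0_norm.
    move=> t ht; apply: absq; rewrite -!horner_exp.
    have mono : {in `[xi - 2 * D, xi + 2 * D] &, {homo horner (g ^+ 2) : x y / x <= y}}.
      apply: ler_hornerW => x; rewrite in_itv /= => /andP[h1 h2].
      rewrite hp mulr_ge0 // -sgr_ge0 sgn ?sgr_ge0 ?ltW //.
      by rewrite in_itv /=; apply/andP; split; lra.
    apply: mono => //; last by nra.
    by rewrite in_itv /=; apply/andP; split; nra.
have [hno|/allPn] := boolP (all (fun x => ~~ ((xi - 2 * D <= x) && (x <= xi + 2 * D))) (rootsR p)).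
  have [|L LD hL] := nroot.
    move=> x; rewrite in_itv /= => hx; apply/negP => rx.
    have : x \in rootsR p by rewrite -roots_on_rootsR //= in_itv.
    by move=> /(allP hno); rewrite hx.
  have L0 : L != 0 by rewrite -normr_eq0 LD gt_eqF.
  have := root_far_from_max r0 sg L0 hL gxi rz.
  by rewrite LD -/rho /D /E; nra.
case=> c cr; rewrite negbK => hc; exists c.
  by move: cr; rewrite -roots_on_rootsR //= in_itv.
rewrite ler_norml -/rho.
move: hc; rewrite /D => /andP[h1 h2]; apply/andP; split; lra.
Qed.

(* A zero-free, monotone stretch around [xi] would make [xi] an endpoint maximum
   of |g|; so every root close to the real line has a real zero of g or g' at
   comparable distance, and the nearest roots to those zeros suffice. *)
Lemma few_nearest_roots (R : rcfType) r n A B (g : {poly R}) (al : 'I_n -> R[i]) :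
  (0 < r)%N -> (size g <= r.+1)%N -> g != 0 -> g^`() != 0 ->
  (forall i, root (map_poly (real_complex R) g) (al i)) ->
  (forall s, uniq s -> all (root g) s -> (size s <= A)%N) ->
  (forall s, uniq s -> all (root g^`()) s -> (size s <= B)%N) ->
  exists S : {set 'I_n}, (#|S| <= A + B)%N /\
    forall (xi : R) i, exists2 j, j \in S &
      normc (al j - real_complex R xi) <= 75 * r%:R ^+ 4 * normc (al i - real_complex R xi).
Proof.
move=> r0 sg g0 g'0 hal hA hB.
have [n0|n0] := posnP n.
  exists finset.set0; split=> [|xi i]; first by rewrite cards0.
  by exfalso; have := ltn_ord i; rewrite {2}n0.
case: n n0 al hal => // n _ al hal.
pose near (c : R) := [arg min_(i < ord0) normc (al i - real_complex R c)]%O.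
have nearP c i : normc (al (near c) - real_complex R c) <= normc (al i - real_complex R c).
  by rewrite /near; case: arg_minP => // j _; apply.
exists [set i in [seq near c | c <- rootsR g ++ rootsR g^`()]]; split.
  rewrite cardsE; apply: leq_trans (card_size _) _; rewrite size_map size_cat.
  have allr (q : {poly R}) : q != 0 -> all (root q) (rootsR q).
    by move=> q0; apply/allP => x; rewrite -roots_on_rootsR.
  by apply: leq_add; [apply: hA|apply: hB]; rewrite ?uniq_roots ?allr.
move=> xi i.
have [c rc hc] := critical_point_near_root xi r0 sg (hal i).
exists (near c).
  rewrite inE; apply: map_f; rewrite mem_cat.
  by rewrite -!roots_on_rootsR //= -rootM.
have -> : al (near c) - real_complex R xi =
    (al (near c) - real_complex R c) + real_complex R (c - xi).
  by rewrite rmorphB; ring.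
apply: le_trans (normc_le_add _ _) _; rewrite normc_real.
(* Passing through [c] costs |c - xi| twice, whence 75 = 1 + 2 * 37. *)
have h1 : normc (al i - real_complex R c) <= normc (al i - real_complex R xi) + `|c - xi|.
  rewrite -normc_real; apply: le_trans (le_normcB _ _).
  by rewrite rmorphB le_eqVlt; apply/orP; left; apply/eqP; congr normc; ring.
have h2 := nearP c i.
have r4 : (1 : R) <= r%:R ^+ 4 by rewrite exprn_ege1 // ler1n.
have := normc_ge0 (al i - real_complex R xi); nra.
Qed.

(** * Thue's method *)

(** The remainder of a^m X^m modulo f, a being the leading coefficient, computed without
    denominators. The index [(size f).-2] is deg f - 1: multiplication by X pushes that coefficient
    to degree deg f, where it is cancelled. Each step multiplies the coefficient bound by 2 H. *)
Definition redXn (f : {poly int}) m : {poly int} :=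
  iter m (fun p => lead_coef f *: (p * 'X) - p`_(size f).-2 *: f) 1.

Lemma redXnP (f : {poly int}) r (H : nat) :
  size f = r.+1 -> (0 < r)%N -> (1 <= H)%N -> (forall i, `|f`_i| <= H%:Z) ->
  forall m, [/\ (size (redXn f m) <= r)%N,
    forall i, `|(redXn f m)`_i| <= ((2 * H) ^ m)%N%:Z &
    exists q, lead_coef f ^+ m *: 'X^m = redXn f m + q * f].
Proof.
move=> sf r0 H0 hf; elim=> [|m]; last first.
  rewrite /redXn /= -/(redXn f m); set p := redXn f m => -[sp hp [q hq]].
  rewrite sf /=.
  pose a0 := lead_coef f; pose c := p`_r.-1; rewrite -/a0 -/c; split.
  - apply/leq_sizeP => j rj; rewrite coefB !coefZ coefMX.
    have -> : (j == 0)%N = false by lia.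
    move: rj; rewrite leq_eqVlt => /orP[/eqP<-|rj].
      by rewrite /a0 lead_coefE sf /= mulrC subrr.
    by rewrite !nth_default ?mulr0 ?subrr //; [rewrite sf|apply: leq_trans sp _; lia].
  - move=> i; rewrite coefB !coefZ coefMX.
    apply: le_trans (ler_normB _ _) _; rewrite !normrM.
    have ha : `|a0| <= H%:Z by rewrite /a0 lead_coefE.
    have hb : `|if (i == 0)%N then 0 else p`_i.-1| <= ((2 * H) ^ m)%N%:Z.
      by case: (i == 0)%N => //; rewrite normr0.
    have hc := hp r.-1; rewrite -/c in hc; have hi := hf i.
    have -> : ((2 * H) ^ m.+1)%N%:Z = H%:Z * ((2 * H) ^ m)%N%:Z + ((2 * H) ^ m)%N%:Z * H%:Z.
      by rewrite expnS !PoszM; ring.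
    by apply: lerD; apply: ler_pM.
  - exists (a0 *: (q * 'X) + c *: 1).
    rewrite -/a0 exprS -scalerA [in LHS]exprSr.
    have -> : a0 ^+ m *: ('X^m * 'X) = (p + q * f) * 'X by rewrite -hq -scalerAl.
    rewrite -!mul_polyC; ring.
split; first by rewrite size_poly1.
  by move=> i; rewrite coef1; case: (i == 0)%N; rewrite ?normr1 ?normr0.
by exists 0; rewrite expr0 expr0 scale1r mul0r addr0.
Qed.

(** Pigeonhole: the vectors with entries in [0, Q] outnumber the possible values in [-Z, Z]^J, and
    the difference of two vectors with equal values is the solution. *)
Lemma siegel_lemma (I J : finType) (Q Z : nat) (phi : I -> J -> int) :
  (forall j, (\sum_i `|phi i j|%N) * Q <= Z)%N ->
  ((2 * Z + 1) ^ #|J| < (Q + 1) ^ #|I|)%N ->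
  exists t : I -> int, [/\ exists i, t i != 0, forall i, `|t i| <= Q%:Z &
    forall j, \sum_i t i * phi i j = 0].
Proof.
move=> hZ hcard.
pose val (v : {ffun I -> 'I_Q.+1}) j : int := \sum_i (v i)%:Z * phi i j.
have hval v j : `|val v j| <= Z%:Z.
  apply: le_trans (ler_norm_sum _ _ _) _.
  apply: le_trans (_ : (\sum_i Q * `|phi i j|%N)%N%:Z <= _).
    rewrite (big_morph Posz PoszD (erefl _)); apply: ler_sum => i _.
    rewrite normrM PoszM abszE; apply: ler_wpM2r => //.
    by rewrite ger0_norm // lez_nat -ltnS ltn_ord.
  by rewrite lez_nat -big_distrr /= mulnC.
pose enc v : {ffun J -> 'I_(2 * Z).+1} := [ffun j => inord (absz (val v j + Z%:Z))].
have [inj|] := boolP (injectiveb enc).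
  have := leq_card enc (injectiveP _ inj).
  rewrite !card_ffun !card_ord -addn1 -[(2 * Z).+1]addn1 leqNgt.
  by rewrite hcard.
case/injectivePn => v [w vw ew].
exists (fun i => (v i)%:Z - (w i)%:Z); split.
- apply/existsP; apply: contraNT vw; rewrite negb_exists => /forallP h.
  apply/eqP/ffunP => i; apply/val_inj/eqP; have := h i; rewrite negbK subr_eq0.
  by rewrite eqz_nat.
- move=> i; have := ltn_ord (v i); have := ltn_ord (w i); lia.
- move=> j; have := congr1 (fun u : {ffun J -> 'I_(2 * Z).+1} => nat_of_ord (u j)) ew.
  have hb u : (absz (val u j + Z%:Z)%R < (2 * Z).+1)%N by have := hval u j; lia.
  rewrite !ffunE !inordK //.
  have := hval v j; have := hval w j => h1 h2 h3.
  have e : val v j = val w j by lia.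
  under eq_bigr => i _ do rewrite mulrBl.
  by rewrite sumrB -/(val v j) -/(val w j) e subrr.
Qed.

(** Using the same power U of the leading coefficient in all degrees makes the reduction linear in
    T, so that divisibility by f is a linear system over the integers. *)
Definition redp (f : {poly int}) U (T : {poly int}) : {poly int} :=
  \sum_(k < U.+1) (T`_k * lead_coef f ^+ (U - k)) *: redXn f k.

Lemma redp_mod (f : {poly int}) r (H : nat) U (T : {poly int}) :
  size f = r.+1 -> (0 < r)%N -> (1 <= H)%N -> (forall i, `|f`_i| <= H%:Z) ->
  (size T <= U.+1)%N ->
  exists g, lead_coef f ^+ U *: T = redp f U T + g * f.
Proof.
move=> sf r0 H0 hf sT; pose a0 := lead_coef f.
have hk (k : 'I_U.+1) : exists g, a0 ^+ U *: (T`_k *: 'X^k) =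
    (T`_k * a0 ^+ (U - k)) *: redXn f k + g * f.
  have [_ _ [q hq]] := redXnP sf r0 H0 hf k.
  exists ((T`_k * a0 ^+ (U - k)) *: q).
  rewrite -scalerAl -scalerDr -hq !scalerA -/a0; congr (_ *: _).
  have -> : a0 ^+ U = a0 ^+ (U - k) * a0 ^+ k by rewrite -exprD subnK // -ltnS ltn_ord.
  ring.
have {1}-> : T = \sum_(k < U.+1) T`_k *: 'X^k.
  apply/polyP => i; rewrite -poly_def coef_poly; case: ltnP => // h.
  by rewrite nth_default //; apply: leq_trans sT _.
rewrite scaler_sumr /redp -/a0.
elim/big_ind2: _ => [|x y u v [g hg] [g' hg']|k _]; first by exists 0; rewrite mul0r addr0.
  by exists (g + g'); rewrite hg hg' mulrDl addrACA.
exact: hk.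
Qed.

Lemma redpD f U T T' : redp f U (T + T') = redp f U T + redp f U T'.
Proof. by rewrite /redp -big_split /=; apply: eq_bigr => k _; rewrite coefD mulrDl scalerDl. Qed.

Lemma redpZ f U c T : redp f U (c *: T) = c *: redp f U T.
Proof. by rewrite /redp scaler_sumr; apply: eq_bigr => k _; rewrite coefZ -mulrA scalerA. Qed.

Lemma redp_sum f U I (s : seq I) (P : pred I) (F : I -> {poly int}) :
  redp f U (\sum_(i <- s | P i) F i) = \sum_(i <- s | P i) redp f U (F i).
Proof.
elim/big_rec2: _ => [|i u v _ <-]; last by rewrite redpD.
by rewrite /redp big1 // => k _; rewrite coef0 mul0r scale0r.
Qed.

Lemma redp_Xn_bound (f : {poly int}) r (H : nat) U k l :
  size f = r.+1 -> (0 < r)%N -> (1 <= H)%N -> (forall i, `|f`_i| <= H%:Z) ->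
  (k <= U)%N -> `|(redp f U 'X^k)`_l| <= ((2 * H) ^ U)%N%:Z.
Proof.
move=> sf r0 H0 hf kU.
have [_ hp _] := redXnP sf r0 H0 hf k.
have kU1 : (k < U.+1)%N by [].
rewrite /redp (bigD1 (Ordinal kU1)) //= big1 => [|i ik]; last first.
  rewrite coefXn; case: eqP => [e|_]; last by rewrite mul0r scale0r.
  by case/eqP: ik; apply/val_inj.
rewrite addr0 coefXn eqxx mul1r coefZ normrM.
have -> : ((2 * H) ^ U)%N%:Z = ((2 * H) ^ (U - k))%N%:Z * ((2 * H) ^ k)%N%:Z.
  by rewrite -PoszM -expnD subnK.
apply: ler_pM => //; rewrite normrX -!natz natrX; apply: lerXn2r; rewrite ?nnegrE //.
by rewrite lead_coefE; apply: le_trans (hf _) _; rewrite natz lez_nat; lia.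
Qed.

Lemma size_nderivn_leq (S : nzSemiRingType) j (p : {poly S}) :
  (size p^`N(j) <= size p)%N.
Proof.
apply/leq_sizeP => k hk; rewrite coef_nderivn nth_default ?mul0rn //.
exact: leq_trans hk (leq_addl _ _).
Qed.

Lemma leq_bin_exp2 n k : ('C(n, k) <= 2 ^ n)%N.
Proof.
have [kn|nk] := leqP k n; last by rewrite bin_small.
rewrite -[2%N]/(1 + 1)%N Pascal (bigD1 (inord k)) //= inordK // !exp1n !muln1.
exact: leq_addr.
Qed.

(* Thue's auxiliary polynomial A(X) - Y B(X) vanishes to order 16 m at (a, a) for
   every root a of f; its 2 U coefficients outnumber the 16 m r conditions. *)
Lemma aux_poly (f : {poly int}) r (H m : nat) :
  size f = r.+1 -> (0 < r)%N -> (1 <= H)%N -> (forall i, `|f`_i| <= H%:Z) -> (0 < m)%N ->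
  let U := (8 * r * m + m)%N in let Q := ((16 * H) ^ (8 * r * U))%N in
  exists A B : {poly int}, [/\ (size A <= U)%N /\ (size B <= U)%N, A != 0 \/ B != 0,
    forall i, `|A`_i| <= Q%:Z /\ `|B`_i| <= Q%:Z &
    forall j, (j < 16 * m)%N -> exists c g, c != 0 /\
      c *: (A^`N(j) - 'X * B^`N(j)) = g * f].
Proof.
move=> sf r0 H0 hf m0 U Q.
have U0 : (0 < U)%N by rewrite /U; lia.
pose I := (bool * 'I_U)%type; pose J := ('I_(16 * m) * 'I_r)%type.
pose T (i : I) (j : nat) : {poly int} :=
  if i.1 then ('X^(i.2))^`N(j) else (-1) *: ('X * ('X^(i.2))^`N(j)).
pose phi (i : I) (j : J) : int := (redp f U (T i j.1))`_j.2.
pose Z := (Q * (8 * H) ^ U)%N.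
have hphi i j : (`|phi i j| <= (4 * H) ^ U)%N.
  rewrite -lez_nat abszE /phi.
  have hb k l b : (k + b <= U)%N ->
      `|(redp f U ('C(k, l)%:Z *: 'X^(k - l + b)))`_j.2| <= ((4 * H) ^ U)%N%:Z.
    move=> kU; rewrite redpZ coefZ normrM.
    have -> : ((4 * H) ^ U)%N%:Z = (2 ^ U)%N%:Z * ((2 * H) ^ U)%N%:Z.
      by rewrite -PoszM -expnMn mulnA.
    apply: ler_pM => //; last by apply: (redp_Xn_bound _ sf) => //; lia.
    rewrite ger0_norm // lez_nat; apply: leq_trans (leq_bin_exp2 _ _) _.
    by rewrite leq_exp2l //; lia.
  rewrite /T; case: i => -[] i /=; rewrite nderivnXn -scaler_nat natz.
    by have := hb i j.1 0%N; rewrite !addn0; apply; exact: ltnW.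
  rewrite redpZ coefZ normrM normrN1 mul1r -scalerAr -exprS -[(i - j.1).+1]addn1.
  by apply: hb; rewrite addn1.
have [||t [[[b i] ht0] htQ ht]] := @siegel_lemma I J Q Z phi.
(* A condition sums 2 U terms of size at most (4 H)^U, and 2 U <= 2^U yields the factor (8 H)^U of
   [Z]. *)
- move=> j; rewrite /Z mulnC leq_mul2l; apply/orP; right.
  apply: leq_trans (_ : \sum_(i : I) (4 * H) ^ U <= _)%N.
    by apply: leq_sum.
  rewrite sum_nat_const card_prod card_bool card_ord.
  have -> : (8 * H = 2 * (4 * H))%N by lia.
  rewrite [leqRHS]expnMn leq_mul2r; apply/orP; right.
  elim: (U) U0 => // -[//|u] IH _; rewrite expnS; lia.
- rewrite !card_prod card_bool !card_ord.
  have h1 : (2 * Z + 1 <= (16 * H) ^ U * (Q + 1))%N.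
    have e : (16 * H = 2 * (8 * H))%N by lia.
    rewrite e expnMn /Z.
    have : (2 <= 2 ^ U)%N by rewrite -{1}[2%N]expn1 leq_exp2l.
    have : (1 <= (8 * H) ^ U)%N by rewrite expn_gt0; lia.
    move: (2 ^ U)%N ((8 * H) ^ U)%N => x y; nia.
  apply: leq_ltn_trans (_ : ((16 * H) ^ U * (Q + 1)) ^ (16 * m * r) < _)%N.
    by rewrite leq_exp2r //; lia.
  (* There are 2 m more unknowns than conditions. After cancellation it remains to see that (16
     H)^(16 m r U) < (Q + 1)^(2 m), and [Q] is chosen so that Q^(2 m) equals the left side. *)
  have e : (2 * U = 2 * m + 16 * m * r)%N by rewrite /U; lia.
  rewrite expnMn e expnD ltn_pmul2r ?expn_gt0 ?addn1 //.
  apply: leq_ltn_trans (_ : Q ^ (2 * m) < _)%N; last by rewrite ltn_exp2r //; lia.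
  by rewrite /Q -!expnM leq_exp2l; lia.
pose co b k := if insub k is Some i then t (b, i) else 0.
have coE c (k : 'I_U) : co c k = t (c, k) by rewrite /co valK.
have coQ c k : `|co c k| <= Q%:Z.
  by rewrite /co; case: insub => [l|]; [exact: htQ|rewrite normr0].
exists (\poly_(k < U) co true k), (\poly_(k < U) co false k); split.
- by split; apply: size_poly.
- have hne c : t (c, i) != 0 -> \poly_(k < U) co c k != 0.
    apply: contraNneq => /(congr1 (fun p : {poly int} => p`_i)).
    by rewrite coef0 coef_poly ltn_ord coE => ->.
  by case: b ht0 => ht0; [left|right]; apply: hne.
- by move=> k; rewrite !coef_poly; case: ifP => _; rewrite ?normr0 ?coQ.
- move=> j hj; set A := \poly_(k < U) co true k; set B := \poly_(k < U) co false k.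
  have [g hg] : exists g, lead_coef f ^+ U *: (A^`N(j) - 'X * B^`N(j)) =
      redp f U (A^`N(j) - 'X * B^`N(j)) + g * f.
    apply: (redp_mod sf r0 H0 hf).
    apply: leq_trans (size_polyD _ _) _; rewrite size_polyN geq_max; apply/andP; split.
      apply: leq_trans (size_nderivn_leq _ _) _; apply: leq_trans (leqnSn _); exact: size_poly.
    apply: leq_trans (size_polyMleq _ _) _; rewrite size_polyX /=.
    apply: leq_trans (size_nderivn_leq _ _) _; exact: size_poly.
  exists (lead_coef f ^+ U), g; split.
    by rewrite expf_neq0 // lead_coef_eq0 -size_poly_eq0 sf.
  rewrite hg [redp _ _ _](_ : _ = 0) ?add0r //.
  have -> : A^`N(j) - 'X * B^`N(j) = \sum_i t i *: T i j.
    rewrite (eq_bigr (fun p => t (p.1, p.2) *: T (p.1, p.2) j)); last by case.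
    rewrite -(pair_bigA _ (fun c i => t (c, i) *: T (c, i) j)) /= big_bool /=.
    rewrite /A /B !poly_def !linear_sum /= mulr_sumr -sumrN; congr (_ + _).
      by apply: eq_bigr => k _; rewrite coE nderivnZ.
    by apply: eq_bigr => k _; rewrite coE nderivnZ /T /= -scalerAr scaleN1r scalerN.
  rewrite redp_sum; apply/polyP => l; rewrite coef0 coef_sum.
  have [lr|rl] := ltnP l r.
    have := ht (Ordinal hj, Ordinal lr); rewrite /phi /= => e; rewrite -[RHS]e.
    by apply: eq_bigr => k _; rewrite redpZ coefZ.
  apply: big1 => k _; rewrite redpZ coefZ [X in _ * X](_ : _ = 0) ?mulr0 //.
  rewrite /redp coef_sum big1 // => u _; rewrite coefZ [(redXn f u)`_l]nth_default ?mulr0 //.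
  by have [su _ _] := redXnP sf r0 H0 hf u; exact: leq_trans su rl.
Qed.

(** * Wronskians and zeros of high order *)

Definition wronskian (S : comNzRingType) (A B : {poly S}) := A * B^`() - A^`() * B.

Lemma wronskian_subZ (S : comNzRingType) (A B : {poly S}) c :
  wronskian (A - c *: B) B = wronskian A B.
Proof. by rewrite /wronskian derivB derivZ -!mul_polyC; ring. Qed.

Lemma nderivn_dvd (K : idomainType) (E : {poly K}) a n :
  (forall j, (j < n)%N -> root E^`N(j) a) -> ('X - a%:P) ^+ n %| E.
Proof.
move=> h.
have -> : E = \sum_(i < size E) (E^`N(i).[a])%:P * ('X - a%:P) ^+ i.
  rewrite -[LHS]comp_polyXr -[X in _ \Po X](subrKC a%:P) /comp_poly.
  rewrite nderiv_taylor ?size_map_polyC; last exact: mulrC.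
  by apply: eq_bigr => i _; rewrite nderivn_map horner_map.
elim/big_ind: _ => [|p q hp hq|i _]; first exact: dvdp0.
  exact: dvdp_add.
have [hi|hi] := ltnP i n; first by rewrite (rootP (h i hi)) mul0r dvdp0.
by rewrite dvdp_mull // dvdp_exp2l.
Qed.

(** The Wronskian does not change when A becomes A - c B, which vanishes to order n at a;
    differentiation loses one order. *)
Lemma wronskian_dvd (K : fieldType) (A B : {poly K}) c a n :
  (forall j, (j < n)%N -> (A^`N(j) - c *: B^`N(j)).[a] = 0) ->
  ('X - a%:P) ^+ n.-1 %| wronskian A B.
Proof.
move=> h; rewrite -(wronskian_subZ A B c).
have /dvdpP[q ->] : ('X - a%:P) ^+ n %| A - c *: B.
  apply: nderivn_dvd => j hj; rewrite rootE -(h j hj).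
  by rewrite linearB linearZ.
case: n {h} => [|n]; first by rewrite expr0 dvd1p.
rewrite /wronskian derivM deriv_exp /= derivXsubC mul1r.
apply: dvdp_sub.
  by rewrite exprS; apply: dvdp_mulr; apply: dvdp_mull; apply: dvdp_mull.
apply: dvdp_mulr; apply: dvdp_add.
  by rewrite exprS; apply: dvdp_mull; apply: dvdp_mull.
by rewrite -mulr_natl; apply: dvdp_mull; apply: dvdp_mull.
Qed.

Lemma prod_XsubC_exp_dvd (K : idomainType) (s : seq K) (e : K -> nat) (W : {poly K}) :
  uniq s -> (forall a, a \in s -> ('X - a%:P) ^+ e a %| W) ->
  \prod_(a <- s) ('X - a%:P) ^+ e a %| W.
Proof.
elim: s => [|a s IH] /=; first by rewrite big_nil dvd1p.
case/andP=> ha us h; rewrite big_cons Gauss_dvdp.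
  rewrite h ?mem_head // IH // => b bs; apply: h; by rewrite inE bs orbT.
apply: coprimep_expl; rewrite coprimep_sym coprimep_XsubC.
apply/negP => /rootP; rewrite horner_prod => /eqP.
rewrite prodf_seq_eq0 => /hasP[b bs] /=; rewrite horner_exp expf_eq0 => /andP[_].
by rewrite !hornerE subr_eq0 => /eqP ab; move: ha; rewrite ab bs.
Qed.

Lemma size_prod_XsubC_exp (K : idomainType) (s : seq K) (e : K -> nat) :
  size (\prod_(a <- s) ('X - a%:P) ^+ e a) = (\sum_(a <- s) e a).+1.
Proof.
elim: s => [|a s IH]; first by rewrite !big_nil size_poly1.
have nz (b : K) n : ('X - b%:P) ^+ n != 0 by rewrite expf_neq0 // polyXsubC_eq0.
rewrite !big_cons size_mul //; last by rewrite prodf_seq_neq0; apply/allP => b _; apply/implyP.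
by rewrite IH size_exp_XsubC addSn addnS.
Qed.

Lemma size_wronskian (S : comNzRingType) (A B : {poly S}) U :
  (size A <= U.+1)%N -> (size B <= U.+1)%N -> (size (wronskian A B) <= U.*2)%N.
Proof.
have sd (p : {poly S}) : (size p <= U.+1)%N -> (size p^`() <= U)%N.
  move=> sp; have [->|p0] := eqVneq p 0; first by rewrite deriv0 size_poly0.
  by rewrite -ltnS; apply: leq_trans (lt_size_deriv p0) sp.
move=> sA sB; apply: leq_trans (size_polyD _ _) _; rewrite size_polyN geq_max.
apply/andP; split; apply: leq_trans (size_polyMleq _ _) _; rewrite -subn1 leq_subLR.
  by apply: leq_trans (leq_add sA (sd _ sB)) _; lia.
by apply: leq_trans (leq_add (sd _ sA) sB) _; lia.
Qed.

Lemma size_deriv_char0 (K : numDomainType) (p : {poly K}) : size p^`() = (size p).-1.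
Proof.
have [->|p0] := eqVneq p 0; first by rewrite deriv0 size_poly0.
apply/anti_leq/andP; split.
  by rewrite -ltnS prednK ?size_poly_gt0 //; apply: lt_size_deriv.
case e : (size p) => [|[|n]] //=; rewrite ltnNge; apply/negP => h.
have := coef_deriv p n; rewrite nth_default // => /esym/eqP; rewrite mulrn_eq0 /=.
by have := lead_coefE p; rewrite e /= => <-; rewrite lead_coef_eq0 (negbTE p0).
Qed.

Lemma lead_coef_deriv_char0 (K : numDomainType) (p : {poly K}) :
  lead_coef p^`() = lead_coef p *+ (size p).-1.
Proof.
rewrite !lead_coefE size_deriv_char0 coef_deriv.
case e : (size p) => [|[|n]] //=; first by rewrite nth_default ?mul0rn ?e.
by rewrite nth_default ?mul0rn ?e.
Qed.

Lemma wronskian_eq0_size (K : numDomainType) (A B : {poly K}) :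
  A != 0 -> B != 0 -> wronskian A B = 0 -> size A = size B.
Proof.
move=> A0 B0 /eqP; rewrite subr_eq0 => /eqP /(congr1 lead_coef).
rewrite !lead_coefM !lead_coef_deriv_char0 mulrnAr mulrnAl -[X in X = _]mulr_natr -[X in _ = X]mulr_natr => e.
have : (size B).-1 = (size A).-1.
  apply/eqP; rewrite -(eqr_nat K); apply/eqP; move: e; apply: mulfI.
  by rewrite mulf_neq0 // lead_coef_eq0.
by move: A0 B0; rewrite -!size_poly_gt0; case: (size A) (size B) => [|a] [|b] //= _ _ ->.
Qed.

(** The combination of A and B that cancels the leading terms has smaller degree than B, but still a
    zero Wronskian with B. Non-zero polynomials with zero Wronskian have equal degrees, so this
    combination is 0. *)
Lemma wronskian_eq0 (K : numDomainType) (A B : {poly K}) :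
  wronskian A B = 0 -> exists2 c, c.1 != 0 \/ c.2 != 0 & c.1 *: A = c.2 *: B.
Proof.
move=> W0.
have [->|A0] := eqVneq A 0; first by exists (1, 0); [left; exact: oner_neq0|rewrite scaler0 scale0r].
have [->|B0] := eqVneq B 0; first by exists (0, 1); [right; exact: oner_neq0|rewrite scaler0 scale0r].
have sAB := wronskian_eq0_size A0 B0 W0.
exists (lead_coef B, lead_coef A) => /=; first by left; rewrite lead_coef_eq0.
apply/eqP; rewrite -subr_eq0; set D := _ - _.
apply: contraT => D0.
have WD : wronskian D B = 0.
  rewrite /D wronskian_subZ /wronskian derivZ -!scalerAl -scalerBr.
  by rewrite -/(wronskian A B) W0 scaler0.
have := wronskian_eq0_size D0 B0 WD => sD.
have : (size D < size B)%N.
  rewrite -(prednK (n := size B)) ?size_poly_gt0 // ltnS.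
  apply/leq_sizeP => j; rewrite leq_eqVlt => /orP[/eqP<-|hj].
    by rewrite coefB !coefZ -lead_coefE -[in A`__]sAB -lead_coefE mulrC subrr.
  rewrite coefB !coefZ !nth_default ?mulr0 ?subrr //; move: hj; rewrite ?sAB; case: (size B) => //.
by rewrite sD ltnn.
Qed.

Lemma high_order_eq0 (K : numFieldType) (P : {poly K}) n (als : seq K) :
  uniq als -> (forall a j, a \in als -> (j < n)%N -> root P^`N(j) a) ->
  (size P <= n * size als)%N -> P = 0.
Proof.
move=> ua hP sP; apply/eqP; apply: contraLR sP => P0; rewrite -ltnNge.
have hd : \prod_(a <- als) ('X - a%:P) ^+ n %| P.
  by apply: (prod_XsubC_exp_dvd (e := fun=> n)) => // a aa; apply: nderivn_dvd => j; apply: hP.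
apply: leq_trans (dvdp_leq P0 hd).
by rewrite (size_prod_XsubC_exp _ (fun=> n)) big_const_seq count_predT iter_addn_0.
Qed.

(* The Wronskian of A and B vanishes to order n - 1 at every root and to order k
   at x1, so that its degree bounds k. *)
Lemma aux_nonvanishing (K : numFieldType) (A B : {poly int}) U n k (als : seq K) (x1 x2 : K) :
  let AK := map_poly intr A : {poly K} in let BK := map_poly intr B : {poly K} in
  (size A <= U.+1)%N -> (size B <= U.+1)%N -> A != 0 \/ B != 0 -> uniq als ->
  (forall a j, a \in als -> (j < n)%N -> (AK^`N(j) - a *: BK^`N(j)).[a] = 0) ->
  (forall a (u v : int), a \in als -> u != 0 -> u%:~R * a != v%:~R) ->
  x1 \notin als -> (U < n * size als)%N ->
  (forall j, (j <= k)%N -> (AK^`N(j) - x2 *: BK^`N(j)).[x1] = 0) ->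
  (size als * n.-1 + k < U.*2)%N.
Proof.
move=> AK BK sA sB AB0 ua hal irr x1al hU hk.
have inj0 (P : {poly int}) : (map_poly intr P == 0 :> {poly K}) = (P == 0).
  rewrite -(inj_eq (map_inj_poly (@intr_inj K) (erefl _))) rmorph0 //.
have sK (P : {poly int}) : (size P <= U.+1)%N -> (size (map_poly intr P : {poly K})%R <= n * size als)%N.
  by move=> sP; apply: leq_trans (size_poly _ _) _; apply: leq_trans sP hU.
have WK : wronskian AK BK = map_poly intr (wronskian A B).
  by rewrite /wronskian rmorphB !rmorphM /= !deriv_map.
(* Otherwise c A = d B with integers c and d. As no root is rational, B would vanish to order n at
   every root, more than its degree allows, and A with it; for c = 0 it is A that vanishes too
   often. *)
have W0 : wronskian A B != 0.
  apply/negP => /eqP W0; have [[c d] /= cd e] := wronskian_eq0 W0.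
  have [c0|c0] := eqVneq c 0.
    have B0 : B = 0.
      case: cd; rewrite ?c0 ?eqxx // => d0; move/esym/eqP: e.
      by rewrite c0 scale0r scale_poly_eq0 (negbTE d0) => /eqP.
    suff : A = 0 by case: AB0 => /eqP.
    apply/eqP; rewrite -inj0; apply/eqP; apply: (high_order_eq0 ua) (sK _ sA) => a j aa jn.
    have := hal a j aa jn; rewrite /BK B0 rmorph0 linear0 scaler0 subr0 => /eqP.
    by rewrite -rootE.
  have B0 : B = 0.
    apply/eqP; rewrite -inj0; apply/eqP; apply: (high_order_eq0 ua) (sK _ sB) => a j aa jn.
    have := hal a j aa jn => /(congr1 ( *%R (c%:~R))); rewrite mulr0 -hornerZ scalerBr.
    rewrite -linearZ /= scalerA -[(c%:~R : K) *: AK]/(intr c *: map_poly intr A) -map_polyZ.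
    rewrite e map_polyZ /= linearZ /= -scalerBl hornerZ => /eqP.
    rewrite mulf_eq0 subr_eq0 eq_sym (negbTE (irr _ _ _ aa c0)) /=.
    by rewrite rootE.
  suff : A = 0 by case: AB0 => /eqP.
  by move/eqP: e; rewrite B0 scaler0 scale_poly_eq0 (negbTE c0) => /eqP.
pose e a := if a == x1 then k else n.-1.
have hd : \prod_(a <- x1 :: als) ('X - a%:P) ^+ e a %| wronskian AK BK.
  apply: prod_XsubC_exp_dvd; first by rewrite /= x1al.
  move=> a; rewrite inE /e; case: eqVneq => [->|ax] /= aa.
    by apply: (@wronskian_dvd _ _ _ x2 _ k.+1) => j; apply: hk.
  by apply: (@wronskian_dvd _ _ _ a) => j; apply: hal.
have := dvdp_leq _ hd; rewrite WK inj0 W0 => /(_ isT).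
rewrite size_prod_XsubC_exp big_cons /e eqxx.
have -> : (\sum_(j <- als) (if j == x1 then k else n.-1) = size als * n.-1)%N.
  rewrite (eq_big_seq (fun=> n.-1)); first by rewrite big_const_seq count_predT iter_addn_0 mulnC.
  by move=> a aa; case: eqP => // ax; move: x1al; rewrite -ax aa.
move=> h; rewrite addnC; apply: leq_trans h _.
apply: leq_trans (size_poly _ _) _; exact: size_wronskian.
Qed.

Lemma nderivn_comp (K : nzRingType) (p : {poly K}) k j :
  (p^`N(k))^`N(j) = p^`N(k + j) *+ 'C(k + j, k).
Proof.
apply/polyP => i; rewrite coefMn !coef_nderivn -!mulrnA addnA; congr (_ *+ _).
have e : ('C(k + j + i, k) * 'C(j + i, j) * (k`! * j`! * i`!) =
          'C(k + j + i, k + j) * 'C(k + j, k) * (k`! * j`! * i`!))%N.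
  have h1 : ('C(k + j + i, k) * (k`! * (j + i)`!) = (k + j + i)`!)%N.
    have := @bin_fact (k + j + i) (k); rewrite (_ : ((k + j + i) - (k) = j + i)%N); last lia.
    by apply; lia.
  have h2 : ('C(j + i, j) * (j`! * i`!) = (j + i)`!)%N.
    have := @bin_fact (j + i) (j); rewrite (_ : ((j + i) - (j) = i)%N); last lia.
    by apply; lia.
  have h3 : ('C(k + j + i, k + j) * ((k + j)`! * i`!) = (k + j + i)`!)%N.
    have := @bin_fact (k + j + i) (k + j); rewrite (_ : ((k + j + i) - (k + j) = i)%N); last lia.
    by apply; lia.
  have h4 : ('C(k + j, k) * (k`! * j`!) = (k + j)`!)%N.
    have := @bin_fact (k + j) (k); rewrite (_ : ((k + j) - (k) = j)%N); last lia.
    by apply; lia.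
  rewrite -h2 in h1; rewrite -h4 in h3; nia.
by move/eqP: e; rewrite eqn_pmul2r ?muln_gt0 ?fact_gt0 // => /eqP.
Qed.

Lemma normc_nat (R : rcfType) n : normc (n%:R : R[i]) = n%:R.
Proof. by have := normc_int R n. Qed.

Lemma normc_mulrn (R : rcfType) (z : R[i]) n : normc (z *+ n) = n%:R * normc z.
Proof. by rewrite -[z *+ n]mulr_natl Normc.normcM normc_nat. Qed.

Lemma horner_normc_le (R : rcfType) (p : {poly R[i]}) n (c b : R) z :
  (size p <= n)%N -> 1 <= b -> (forall i, normc p`_i <= c) -> normc z <= b ->
  normc p.[z] <= n%:R * (c * b ^+ n).
Proof.
move=> sp b1 hc hz; rewrite (horner_coef_wide _ sp).
apply: le_trans (normc_sum _ _ _) _.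
apply: le_trans (_ : \sum_(i < n) c * b ^+ n <= _); last by rewrite sumr_const card_ord mulr_natl.
apply: ler_sum => i _; rewrite Normc.normcM normcX.
apply: ler_pM; rewrite ?normc_ge0 ?exprn_ge0 ?normc_ge0 //.
apply: le_trans (_ : b ^+ i <= _).
  by apply: lerXn2r; rewrite ?nnegrE ?normc_ge0 //; lra.
by apply: ler_weXn2l => //; exact: ltnW.
Qed.

Lemma nderivn_coef_le (R : rcfType) (p : {poly R[i]}) U k (c : R) :
  (size p <= U)%N -> (forall i, normc p`_i <= c) ->
  forall i, normc (p^`N(k))`_i <= 2 ^+ U * c.
Proof.
move=> sp hc i; rewrite coef_nderivn normc_mulrn.
have c0 : 0 <= c by apply: le_trans (hc 0%N); exact: normc_ge0.
have [h|h] := ltnP (k + i) U; last first.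
  by rewrite nth_default ?Normc.normc0 ?mulr0 ?mulr_ge0 ?exprn_ge0 //; apply: leq_trans h.
apply: ler_pM; rewrite ?normc_ge0 ?ler0n //.
rewrite -natrX ler_nat; apply: leq_trans (leq_bin_exp2 _ _) _.
by rewrite leq_exp2l //; exact: ltnW.
Qed.

Lemma leq_exp2 n : (n <= 2 ^ n)%N.
Proof. by apply: ltnW; exact: ltn_expl. Qed.

(** The numerical side of [aux_nonvanishing] for the degree bound U - 1: the zeros at the roots take
    r (16 m - 1) of the degree of the Wronskian, so that at the first approximation some derivative
    of order at most 2 m + r survives. *)
Lemma thue_degree_bounds r m : (2 <= r)%N -> (0 < m)%N ->
  ((8 * r * m + m).-1 < 16 * m * r)%N /\
  ~ (r * (16 * m).-1 + (2 * m + r) < (8 * r * m + m).-1.*2)%N.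
Proof.
move=> r2 m0; have rm : (m <= r * m)%N by rewrite leq_pmull; lia.
have e : (8 * r * m + m = (8 * r * m + m).-1.+1)%N by rewrite prednK //; lia.
by split; move: rm e; nia.
Qed.

Lemma thue_exponent_bound r m k j :
  (k <= 2 * m + r)%N -> (16 * m <= k + j)%N -> (14 * m - r <= j)%N.
Proof. lia. Qed.

Lemma thue_exponent_split r u : (9 * r * u = 8 * r * u + r * u)%N.
Proof. by rewrite -!mulnA -mulSnr. Qed.

(** Here [u], [t] and [h] stand for U, 2^U and H^U: the polynomial factors in U are absorbed by
    powers of 2^U. *)
Lemma thue_constants (R : realFieldType) (H h t u Q : R) :
  1 <= H -> H <= h -> 2 <= t -> 0 <= u -> u <= t -> 0 <= Q ->
  u * (t * Q * (t * h)) <= Q * (t ^+ 8 * h ^+ 2) /\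
  u * (u * (t * (t * (2 * H * Q)) * h)) <= Q * (t ^+ 8 * h ^+ 2).
Proof.
move=> H1 Hh t2 u0 ut Q0.
have t0 : 0 <= t by lra.
have t1 : 1 <= t by lra.
have h0 : 0 <= h by lra.
have pw n : (n <= 8)%N -> t ^+ n <= t ^+ 8 by move=> ?; apply: ler_weXn2l.
have hh : h <= h ^+ 2 by rewrite expr2 ler_peMl //; lra.
have uu : u * u <= t * t by apply: ler_pM.
split.
  rewrite [leLHS](_ : _ = Q * ((u * t ^+ 2) * h)); last by ring.
  apply: ler_wpM2l => //; apply: ler_pM; rewrite ?mulr_ge0 ?exprn_ge0 //.
  by apply: le_trans (pw 3%N isT); rewrite [leRHS]exprS; apply: ler_wpM2r; rewrite ?exprn_ge0.
rewrite [leLHS](_ : _ = Q * ((u * u * 2 * t ^+ 2) * (H * h))); last by ring.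
apply: ler_wpM2l => //; apply: ler_pM; rewrite ?mulr_ge0 ?exprn_ge0 //; try lra.
  apply: le_trans (pw 5%N isT); rewrite (_ : t ^+ 5 = t * t * t * t ^+ 2); last by ring.
  apply: ler_wpM2r; first exact: exprn_ge0.
  by apply: ler_pM; rewrite ?mulr_ge0.
by rewrite expr2; apply: ler_wpM2r.
Qed.

(** For some k <= 2 m + r, clearing denominators in A_k(x1/y1) - (x2/y2) B_k(x1/y1), with k-th
    divided derivatives, gives a non-zero integer. In its upper bound, A - al B vanishes at al to
    order at least 16 m - k >= 14 m - r, which yields the power of [d1]; replacing al by x2/y2
    yields [d2]. *)
Lemma thue_power (R : rcfType) (f : {poly int}) r (H m : nat) (als : seq R[i]) (al : R[i])
    (x1 y1 x2 y2 : int) (X1 X2 d1 d2 : R) :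
  let U := (8 * r * m + m)%N in
  (2 <= r)%N -> size f = r.+1 -> (1 <= H)%N -> (forall i, `|f`_i| <= H%:Z) -> (0 < m)%N ->
  size als = r -> uniq als -> (forall a, a \in als -> root (map_poly intr f) a) ->
  (forall a (u v : int), a \in als -> u != 0 -> u%:~R * a != v%:~R) ->
  al \in als -> normc al <= H%:R -> y1 != 0 -> y2 != 0 ->
  `|y1|%:~R <= X1 -> `|y2|%:~R <= X2 ->
  normc (x1%:~R / y1%:~R - al) <= d1 -> d1 <= 1 ->
  normc (x2%:~R / y2%:~R - al) <= d2 ->
  1 <= X1 ^+ U.-1 * X2 * (16 * H)%:R ^+ (9 * r * U) * (d1 ^+ (14 * m - r) + d2).
Proof.
move=> U r2 sf H0 hf m0 sals uals rals irr hal nal y10 y20 hX1 hX2 hd1 d11 hd2.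
have r0 : (0 < r)%N by lia.
have U0 : (0 < U)%N by rewrite /U; lia.
set xi1 := (x1%:~R / y1%:~R : R[i]) in hd1 *; set xi2 := (x2%:~R / y2%:~R : R[i]) in hd2 *.
have yC (y : int) : y != 0 -> (y%:~R : R[i]) != 0 by rewrite intr_eq0.
have [A [B [[sA sB] AB0 hQ hv]]] := aux_poly sf r0 H0 hf m0.
rewrite -/U in sA sB.
set Q := ((16 * H) ^ _)%N in hQ.
pose AK : {poly R[i]} := map_poly intr A; pose BK : {poly R[i]} := map_poly intr B.
have hal0 a j : a \in als -> (j < 16 * m)%N -> (AK^`N(j) - a *: BK^`N(j)).[a] = 0.
  move=> aa jm; have [c [g [c0 e]]] := hv j jm.
  have := congr1 (fun p => (map_poly intr p : {poly R[i]}).[a]) e => /=.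
  rewrite map_polyZ rmorphB !rmorphM /= map_polyX -!nderivn_map hornerZ hornerM.
  rewrite (rootP (rals a aa)) mulr0 => /eqP; rewrite mulf_eq0 intr_eq0 (negbTE c0) /=.
  by rewrite !hornerE /= => /eqP.
have [k kle Vk0] : exists2 k, (k <= 2 * m + r)%N & (AK^`N(k) - xi2 *: BK^`N(k)).[xi1] != 0.
  have [/'forall_eqP hall|] := boolP
      [forall j : 'I_(2 * m + r).+1, (AK^`N(j) - xi2 *: BK^`N(j)).[xi1] == 0]; last first.
    by rewrite negb_forall => /existsP[j hj]; exists (j : nat) => //; rewrite -ltnS.
  have xal : xi1 \notin als.
    apply/negP => xa; have := irr xi1 y1 x1 xa y10.
    by rewrite /xi1 mulrC divfK ?eqxx // yC.
  have hk j : (j <= 2 * m + r)%N -> (AK^`N(j) - xi2 *: BK^`N(j)).[xi1] = 0.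
    by rewrite -ltnS => jk; exact: (hall (Ordinal jk)).
  have sz (P : {poly int}) : (size P <= U)%N -> (size P <= U.-1.+1)%N by rewrite prednK.
  have [hU hdeg] := thue_degree_bounds r2 m0; rewrite -{2}sals -/U in hU.
  have := aux_nonvanishing (sz A sA) (sz B sB) AB0 uals hal0 irr xal hU hk.
  by rewrite sals.
pose N := hom U.-1 (A^`N(k)) x1 y1 * y2 - x2 * hom U.-1 (B^`N(k)) x1 y1.
have sz (P : {poly int}) : (size P <= U)%N -> (size (map_poly intr P : {poly R[i]})^`N(k) <= U)%N.
  by move=> sP; apply: leq_trans (size_nderivn_leq _ _) _; apply: leq_trans (size_poly _ _) sP.
have NE : N%:~R = y1%:~R ^+ U.-1 * y2%:~R * (AK^`N(k) - xi2 *: BK^`N(k)).[xi1].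
  rewrite /N rmorphB !rmorphM /= !hom_rmorph -!nderivn_map -/AK -/BK.
  rewrite !hom_field ?yC ?prednK ?sz // hornerD hornerN hornerZ -/xi1 /xi2.
  by field; exact: yC.
have N0 : N != 0.
  apply: contraNneq Vk0 => N0; move/esym/eqP: NE; rewrite N0 mulr0z.
  by rewrite !mulf_eq0 expf_eq0 !(negbTE (yC _ _)) // andbF.
have N1 : 1 <= normc (N%:~R : R[i]).
  by rewrite normc_int ler1z -gtz0_ge1 normr_gt0.
apply: le_trans N1 _; rewrite NE !Normc.normcM normcX !normc_int -!mulrA.
have X10 : 0 <= X1 by apply: le_trans hX1; rewrite ler0z.
have X20 : 0 <= X2 by apply: le_trans hX2; rewrite ler0z.
apply: ler_pM; [|by rewrite mulr_ge0 ?ler0z ?normc_ge0|by apply: lerXn2r; rewrite ?nnegrE ?ler0z|].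
  by rewrite exprn_ge0 // ler0z.
apply: ler_pM => //; rewrite ?ler0z ?normc_ge0 //.
have H1 : (1 : R) <= H%:R by rewrite ler1n.
have Q0 : (0 : R) <= Q%:R by rewrite ler0n.
have d10 : 0 <= d1 by apply: le_trans hd1; exact: normc_ge0.
have d20 : 0 <= d2 by apply: le_trans hd2; exact: normc_ge0.
have cQ (P : {poly int}) i : `|P`_i| <= Q%:Z -> normc (map_poly intr P : {poly R[i]})`_i <= Q%:R.
  by move=> h; rewrite coef_map /= normc_int -[Q%:R]/(Q%:Z%:~R) ler_int.
have cA i : normc AK`_i <= Q%:R by apply: cQ; case: (hQ i).
have cB i : normc BK`_i <= Q%:R by apply: cQ; case: (hQ i).
have sAK : (size AK <= U)%N by apply: leq_trans (size_poly _ _) sA.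
have sBK : (size BK <= U)%N by apply: leq_trans (size_poly _ _) sB.
have Bxi : normc (BK^`N(k)).[xi1] <= U%:R * (2 ^+ U * Q%:R * (2 * H%:R) ^+ U).
  apply: horner_normc_le; [exact: sz|lra|exact: nderivn_coef_le|].
  have -> : xi1 = (xi1 - al) + al by rewrite subrK.
  apply: le_trans (normc_le_add _ _) _; lra.
pose E := AK - al *: BK.
have sE : (size E <= U)%N.
  rewrite /E; apply: leq_trans (size_polyD _ _) _; rewrite size_polyN geq_max sAK /=.
  exact: leq_trans (size_scale_leq _ _) sBK.
have cE i : normc E`_i <= 2 * H%:R * Q%:R.
  rewrite /E coefB coefZ; apply: le_trans (le_normcB _ _) _; rewrite Normc.normcM.
  have := cA i; have := cB i; have := normc_ge0 BK`_i; have := normc_ge0 al; nra.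
have Exi : normc (E^`N(k)).[xi1] <=
    U%:R * (U%:R * (2 ^+ U * (2 ^+ U * (2 * H%:R * Q%:R)) * H%:R ^+ U)) * d1 ^+ (14 * m - r).
  have -> : xi1 = al + (xi1 - al) by rewrite addrC subrK.
  have sEk : (size E^`N(k) <= U)%N by apply: leq_trans (size_nderivn_leq _ _) sE.
  rewrite (nderiv_taylor_wide _ sEk); last exact: mulrC.
  apply: le_trans (normc_sum _ _ _) _.
  pose cst : R := U%:R * (2 ^+ U * (2 ^+ U * (2 * H%:R * Q%:R)) * H%:R ^+ U); rewrite -/cst.
  apply: le_trans (_ : \sum_(j < U) (cst * d1 ^+ (14 * m - r)) <= _); last first.
    by rewrite sumr_const card_ord -[X in X <= _]mulr_natl mulrA.
  apply: ler_sum => j _; rewrite Normc.normcM normcX.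
  have [kj|kj] := ltnP (k + j) (16 * m).
    rewrite nderivn_comp hornerMn.
    have -> : E^`N(k + j).[al] = 0 by rewrite /E linearB /= linearZ /= hal0.
    rewrite mul0rn Normc.normc0 mul0r.
    by rewrite !mulr_ge0 ?exprn_ge0 ?ler0n.
  apply: ler_pM; rewrite ?normc_ge0 ?exprn_ge0 ?normc_ge0 //.
    apply: horner_normc_le => //; first by apply: leq_trans (size_nderivn_leq _ _) sEk.
    by apply: nderivn_coef_le => //; apply: nderivn_coef_le.
  apply: le_trans (_ : d1 ^+ j <= _).
    by apply: lerXn2r; rewrite ?nnegrE ?normc_ge0.
  by apply: ler_wiXn2l => //; apply: thue_exponent_bound kle kj.
have -> : (AK^`N(k) - xi2 *: BK^`N(k)).[xi1] = E^`N(k).[xi1] + (al - xi2) * (BK^`N(k)).[xi1].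
  rewrite /E nderivnB nderivnZ !(hornerD, hornerN, hornerZ).
  move: (AK^`N(k)).[_] (BK^`N(k)).[_] => u v; ring.
apply: le_trans (normc_le_add _ _) _; rewrite Normc.normcM normcBC.
have UU : (U%:R : R) <= 2 ^+ U by rewrite -natrX ler_nat leq_exp2.
have hexp : (16 * H)%:R ^+ (9 * r * U) = Q%:R * (16 * H%:R : R) ^+ (r * U).
  by rewrite thue_exponent_split exprD /Q natrX natrM.
have hexp2 : (16 * H%:R : R) ^+ (2 * U) <= (16 * H%:R) ^+ (r * U).
  by apply: ler_weXn2l; [lra|rewrite leq_mul2r r2 orbT].
pose h := (H%:R : R) ^+ U; pose t := (2 : R) ^+ U.
have h1 : H%:R <= h by rewrite /h -[X in X <= _]expr1; apply: ler_weXn2l.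
have t1 : 2 <= t by rewrite /t -[X in X <= _]expr1; apply: ler_weXn2l => //; rewrite ler1n.
have hexp3 : (16 * H%:R : R) ^+ (2 * U) = t ^+ 8 * h ^+ 2.
  rewrite mulnC exprM exprMn exprMn /t /h; congr (_ * _).
  have e16 : (16 : R) = 2 ^+ 4 by rewrite -natrX.
  by rewrite e16 -!exprM mulnCA.
rewrite hexp3 in hexp2.
have [c1 c2] := thue_constants H1 h1 t1 (ler0n R U) UU Q0.
have b1 : U%:R * (2 ^+ U * Q%:R * (2 * H%:R) ^+ U) <= Q%:R * (16 * H%:R) ^+ (r * U) :> R.
  by rewrite exprMn; apply: le_trans c1 _; apply: ler_wpM2l.
have b2 : U%:R * (U%:R * (2 ^+ U * (2 ^+ U * (2 * H%:R * Q%:R)) * H%:R ^+ U))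
     <= Q%:R * (16 * H%:R) ^+ (r * U) :> R.
  by apply: le_trans c2 _; apply: ler_wpM2l.
rewrite hexp mulrDr; apply: lerD.
  apply: le_trans Exi _; apply: ler_wpM2r => //; exact: exprn_ge0.
by rewrite mulrC; apply: ler_pM; rewrite ?normc_ge0 //; exact: le_trans Bxi b1.
Qed.

Lemma expR_le_third (R : realType) (x : R) : x <= - 2 -> expR x <= 3^-1.
Proof.
move=> hx; rewrite -[x]opprK expRN lef_pV2 ?posrE ?expR_gt0 //.
by apply: le_trans (expR_ge1Dx _); lra.
Qed.

Lemma expR1_le4 (R : realType) : expR 1 <= 4 :> R.
Proof.
have h : expR (2^-1) <= 2 :> R.
  rewrite -[2^-1]opprK expRN -[leRHS]invrK lef_pV2 ?posrE ?expR_gt0 ?invr_gt0 //.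
  by apply: le_trans (expR_ge1Dx _); lra.
apply: (@le_trans _ _ (expR (2^-1) ^+ 2)).
  by rewrite -expRM_natl ler_expR; lra.
rewrite expr2; apply: le_trans (_ : 2 * 2 <= _); last by lra.
by apply: ler_pM; rewrite ?expR_ge0.
Qed.

(** The exponents of the two summands of [thue_power]. In units of r m l1 the main terms are 8 *
    209/200 = 8.36 against 13 * 17/20 = 11.05 in the first and against 11 * 17/20 = 9.35 in the
    second, which explains the ratio 11. *)
Lemma thue_numeric (R : realFieldType) (r m u n l1 l2 c : R) :
  100 <= r -> r <= m -> 1 <= c -> 200 * r * c <= l1 -> 0 <= u -> u <= 8 * r * m + m ->
  13 * m <= n -> 11 * m * l1 <= l2 -> l2 <= 11 * (m + 1) * l1 ->
  u * l1 + l2 + 9 * r * (8 * r * m + m) * c - n * (17 / 20 * r * l1) <= - 2 /\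
  u * l1 + l2 + 9 * r * (8 * r * m + m) * c - 17 / 20 * r * l2 <= - 2.
Proof.
move=> hr hm hc hl1 u0 hu hn hl2 hl2'.
have l12 : 2 <= l1 by apply: le_trans hl1; nra.
have l10 : 0 <= l1 by lra.
have rm : 100 * m <= r * m by apply: ler_wpM2r => //; lra.
have w0 : 0 <= 8 * r * m + m by nra.
have h1 : u * l1 <= (8 * r * m + m) * l1 by apply: ler_wpM2r.
have h2 : 9 * r * (8 * r * m + m) * c <= 9 / 200 * (8 * r * m + m) * l1.
  rewrite [leLHS](_ : _ = 9 / 200 * (8 * r * m + m) * (200 * r * c)); last by field.
  by apply: ler_wpM2l => //; rewrite mulr_ge0 //; lra.
split.
  have h3 : 13 * m * (17 / 20 * r * l1) <= n * (17 / 20 * r * l1).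
    by apply: ler_wpM2r => //; rewrite !mulr_ge0 //; lra.
  have h4 : l1 * (209 / 200 * (8 * (r * m) + m) + 11 * (m + 1) - 221 / 20 * (r * m)) <= l1 * (-1).
    by apply: ler_wpM2l; lra.
  lra.
have h3 : (17 / 20 * r - 1) * (11 * m * l1) <= (17 / 20 * r - 1) * l2.
  by apply: ler_wpM2l => //; lra.
have h4 : l1 * (209 / 200 * (8 * (r * m) + m) + 11 * m - 187 / 20 * (r * m)) <= l1 * (-1).
  by apply: ler_wpM2l; lra.
lra.
Qed.

Lemma truncn_ratio (R : realType) (r l1 l2 : R) (n : nat) :
  0 < l1 -> 11 * (n%:R + 1) * l1 <= l2 -> exists m : nat,
  [/\ (n <= m)%N, 11 * m%:R * l1 <= l2 & l2 <= 11 * (m%:R + 1) * l1].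
Proof.
move=> l1p h.
have a0 : 0 < 11 * l1 by lra.
have rho0 : 0 <= l2 / (11 * l1).
  apply: divr_ge0; last exact: ltW.
  by apply: le_trans h; rewrite mulr_ge0 ?(ltW l1p) ?mulr_ge0 ?addr_ge0 ?ler0n.
have /andP[] := truncn_itv rho0; set m := Num.truncn _; move: m => m hm1 hm2.
exists m; move: hm1 hm2; rewrite ler_pdivlMr // ltr_pdivrMr // -natr1 => hm1 hm2; split; try lra.
have h2 : (n%:R + 1) * (11 * l1) < (m%:R + 1) * (11 * l1) by lra.
by move: h2; rewrite ltr_pM2r // ltrD2r ltr_nat; exact: ltnW.
Qed.

(** If l2 >= 11 (r + 1) l1, the integer part m of l2 / (11 l1) is at least r. With this m both
    summands of [thue_power] are at most e^(-2) <= 1/3, and their sum cannot reach 1. *)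
Lemma thue_gap (R : realType) (f : {poly int}) r (H : nat) (als : seq R[i]) (al : R[i])
    (x1 y1 x2 y2 : int) (l1 l2 : R) :
  (100 <= r)%N -> size f = r.+1 -> (1 <= H)%N -> (forall i, `|f`_i| <= H%:Z) ->
  size als = r -> uniq als -> (forall a, a \in als -> root (map_poly intr f) a) ->
  (forall a (u v : int), a \in als -> u != 0 -> u%:~R * a != v%:~R) ->
  al \in als -> normc al <= H%:R -> y1 != 0 -> y2 != 0 ->
  `|y1|%:~R <= expR l1 -> `|y2|%:~R <= expR l2 ->
  normc (x1%:~R / y1%:~R - al) <= expR (- (17 / 20 * r%:R * l1)) ->
  normc (x2%:~R / y2%:~R - al) <= expR (- (17 / 20 * r%:R * l2)) ->
  200 * r%:R * ln (16 * H)%:R <= l1 -> l2 < 11 * (r%:R + 1) * l1.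
Proof.
move=> r100 sf H0 hf sals uals rals irr hal nal y10 y20 hX1 hX2 hd1 hd2 hl1.
rewrite ltNge; apply/negP => hl2.
have rr : (100 : R) <= r%:R by rewrite (ler_nat _ 100).
have H1 : (1 : R) <= H%:R by rewrite ler1n.
set c := ln _ in hl1.
have H16 : (16 : R) <= (16 * H)%:R by rewrite natrM; lra.
have c1 : 1 <= c.
  rewrite -(expRK (1 : R)) /c ler_ln ?posrE ?expR_gt0 //; last by lra.
  by apply: le_trans (expR1_le4 R) _; lra.
have l10 : 1 <= l1 by apply: le_trans hl1; nra.
have l1p : 0 < l1 by lra.
have [m [mr hm1 hm2]] := truncn_ratio r%:R l1p hl2.
have rm : (r%:R : R) <= m%:R by rewrite ler_nat.
have m0 : (0 < m)%N by apply: leq_trans mr; apply: leq_trans r100.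
have := @thue_power R f r H m als al x1 y1 x2 y2 (expR l1) (expR l2) _ _ (leq_trans _ r100)
  sf H0 hf m0 sals uals rals irr hal nal y10 y20 hX1 hX2 hd1 _ hd2.
move=> /(_ isT).
have -> : expR (- (17 / 20 * r%:R * l1)) <= 1.
  rewrite expR_le1 oppr_le0; apply: mulr_ge0; last lra.
  by apply: mulr_ge0; [lra|exact: ler0n].
move=> /(_ isT); apply/negP; rewrite -ltNge.
have hH : (16 * H)%:R = expR c by rewrite lnK // posrE; lra.
rewrite hH -!expRM_natl -!expRD mulrDr -!expRD.
have UR : (8 * r * m + m)%:R = 8 * r%:R * m%:R + m%:R :> R by rewrite natrD !natrM.
have U1R : ((8 * r * m + m).-1)%:R <= 8 * r%:R * m%:R + m%:R :> R.
  by rewrite -UR ler_nat; exact: leq_pred.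
have nR : (13 * m%:R : R) <= (14 * m - r)%:R.
  rewrite natrB; last by apply: leq_trans mr _; rewrite leq_pmull.
  by rewrite natrM; lra.
have [b1 b2] := thue_numeric rr rm c1 hl1 (ler0n _ _) U1R nR hm1 hm2.
apply: le_lt_trans (_ : 3^-1 + 3^-1 < _); last by lra.
rewrite 2!natrM UR; apply: lerD; apply: expR_le_third.
  by apply: le_trans b1; rewrite mulrN.
exact: b2.
Qed.

(** * Linear factors of a sparse form *)

(** The chain rule. By Euler's relation, (r + 1) f - X f' is the dehomogenised partial derivative in
    the second variable. *)
Lemma deriv_hom (S : comNzRingType) r (f : {poly S}) (u v : {poly S}) :
  (hom r.+1 (map_poly polyC f) u v)^`() =
  u^`() * hom r (map_poly polyC f^`()) u v +
  v^`() * hom r (map_poly polyC (f *+ r.+1 - 'X * f^`())) u v.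
Proof.
have cm (p : {poly S}) i : (map_poly polyC p)`_i = (p`_i)%:P by rewrite coef_map.
have -> : (hom r.+1 (map_poly polyC f) u v)^`() =
   \sum_(i < r.+2) (f`_i)%:P * (u ^+ i)^`() * v ^+ (r.+1 - i) +
   \sum_(i < r.+2) (f`_i)%:P * u ^+ i * (v ^+ (r.+1 - i))^`().
  rewrite /hom linear_sum -big_split /=; apply: eq_bigr => i _.
  by rewrite cm !derivM derivC mul0r add0r.
congr (_ + _).
  rewrite big_ord_recl expr0 derivC mulr0 mul0r add0r mulr_sumr.
  apply: eq_bigr => i _; rewrite lift0 cm subSS coef_deriv deriv_exp /= -mulr_natr.
  rewrite -[f`_i.+1 *+ _]mulr_natr rmorphM /= rmorph_nat; ring.
rewrite big_ord_recr /= subnn expr0 derivC mulr0 addr0 mulr_sumr.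
apply: eq_bigr => i _; rewrite cm coefB coefMn coefXM coef_deriv.
have hi : (i <= r)%N by rewrite -ltnS.
rewrite subSn // deriv_exp /= -[v^`() * _ *+ _]mulr_natr.
have -> : (f`_i *+ r.+1 - (if i == 0%N :> nat then 0 else f`_i.-1.+1 *+ i.-1.+1))%:P =
   (f`_i)%:P * (r - i).+1%:R.
  rewrite -subSn // natrB; last by apply: leqW.
  rewrite mulrBr rmorphB /=; congr (_ - _).
    by rewrite -[_ *+ r.+1]mulr_natr rmorphM /= rmorph_nat.
  case: (i : nat) => [|k]; first by rewrite mulr0.
  by rewrite -[_ *+ k.+1 in LHS]mulr_natr rmorphM /= rmorph_nat.
ring.
Qed.

Lemma nterms_deriv (S : numDomainType) m (p : {poly S}) :
  (nterms m p^`() <= nterms m.+1 p)%N.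
Proof.
rewrite /nterms [leqRHS]big_ord_recl; apply: leq_trans (leq_addl _ _).
by apply: leq_sum => i _; rewrite lift0 coef_deriv mulrn_eq0.
Qed.

Lemma nterms_lincomb (S : idomainType) m (p q g : {poly S}) :
  (forall i, p`_i = 0 -> q`_i = 0 -> g`_i = 0) ->
  (nterms m g <= nterms m p + nterms m q)%N.
Proof.
move=> h; rewrite -big_split /=; apply: leq_sum => i _.
have [p0|_] := eqVneq p`_i 0; last by rewrite add1n; case: (_ != _).
by have [q0|_] := eqVneq q`_i 0; [rewrite h // eqxx|case: (_ != _)].
Qed.

Lemma hom_linear_roots (S K : comNzRingType) (phi : {rmorphism S -> K}) r (f : {poly S})
    (a0 : K) (al : 'I_r -> K) (a b c d : S) :
  map_poly phi f = a0 *: \prod_(i < r) ('X - (al i)%:P) ->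
  map_poly phi (hom r (map_poly polyC f) (a *: 'X + b%:P) (c *: 'X + d%:P)) =
  a0 *: \prod_(i < r) ((phi a - al i * phi c) *: 'X + (phi b - al i * phi d)%:P).
Proof.
move=> hf; rewrite hom_rmorph /= -map_poly_comp.
rewrite (eq_map_poly (g := polyC \o phi)); last by move=> x /=; rewrite map_polyC.
rewrite map_poly_comp hf.
have -> : map_poly polyC (a0 *: \prod_(i < r) ('X - (al i)%:P)) =
   a0%:P *: \prod_(z <- [seq (al i)%:P | i <- enum 'I_r]) ('X - z%:P).
  rewrite map_polyZ rmorph_prod /= big_map big_enum /=; congr (_ *: _).
  by apply: eq_bigr => i _; rewrite rmorphB /= map_polyX map_polyC.
have {1}-> : r = size [seq (al i)%:P | i <- enum 'I_r] by rewrite size_map size_enum_ord.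
rewrite hom_prodXsubC big_map big_enum /= mul_polyC; congr (_ *: _).
apply: eq_bigr => i _; rewrite !rmorphD /= !map_polyZ /= !map_polyX !map_polyC /=.
rewrite mulrDr -!mul_polyC !rmorphB !rmorphM /=; ring.
Qed.

(** The polynomial g(x) = F(a x + b, c x + d) need not be sparse, but a Moebius map carries its
    zeros to those of [f], so at most 2 s are real. Its derivative comes likewise from a form with
    at most 2 s terms and has at most 4 s real zeros; the total is 6 s. *)
Lemma cover_chart (R : rcfType) r s (f : {poly R}) (a0 : R[i]) (al : 'I_r -> R[i])
    (a b c d : R) :
  (0 < r)%N -> (size f <= r.+1)%N -> (nterms r.+1 f <= s)%N ->
  map_poly (real_complex R) f = a0 *: \prod_(i < r) ('X - (al i)%:P) -> a0 != 0 ->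
  a * d - b * c != 0 -> (forall i, real_complex R a - al i * real_complex R c != 0) ->
  exists S : {set 'I_r}, (#|S| <= 6 * s)%N /\ forall (xi : R) i, exists2 j, j \in S &
    let be k := - ((real_complex R b - al k * real_complex R d) /
                   (real_complex R a - al k * real_complex R c)) in
    normc (be j - real_complex R xi) <= 75 * r%:R ^+ 4 * normc (be i - real_complex R xi).
Proof.
case: r al => // r al _ sf nf hf a00 det hp.
pose be k := - ((real_complex R b - al k * real_complex R d) /
                   (real_complex R a - al k * real_complex R c)).
set u : {poly R} := a *: 'X + b%:P; set v : {poly R} := c *: 'X + d%:P.
pose g := hom r.+1 (map_poly polyC f) u v.
have hg : map_poly (real_complex R) g = _ := hom_linear_roots a b c d hf.
have sg1 : size g = r.+2.
  have <- : size (map_poly (real_complex R) g) = size g by rewrite size_map_poly.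
  rewrite hg size_scale // size_prod; last first.
    move=> i _; apply/eqP => /(congr1 (fun p : {poly R[i]} => p`_1)).
    rewrite coefD coefZ coefX coefC coef0 /= mulr1 addr0 => /eqP; exact/negP/hp.
  have sz i : size ((real_complex R a - al i * real_complex R c) *: 'X
                     + (real_complex R b - al i * real_complex R d)%:P) = 2.
    by rewrite size_polyDl size_scale ?size_polyX ?hp // ltnS size_polyC_leq1.
  rewrite (eq_bigr (fun=> 2%N)) // sum_nat_const card_ord; lia.
have g0 : g != 0 by rewrite -size_poly_eq0 sg1.
have g'0 : g^`() != 0.
  apply/negP => /eqP g'0; have : (size g <= 1)%N.
    apply/leq_sizeP => -[//|j] _; have := coef_deriv g j; rewrite g'0 coef0.
    by move/esym/eqP; rewrite mulrn_eq0 /= => /eqP.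
  by rewrite sg1.
have rg i : root (map_poly (real_complex R) g) (be i).
  rewrite hg rootZ // rootE horner_prod; apply/prodf_eq0; exists i => //.
  by rewrite hornerD hornerZ hornerX hornerC /be mulrN mulrC divfK // addNr.
have ux x : u.[x] = a * x + b by rewrite hornerD hornerZ hornerX hornerC.
have vx x : v.[x] = c * x + d by rewrite hornerD hornerZ hornerX hornerC.
have hgx p k x : (hom k (map_poly polyC p) u v).[x] = hom k p (a * x + b) (c * x + d).
  rewrite -[LHS]/(horner_eval x _) hom_rmorph map_horner_eval_polyC.
  by congr (hom _ _ _ _); [exact: ux|exact: vx].
have f0 : f != 0.
  apply: contraNneq g0 => f0; apply/eqP.
  by rewrite /g f0 rmorph0 /hom big1 // => i _; rewrite coef0 !mul0r.
have hA t : uniq t -> all (root g) t -> (size t <= s.*2)%N.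
  move=> ut rt; apply: leq_trans (hom_sparse_roots sf f0 det ut _) _; last by rewrite leq_double.
  by apply/allP => x xt; rewrite -hgx -rootE; apply: (allP rt).
(* The derivative of F in the direction (a, c); its terms occur in f or in f'. *)
pose phi : {poly R} := a *: f^`() + c *: (f *+ r.+1 - 'X * f^`()).
have hphi : g^`() = hom r (map_poly polyC phi) u v.
  have e : map_poly polyC phi = a%:P *: map_poly polyC f^`() +
      c%:P *: map_poly polyC (f *+ r.+1 - 'X * f^`()).
    by rewrite /phi raddfD /= !map_polyZ.
  rewrite /g deriv_hom e homD !homZ.
  by rewrite /u /v !derivD !derivZ !derivX !derivC !addr0 !alg_polyC.
have phi0 : phi != 0.
  by apply: contraNneq g'0 => e; rewrite hphi e rmorph0 /hom big1 // => i _; rewrite coef0 !mul0r.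
have sphi : (size phi <= r.+1)%N.
  apply/leq_sizeP => j hj; rewrite /phi coefD !coefZ coefB coefMn coefXM coef_deriv.
  have fj : f`_j.+1 = 0 by rewrite nth_default //; apply: leq_trans sf _.
  rewrite fj mul0rn mulr0 add0r; case: j hj {fj} => // j hj /=.
  move: hj; rewrite coef_deriv ltnS leq_eqVlt => /orP[/eqP<-|hj].
    by rewrite subrr mulr0.
  by rewrite nth_default ?mul0rn ?subrr ?mulr0 //; apply: leq_trans sf _.
have nphi : (nterms r.+1 phi <= s.*2)%N.
  apply: leq_trans (@nterms_lincomb _ r.+1 f^`() f phi _) _.
    move=> i h1 h2; rewrite /phi coefD !coefZ coefB coefMn coefXM h1 h2 mulr0 add0r mul0rn sub0r.
    case: i h1 h2 => [|i] _ h2; first by rewrite oppr0 mulr0.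
    by rewrite coef_deriv h2 mul0rn oppr0 mulr0.
  rewrite -addnn; apply: leq_add; first by apply: leq_trans (nterms_deriv _ _) nf.
  by apply: leq_trans nf; rewrite /nterms [leqRHS]big_ord_recr /= leq_addr.
have hB t : uniq t -> all (root g^`()) t -> (size t <= s.*2.*2)%N.
  move=> ut rt; apply: leq_trans (hom_sparse_roots sphi phi0 det ut _) _; last by rewrite leq_double.
  by apply/allP => x xt; rewrite -hgx -hphi -rootE; apply: (allP rt).
have sg : (size g <= r.+2)%N by rewrite sg1.
have [S [cS hS]] := few_nearest_roots (ltn0Sn r) sg g0 g'0 rg hA hB.
by exists S; split => //; apply: leq_trans cS _; lia.
Qed.

Definition lin (C : comNzRingType) (l : C * C) (x y : C) := l.1 * x + l.2 * y.

Definition hgt (R : rcfType) (l : R[i] * R[i]) : R := Num.max (normc l.1) (normc l.2).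

(** Normalising by the height divides by max(1, |root|). This matters only for a root of modulus
    greater than 3, and such a root is at a distance comparable to its modulus from the point x/y of
    [-1, 1]. *)
Lemma chart_to_projective (R : rcfType) (p q p' q' : R[i]) (x y E : R) :
  p != 0 -> p' != 0 -> `|x| <= `|y| -> 1 <= E ->
  normc (- (q / p) - real_complex R (x / y)) <= E * normc (- (q' / p') - real_complex R (x / y)) ->
  normc (lin (p, q) (real_complex R x) (real_complex R y)) * hgt (p', q') <=
  3 * E * normc (lin (p', q') (real_complex R x) (real_complex R y)) * hgt (p, q).
Proof.
move=> p0 p'0 xy E1.
have [y0|y0] := eqVneq y 0.
  have x0 : x = 0 by apply/eqP; rewrite -normr_le0; apply: le_trans xy _; rewrite y0 normr0.
  rewrite x0 y0 rmorph0 /lin !mulr0 addr0 Normc.normc0. by move=> _; rewrite mul0r mulr0 mul0r.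
have yn : 0 < `|y| by rewrite normr_gt0.
set X := real_complex R x; set Y := real_complex R y.
have key (a b : R[i]) : a != 0 -> normc (lin (a, b) X Y) =
    normc a * `|y| * normc (- (b / a) - real_complex R (x / y)).
  move=> a0; rewrite -[`|y|]normc_real -!Normc.normcM -normc_opp; congr normc.
  rewrite /lin /= fmorph_div -/X -/Y.
  have Y0 : Y != 0 by rewrite fmorph_eq0.
  by field; rewrite a0 Y0.
rewrite !key //.
set D := normc (- (q / p) - _); set D' := normc (- (q' / p') - _) => hD.
have hh (a b : R[i]) : a != 0 -> hgt (a, b) = normc a * Num.max 1 (normc (- (b / a))).
  move=> a0; rewrite normc_opp maxr_pMr ?normc_ge0 // mulr1 -Normc.normcM mulrC divfK //.
rewrite !hh //.
set m := Num.max 1 (normc (- (q / p))); set m' := Num.max 1 (normc (- (q' / p'))).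
have np : 0 < normc p by rewrite normc_gt0.
have np' : 0 < normc p' by rewrite normc_gt0.
suff : D * m' <= 3 * E * D' * m.
  move=> h; have h0 : 0 <= normc p * `|y| * normc p' by rewrite !mulr_ge0 // ltW.
  have := ler_wpM2l h0 h; lra.
have D0 : 0 <= D by exact: normc_ge0.
have D'0 : 0 <= D' by exact: normc_ge0.
have m1 : 1 <= m by rewrite le_max lexx.
have xi1 : `|x / y| <= 1 by rewrite normf_div ler_pdivrMr // mul1r.
have hDm : D <= 2 * m.
  apply: le_trans (le_normcB _ _) _; rewrite normc_real.
  have : normc (- (q / p)) <= m by rewrite le_max lexx orbT.
  lra.
have [m3|m3] := lerP m' 3.
  nra.
have hm' : m' <= D' + 1.
  have : m' = normc (- (q' / p')).
    move: m3; rewrite /m'; case: (leP 1 (normc _)) => //; lra.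
  move=> ->; rewrite -[- (q' / p')](subrK (real_complex R (x / y))).
  apply: le_trans (normc_le_add _ _) _; rewrite normc_real -/D'; lra.
have m'0 : 0 <= m' by lra.
have h1 : D * m' <= 2 * m * (3 / 2 * D') by apply: ler_pM => //; lra.
have h2 : 1 * (D' * m) <= E * (D' * m) by apply: ler_wpM2r => //; rewrite mulr_ge0 //; lra.
lra.
Qed.

(* The same form seen in the charts y = 1 and x = 1. *)
Lemma few_close_factors (R : rcfType) r s (f : {poly R}) (a0 : R[i]) (al : 'I_r -> R[i])
    (a b c d : R) :
  (225 <= r)%N -> (size f <= r.+1)%N -> (nterms r.+1 f <= s)%N ->
  map_poly (real_complex R) f = a0 *: \prod_(i < r) ('X - (al i)%:P) -> a0 != 0 ->
  a * d - b * c != 0 ->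
  let l i := (real_complex R a - al i * real_complex R c,
              real_complex R b - al i * real_complex R d) in
  (forall i, (l i).1 != 0 /\ (l i).2 != 0) ->
  exists S : {set 'I_r}, (#|S| <= 12 * s)%N /\ forall (x y : R) i, exists2 j, j \in S &
    normc (lin (l j) (real_complex R x) (real_complex R y)) * hgt (l i) <=
    r%:R ^+ 5 * normc (lin (l i) (real_complex R x) (real_complex R y)) * hgt (l j).
Proof.
move=> r225 sf nf hf a00 det l hl.
have r0 : (0 < r)%N by apply: leq_trans r225.
have [S1 [c1 h1]] := cover_chart r0 sf nf hf a00 det (fun i => proj1 (hl i)).
have det' : b * c - a * d != 0 by rewrite -opprB oppr_eq0.
have [S2 [c2 h2]] := cover_chart r0 sf nf hf a00 det' (fun i => proj2 (hl i)).
exists (S1 :|: S2); split.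
  apply: leq_trans (leq_card_setU _ _) _.
  by apply: leq_trans (leq_add c1 c2) _; rewrite -mulnDl.
have rr : (225 : R) <= r%:R by rewrite (ler_nat _ 225).
have r4 : (1 : R) <= r%:R ^+ 4 by rewrite exprn_ege1 // ler1n.
(* The constant 225 = 3 * 75 is absorbed by one more factor r. *)
have r5 : 3 * (75 * r%:R ^+ 4) <= r%:R ^+ 5 :> R.
  by rewrite [leRHS]exprS mulrA; apply: ler_wpM2r; [rewrite exprn_ge0 ?ler0n|lra].
have E1 : 1 <= 75 * r%:R ^+ 4 :> R by lra.
move=> x y i.
have wk (A B C D : R) : 0 <= B -> 0 <= D ->
    A * C <= 3 * (75 * r%:R ^+ 4) * B * D -> A * C <= r%:R ^+ 5 * B * D.
  by move=> B0 D0 h; apply: le_trans h _; do 2!apply: ler_wpM2r => //.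
have hg (z : R[i] * R[i]) : 0 <= hgt z by rewrite le_max normc_ge0.
have [xy|yx] := lerP `|x| `|y|.
  have [j jS hj] := h1 (x / y) i; exists j; first by rewrite inE jS.
  apply: wk => //; first exact: normc_ge0.
  exact: (chart_to_projective (proj1 (hl j)) (proj1 (hl i)) xy E1 hj).
have [j jS hj] := h2 (y / x) i; exists j; first by rewrite inE jS orbT.
apply: wk => //; first exact: normc_ge0.
have swp z : lin (l z) (real_complex R x) (real_complex R y) =
   lin ((l z).2, (l z).1) (real_complex R y) (real_complex R x) by rewrite /lin addrC.
have swh z : hgt (l z) = hgt ((l z).2, (l z).1) by rewrite /hgt maxC.
rewrite !swp !(swh _).
exact: (chart_to_projective (proj2 (hl j)) (proj2 (hl i)) (ltW yx) E1 hj).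
Qed.

(** * Reduced bases *)

(* A linear form is the pair [l] of its coefficients and [hgt l] its height. The
   quantities |l(x)|, |l1 l2' - l2 l1'|, max(|x|, |y|), and the form [l] read in
   the coordinates of a basis: *)
Definition evz (R : rcfType) (l : R[i] * R[i]) (x : int * int) : R :=
  normc (lin l x.1%:~R x.2%:~R).

Definition crs (R : rcfType) (l l' : R[i] * R[i]) : R := normc (l.1 * l'.2 - l.2 * l'.1).

Definition maxz (x : int * int) : int := Num.max `|x.1| `|x.2|.

Definition detz (x y : int * int) : int := x.1 * y.2 - x.2 * y.1.

Definition lcomp (R : rcfType) (l : R[i] * R[i]) (x y : int * int) : R[i] * R[i] :=
  (lin l x.1%:~R x.2%:~R, lin l y.1%:~R y.2%:~R).

Lemma hgt_ge0 (R : rcfType) (l : R[i] * R[i]) : 0 <= hgt l.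
Proof. by rewrite le_max normc_ge0. Qed.

Lemma normc_hgt1 (R : rcfType) (l : R[i] * R[i]) : normc l.1 <= hgt l.
Proof. by rewrite le_max lexx. Qed.

Lemma normc_hgt2 (R : rcfType) (l : R[i] * R[i]) : normc l.2 <= hgt l.
Proof. by rewrite le_max lexx orbT. Qed.

Lemma hgt_gt0 (R : rcfType) (l : R[i] * R[i]) : l.1 != 0 -> 0 < hgt l.
Proof. by move=> h; rewrite lt_max normc_gt0 h. Qed.

Lemma evz_ge0 (R : rcfType) (l : R[i] * R[i]) x : 0 <= evz l x.
Proof. exact: normc_ge0. Qed.

Lemma maxz1 (R : rcfType) x : `|x.1|%:~R <= (maxz x)%:~R :> R.
Proof. by rewrite ler_int le_max lexx. Qed.

Lemma maxz2 (R : rcfType) x : `|x.2|%:~R <= (maxz x)%:~R :> R.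
Proof. by rewrite ler_int le_max lexx orbT. Qed.

Lemma maxz_gt0 x : x != (0, 0) -> 0 < maxz x.
Proof.
case: x => a b; rewrite -pair_eqE negb_and lt_max !normr_gt0 /=; exact.
Qed.

Lemma crs_le (R : rcfType) (l l' : R[i] * R[i]) : crs l l' <= 2 * (hgt l * hgt l').
Proof.
apply: le_trans (le_normcB _ _) _; rewrite !Normc.normcM.
have h1 := normc_hgt1 l; have h2 := normc_hgt2 l.
have h1' := normc_hgt1 l'; have h2' := normc_hgt2 l'.
have := ler_pM (normc_ge0 _) (normc_ge0 _) h1 h2'.
have := ler_pM (normc_ge0 _) (normc_ge0 _) h2 h1'; lra.
Qed.

(** Cramer's rule: eliminating one coordinate shows that two factors cannot both be small at a point
    unless they are nearly proportional. *)
Lemma crs_maxz_le (R : rcfType) (l l' : R[i] * R[i]) x :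
  crs l l' * (maxz x)%:~R <= evz l x * hgt l' + evz l' x * hgt l.
Proof.
have key (t : int) (p q : R[i]) : normc p <= hgt l' -> normc q <= hgt l ->
   (l.1 * l'.2 - l.2 * l'.1) * t%:~R =
     lin l x.1%:~R x.2%:~R * p - lin l' x.1%:~R x.2%:~R * q ->
   crs l l' * `|t|%:~R <= evz l x * hgt l' + evz l' x * hgt l.
  move=> hp hq e; rewrite /crs -normc_int -Normc.normcM e.
  apply: le_trans (le_normcB _ _) _; rewrite !Normc.normcM.
  by apply: lerD; apply: ler_wpM2l; rewrite ?normc_ge0.
rewrite /maxz; case: (leP `|x.1| `|x.2|) => _.
  apply: (key _ (- l'.1) (- l.1)); rewrite ?normc_opp ?normc_hgt1 //.
  by rewrite /lin; ring.
apply: (key _ l'.2 l.2); rewrite ?normc_hgt2 //.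
by rewrite /lin; ring.
Qed.

(** Cramer's rule with points and forms exchanged; for a non-zero determinant it becomes the gap
    principle. *)
Lemma detz_hgt_le (R : rcfType) (l : R[i] * R[i]) x y :
  `|detz x y|%:~R * hgt l <= evz l x * (maxz y)%:~R + evz l y * (maxz x)%:~R.
Proof.
have key (p : R[i]) (s t : int) : `|s|%:~R <= (maxz y)%:~R :> R -> `|t|%:~R <= (maxz x)%:~R :> R ->
   (detz x y)%:~R * p = lin l x.1%:~R x.2%:~R * s%:~R - lin l y.1%:~R y.2%:~R * t%:~R ->
   `|detz x y|%:~R * normc p <= evz l x * (maxz y)%:~R + evz l y * (maxz x)%:~R.
  move=> hs ht e; rewrite -normc_int -Normc.normcM e.
  apply: le_trans (le_normcB _ _) _; rewrite !Normc.normcM !normc_int.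
  by apply: lerD; apply: ler_wpM2l; rewrite ?normc_ge0.
rewrite /hgt; case: (leP (normc l.1) (normc l.2)) => _.
  apply: (key _ (- y.1) (- x.1)); rewrite ?normrN ?maxz1 // /lin /detz rmorphB !rmorphM /=; ring.
apply: (key _ y.2 x.2); rewrite ?maxz2 // /lin /detz rmorphB !rmorphM /=; ring.
Qed.

Lemma crs_lcomp (R : rcfType) (l l' : R[i] * R[i]) x y :
  crs (lcomp l x y) (lcomp l' x y) = `|detz x y|%:~R * crs l l'.
Proof.
rewrite /crs -normc_int -Normc.normcM /lcomp /lin /detz rmorphB !rmorphM /=.
by congr normc; ring.
Qed.

(* The second vector is reduced modulo the first. *)
Lemma complete_basis (R : rcfType) x : coprimez x.1 x.2 ->
  exists2 y, detz x y = 1 &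
    forall l : R[i] * R[i], hgt (lcomp l x y) <= evz l x + hgt l / (maxz x)%:~R.
Proof.
move=> cx.
have x0 : 0 < maxz x.
  apply: maxz_gt0; apply: contraTneq cx => ->; by [].
have X0 : (0 : R) < (maxz x)%:~R by rewrite ltr0z.
have [[u v] /= huv] : exists w : int * int, x.1 * w.2 - x.2 * w.1 = 1.
  have [u [v e]] := Bezoutz x.1 x.2.
  by exists (- v, u); move/eqP: cx => cx; rewrite /= -cx -e; ring.
suff [y dy hy] : exists2 y, detz x y = 1 &
    forall l : R[i] * R[i], (maxz x)%:~R * evz l y <= (maxz x)%:~R * evz l x + hgt l.
  exists y => // l; rewrite /hgt /= ge_max -!/(evz _ _); apply/andP; split.
    by rewrite lerDl divr_ge0 ?hgt_ge0 // ltW.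
  by rewrite -(ler_pM2l X0) mulrDr mulrCA divff ?mulr1 ?gt_eqF.
rewrite /maxz; case: (leP `|x.1| `|x.2|) => h12.
  have x20 : x.2 != 0.
    by apply: contraTneq x0 => e; move: h12; rewrite /maxz e normr0 normr_le0 => /eqP->; rewrite normr0 maxxx ltxx.
  pose k := (v %/ x.2)%Z.
  have dv := divz_eq v x.2; have mv := ltz_mod v x20; have m0 := modz_ge0 v x20.
  exists (u - k * x.1, v - k * x.2); first by rewrite /detz /= -huv; ring.
  move=> l; have hl := normc_hgt1 l.
  have e : x.2%:~R * lin l (u - k * x.1)%:~R (v - k * x.2)%:~R =
     (v %% x.2)%Z%:~R * lin l x.1%:~R x.2%:~R - l.1.
    have -> : (v %% x.2)%Z = v - k * x.2 by rewrite {2}dv; ring.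
    have -> : l.1 = l.1 * (x.1 * v - x.2 * u)%:~R by rewrite huv mulr1.
    rewrite /lin !rmorphB !rmorphM /=; ring.
  rewrite /evz -!normc_int -!Normc.normcM /= e; apply: le_trans (le_normcB _ _) _.
  rewrite lerD //  !Normc.normcM; apply: ler_wpM2r; first exact: normc_ge0.
  by rewrite !normc_int ler_int ger0_norm // ltW.
have x10 : x.1 != 0 by rewrite -normr_gt0; apply: le_lt_trans h12.
pose k := (u %/ x.1)%Z.
have du := divz_eq u x.1; have mu := ltz_mod u x10; have m0 := modz_ge0 u x10.
exists (u - k * x.1, v - k * x.2); first by rewrite /detz /= -huv; ring.
move=> l; have hl := normc_hgt2 l.
have e : x.1%:~R * lin l (u - k * x.1)%:~R (v - k * x.2)%:~R =
   (u %% x.1)%Z%:~R * lin l x.1%:~R x.2%:~R + l.2.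
  have -> : (u %% x.1)%Z = u - k * x.1 by rewrite {2}du; ring.
  have -> : l.2 = l.2 * (x.1 * v - x.2 * u)%:~R by rewrite huv mulr1.
  rewrite /lin !rmorphB !rmorphM /=; ring.
rewrite /evz -!normc_int -!Normc.normcM /= e; apply: le_trans (normc_le_add _ _) _.
rewrite lerD //  !Normc.normcM; apply: ler_wpM2r; first exact: normc_ge0.
by rewrite !normc_int ler_int ger0_norm // ltW.
Qed.

Lemma lcomp_comp (R : rcfType) (l : R[i] * R[i]) e f x y :
  lcomp (lcomp l e f) x y =
  lcomp l (e.1 * x.1 + f.1 * x.2, e.2 * x.1 + f.2 * x.2)
          (e.1 * y.1 + f.1 * y.2, e.2 * y.1 + f.2 * y.2).
Proof. by rewrite /lcomp /lin /= !rmorphD !rmorphM /=; congr (_, _); ring. Qed.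

(** The resultant of two factors is invariant under unimodular changes and at most twice the product
    of their heights. Multiplied along the cycle i, i + 1, this bounds the square of the product M
    of the heights from below; the minimum with 1 passes from M^2 to M. *)
Lemma lower_bound_heights (R : rcfType) r (L : 'I_r -> R[i] * R[i]) :
  (2 <= r)%N -> (forall i j, i != j -> 0 < crs (L i) (L j)) ->
  exists2 c : R, 0 < c & forall x y, detz x y = 1 -> c <= \prod_(i < r) hgt (lcomp (L i) x y).
Proof.
move=> r2 hL.
have nS (i : 'I_r) : i != ordS i.
  apply/eqP => e; have := congr1 (@nat_of_ord r) e; rewrite /= => h.
  have li := ltn_ord i; move: h; have [hi|hi] := ltnP i.+1 r; first by rewrite modn_small //; lia.
  have -> : i.+1 = r by apply/eqP; rewrite eqn_leq li hi.
  rewrite modnn; lia.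
pose c := \prod_(i < r) (crs (L i) (L (ordS i)) / 2).
have c0 : 0 < c by apply: prodr_gt0 => i _; rewrite divr_gt0 // hL.
exists (Num.min 1 c); first by rewrite lt_min ltr01.
move=> x y d1; set M := \prod_(i < r) _.
have M0 : 0 <= M by apply: prodr_ge0 => i _; exact: hgt_ge0.
have hM : c <= M * M.
  rewrite {2}/M (reindex_inj (@ordS_inj r)) -big_split /=.
  apply: ler_prod => i _; apply/andP; split; first by rewrite divr_ge0 // ltW // hL.
  rewrite ler_pdivrMr // mulrC; have := crs_le (lcomp (L i) x y) (lcomp (L (ordS i)) x y).
  by rewrite crs_lcomp d1 normr1 mul1r.
have [M1|M1] := lerP 1 M; first by rewrite ge_min M1.
by rewrite ge_min (le_trans hM) ?orbT // ler_piMl // ltW.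
Qed.

(** If no basis were minimal up to a factor 2, the product of the heights could be halved for ever,
    against its positive lower bound. *)
Lemma reduced_basis (R : realType) r (L : 'I_r -> R[i] * R[i]) :
  (2 <= r)%N -> (forall i j, i != j -> 0 < crs (L i) (L j)) ->
  exists e f : int * int, detz e f = 1 /\
    forall x y, detz x y = 1 ->
      \prod_(i < r) hgt (lcomp (L i) e f) <= 2 * \prod_(i < r) hgt (lcomp (L i) x y).
Proof.
move=> r2 hL; have [c c0 hc] := lower_bound_heights r2 hL.
pose M (x y : int * int) := \prod_(i < r) hgt (lcomp (L i) x y).
pose e0 : int * int := (1, 0); pose f0 : int * int := (0, 1).
apply: contrapT => hno.
have step n : exists e f, detz e f = 1 /\ 2 ^+ n * M e f <= M e0 f0.
  elim: n => [|n [e [f [d1 hn]]]]; first by exists e0, f0; rewrite expr0 mul1r.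
  have [x [y [d2 hxy]]] : exists x y, detz x y = 1 /\ 2 * M x y < M e f.
    apply: contrapT => h; apply: hno; exists e, f; split=> // x y d2.
    by rewrite leNgt; apply/negP => hlt; apply: h; exists x, y.
  exists x, y; split=> //; apply: le_trans hn; rewrite exprSr -mulrA.
  by apply: ler_wpM2l; [apply: exprn_ge0|exact: ltW].
have M0 : 0 <= M e0 f0 / c by rewrite divr_ge0 ?(ltW c0) // prodr_ge0 // => i _; exact: hgt_ge0.
have := archi_boundP M0; set n := Num.bound _ => hn.
have [e [f [d1 h]]] := step n.
have h2 : 2 ^+ n * c <= M e0 f0.
  by apply: le_trans h; apply: ler_wpM2l; [apply: exprn_ge0|exact: hc].
move: hn; rewrite ltr_pdivrMr // ltNge => /negP; apply; apply: le_trans h2.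
apply: ler_wpM2r; first exact: ltW.
by rewrite -natrX ler_nat ltnW // ltn_expl.
Qed.

(** * Counting points by height *)

Lemma growth_path (R : realFieldType) (T : eqType) (v : T -> R) q (x : T) (s : seq T) :
  0 <= q -> path (relpre v <=%R) x s -> uniq (x :: s) ->
  {in x :: s &, forall a b, a != b -> v a <= v b -> q * v a <= v b} ->
  exists2 y, y \in x :: s & q ^+ size s * v x <= v y.
Proof.
move=> q0; elim: s x => [|z s IH] x /=.
  by move=> _ _ _; exists x; rewrite ?mem_head // expr0 mul1r.
case/andP=> xz pz /andP[xs us] h.
have [|y ys hy] := IH z pz us.
  by move=> a b ha hb; apply: h; rewrite inE ?ha ?hb orbT.
exists y; first by rewrite inE ys orbT.
apply: le_trans hy; rewrite exprSr -mulrA; apply: ler_wpM2l; first exact: exprn_ge0.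
apply: h => //; rewrite ?mem_head //; first by rewrite inE mem_head orbT.
by apply: contraNneq xs => ->; rewrite mem_head.
Qed.

Lemma growth_chain (R : realFieldType) (T : eqType) (v : T -> R) q (l : seq T) :
  0 <= q -> uniq l -> {in l &, forall a b, a != b -> v a <= v b -> q * v a <= v b} ->
  l != [::] -> exists x y, [/\ x \in l, y \in l & q ^+ (size l).-1 * v x <= v y].
Proof.
move=> q0 ul h l0; pose s := sort (relpre v <=%R) l.
have ms x : (x \in s) = (x \in l) by rewrite mem_sort.
have ss : sorted (relpre v <=%R) s by apply: sort_sorted => a b; exact: le_total.
have us : uniq s by rewrite sort_uniq.
have -> : size l = size s by rewrite size_sort.
have : s != [::] by rewrite -size_eq0 size_sort size_eq0.
case: s ms ss us => // x s ms ss us _ /=.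
have [|y ys hy] := growth_path q0 ss us.
  by move=> a b; rewrite !ms; exact: h.
by exists x, y; rewrite -!ms mem_head.
Qed.

Lemma cost_path (R : realFieldType) (T : eqType) (c v : T -> R) U (x : T) (s : seq T) :
  path (relpre v <=%R) x s -> uniq (x :: s) ->
  {in x :: s, forall a, c a <= U} ->
  {in x :: s &, forall a b, a != b -> v a <= v b -> v a + c a <= v b} ->
  exists2 y, y \in x :: s & \sum_(a <- x :: s) c a <= U + v y - v x.
Proof.
elim: s x => [|z s IH] x /=.
  move=> _ _ hU _; exists x; rewrite ?mem_head // big_seq1.
  by have := hU x (mem_head _ _); lra.
case/andP=> xz pz /andP[xs us] hU h.
have [||y ys hy] := IH z pz us.
- by move=> a ha; apply: hU; rewrite inE ha orbT.
- by move=> a b ha hb; apply: h; rewrite inE ?ha ?hb orbT.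
exists y; first by rewrite inE ys orbT.
have : v x + c x <= v z.
  apply: h => //; rewrite ?mem_head //; first by rewrite inE mem_head orbT.
  by apply: contraNneq xs => ->; rewrite mem_head.
rewrite big_cons; lra.
Qed.

(** Sort the elements of positive cost by [v]: each pushes the next one up by its cost, so all costs
    but the last telescope into the range of [v], and the last is at most [U]. *)
Lemma cost_chain (R : realFieldType) (T : eqType) (c v : T -> R) U Y (l : seq T) :
  uniq l -> 0 <= U -> 0 <= Y -> {in l, forall a, 0 <= v a <= Y} ->
  {in l, forall a, 0 <= c a <= U} ->
  {in l &, forall a b, a != b -> 0 < c a -> 0 < c b -> v a <= v b -> v a + c a <= v b} ->
  \sum_(a <- l) c a <= U + Y.
Proof.
move=> ul U0 Y0 hv hc h.
pose p := [seq a <- l | 0 < c a].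
have -> : \sum_(a <- l) c a = \sum_(a <- p) c a.
  rewrite big_filter [RHS]big_mkcond /=; apply: eq_big_seq => a al.
  by case: ltP => // ca; apply/le_anti; case/andP: (hc a al) => ->; rewrite ca.
pose s := sort (relpre v <=%R) p.
have -> : \sum_(a <- p) c a = \sum_(a <- s) c a.
  by apply: perm_big; rewrite perm_sym; exact: permEl (perm_sort _ _).
have ms x : (x \in s) = (0 < c x) && (x \in l) by rewrite mem_sort mem_filter.
have ss : sorted (relpre v <=%R) s by apply: sort_sorted => a b; exact: le_total.
have us : uniq s by rewrite sort_uniq filter_uniq.
case: s ms ss us => [|x s] ms ss us; first by rewrite big_nil addr_ge0.
have [||y ys hy] := cost_path (c := c) (U := U) ss us.
- by move=> a; rewrite ms => /andP[_ /hc/andP[]].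
- by move=> a b; rewrite !ms => /andP[ca al] /andP[cb bl] ab; exact: h.
apply: le_trans hy _.
move: ys; rewrite ms => /andP[_ /hv/andP[_ hy]].
by move: (mem_head x s); rewrite ms => /andP[_ /hv/andP[hx _]]; lra.
Qed.

Lemma size_le_cover (T : eqType) (I : finType) (S : {set I}) (P : T -> I -> bool) (l : seq T) :
  (forall x, x \in l -> exists2 j, j \in S & P x j) ->
  (size l <= \sum_(j in S) size [seq x <- l | P x j])%N.
Proof.
elim: l => [|x l IH] h; first by [].
apply: leq_trans (_ : (\sum_(j in S) P x j + \sum_(j in S) size [seq x <- l | P x j] <= _)%N).
  rewrite /= -add1n; apply: leq_add; last first.
    by apply: IH => y yl; apply: h; rewrite inE yl orbT.
  have [j jS Pj] := h x (mem_head _ _).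
  by rewrite (bigD1 j) //= Pj leq_addr.
rewrite -big_split /=; apply: leq_sum => j _.
by case: (P x j).
Qed.

(** * Inequalities in logarithmic coordinates *)

Lemma sum_const_ord (R : pzSemiRingType) r (c : R) : \sum_(i < r) c = r%:R * c.
Proof. by rewrite sumr_const card_ord mulr_natl. Qed.

Lemma sum_neq_const (R : pzRingType) r (i : 'I_r) (c : R) :
  \sum_(j < r | j != i) c = (r%:R - 1) * c.
Proof.
have e : \sum_(j < r) c = c + \sum_(j < r | j != i) c by rewrite (bigD1 i).
by rewrite mulrBl mul1r -sum_const_ord e addrC addKr.
Qed.

Lemma sum_offdiag_const (R : pzRingType) r (c : R) :
  \sum_(i < r) \sum_(j < r | j != i) c = r%:R * (r%:R - 1) * c.
Proof. by rewrite (eq_bigr _ (fun i _ => sum_neq_const i c)) sum_const_ord mulrA. Qed.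

Lemma expR1_ge2 (R : realType) : 2 <= expR 1 :> R.
Proof. by apply: le_trans (expR_ge1Dx _); lra. Qed.

Lemma expR_add_le (R : realType) (a b c d : R) :
  expR a <= expR b + expR c -> b <= d -> c <= d -> a <= 1 + d.
Proof.
move=> h hb hc; rewrite -ler_expR; apply: le_trans h _.
rewrite expRD; have hb' : expR b <= expR d by rewrite ler_expR.
have hc' : expR c <= expR d by rewrite ler_expR.
have := ler_wpM2r (expR_ge0 d) (expR1_ge2 R); lra.
Qed.

Lemma tau_lower_bound (R : realFieldType) r (Gam : 'I_r -> 'I_r -> R) tau :
  (2 <= r)%N -> (forall i j, Gam i j <= 1) ->
  (r%:R - 1) * (100 * r%:R - 2 * tau) <= \sum_(i < r) \sum_(j < r | j != i) Gam i j ->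
  99 / 2 * r%:R <= tau.
Proof.
move=> r2 hC hS.
have rr : 2 <= r%:R :> R by rewrite (ler_nat _ 2).
have : \sum_(i < r) \sum_(j < r | j != i) Gam i j <= r%:R * (r%:R - 1) * 1.
  by rewrite -sum_offdiag_const; apply: ler_sum => i _; apply: ler_sum.
move=> h; have := le_trans hS h; rewrite mulr1 [leRHS]mulrC.
rewrite ler_pM2l; lra.
Qed.

(* If no factor were small, then at least r/7 factors would be at most
   exp(- ell / 2), and the corresponding roots would be so close to each other
   that the discriminant would be too small. *)
Lemma medium_close (R : realType) r (Gam : 'I_r -> 'I_r -> R) (del : 'I_r -> R) tau ell :
  (56 <= r)%N -> (forall i j, Gam i j <= 1) ->
  (r%:R - 1) * (100 * r%:R - 2 * tau) <= \sum_(i < r) \sum_(j < r | j != i) Gam i j ->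
  (forall i j, i != j -> expR (Gam i j) <= expR (del i) + expR (del j)) ->
  \sum_(i < r) del i <= - tau - r%:R * ell -> 0 <= tau -> 0 < ell -> 225 * tau <= r%:R * ell ->
  exists i, del i < - 4 * ell.
Proof.
move=> r56 hC hS hD hP tau0 ell0 hell.
have rr : 56 <= r%:R :> R by rewrite (ler_nat _ 56).
apply: contrapT => hno.
have hge i : - 4 * ell <= del i by rewrite leNgt; apply/negP => h; apply: hno; exists i.
pose B (i : 'I_r) : R := if del i < - (ell / 2) then 1 else 0.
pose k := \sum_(i < r) B i.
have B01 i : 0 <= B i <= 1 by rewrite /B; case: (_ < _); rewrite /= ?lexx ler01.
have BB i : B i * B i = B i by rewrite /B; case: (_ < _); rewrite /= ?mulr1 ?mulr0.
(* Here k counts the factors below -ell / 2. Such a factor contributes at least -4 ell = -ell / 2 -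
   (7 / 2) ell, any other at least -ell / 2, while the sum is at most -r ell. *)
have h1 : r%:R <= 7 * k.
  have : \sum_(i < r) (- (ell / 2) - 7 / 2 * ell * B i) <= \sum_(i < r) del i.
    apply: ler_sum => i _; rewrite /B; case: ltP => h /=; have := hge i; lra.
  rewrite sumrB sum_const_ord -mulr_sumr -/k => h.
  have h' : ell * r%:R <= ell * (7 * k) by lra.
  by move: h'; rewrite ler_pM2l.
have h2 : \sum_(i < r) \sum_(j < r | j != i) Gam i j <=
    r%:R * (r%:R - 1) - (ell / 2) * (k * k - k).
  have -> : r%:R * (r%:R - 1) - (ell / 2) * (k * k - k) =
      \sum_(i < r) \sum_(j < r | j != i) (1 - (ell / 2) * (B i * B j)).
    under [RHS]eq_bigr => i _ do rewrite sumrB -mulr_sumr.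
    rewrite sumrB sum_offdiag_const mulr1 -mulr_sumr; congr (_ - _ * _).
    have hk : k * k = \sum_(i < r) (B i + \sum_(j < r | j != i) B i * B j).
      rewrite {1}/k mulr_suml; apply: eq_bigr => i _.
      by rewrite /k mulr_sumr (bigD1 i) //= BB.
    by apply/eqP; rewrite subr_eq hk big_split /= [X in _ == X]addrC.
  apply: ler_sum => i _; apply: ler_sum => j ji; rewrite /B.
  case: ltP => hi /=; last by rewrite mul0r mulr0 subr0.
  case: ltP => hj /=; last by rewrite !mulr0 subr0.
  rewrite !mulr1; apply: (expR_add_le (hD i j _)); rewrite 1?eq_sym //; exact: ltW.
(* With [h4] this gives ell r^2 / 112 <= 2 (r - 1) tau, hence r ell < 224 tau, against the 225 of
   the hypothesis. *)
have h3 : (ell / 2) * (k * k - k) <= 2 * (r%:R - 1) * tau.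
  have := le_trans hS h2.
  have : 0 <= (r%:R - 1) * (99 * r%:R) :> R by apply: mulr_ge0; lra.
  lra.
(* From k >= r / 7 and r >= 56 follows k - 1 >= r / 8. *)
have h4 : (r%:R / 7) * (r%:R / 8) <= k * k - k.
  have -> : k * k - k = k * (k - 1) by ring.
  by apply: ler_pM; lra.
have h5 : (ell / 2) * ((r%:R / 7) * (r%:R / 8)) <= (ell / 2) * (k * k - k).
  by apply: ler_wpM2l => //; lra.
have h6 : r%:R * (225 * tau) <= r%:R * (r%:R * ell) by apply: ler_wpM2l => //; lra.
have h7 : 0 <= r%:R * tau by rewrite mulr_ge0 ?ler0n.
have h8 : 0 < tau.
  rewrite lt_def tau0 andbT; apply/negP => /eqP t0; move: h3; rewrite t0 mulr0.
  have : 0 < (ell / 2) * ((r%:R / 7) * (r%:R / 8)) by apply: mulr_gt0; [lra|apply: mulr_gt0; lra].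
  lra.
lra.
Qed.

(* For the nearest root i, d_j >= c_ij / 2 for all j != i, and the product of
   these c_ij is bounded below by the discriminant. *)
Lemma large_close (R : realType) r (Gam : 'I_r -> 'I_r -> R) (del : 'I_r -> R) tau ell :
  (2 <= r)%N -> (forall i j, Gam i j <= 1) ->
  (r%:R - 1) * (100 * r%:R - 2 * tau) <= \sum_(i < r) \sum_(j < r | j != i) Gam i j ->
  (forall i j, i != j -> expR (Gam i j) <= expR (del i) + expR (del j)) ->
  \sum_(i < r) del i <= - tau - r%:R * ell -> 99 / 2 * r%:R <= tau -> 40 * tau <= ell ->
  exists i, del i <= - (19 / 20 * (r%:R * ell)).
Proof.
move=> r2 hC hS hD hP htau hell.
have rr : 2 <= r%:R :> R by rewrite (ler_nat _ 2).
case: r r2 Gam del hC hS hD hP htau hell rr => // r r2 Gam del hC hS hD hP htau hell rr.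
pose i := [arg min_(i < ord0) del i]%O.
have hi j : del i <= del j by rewrite /i; case: arg_minP => // k _; apply.
exists i.
have h1 : \sum_(j < r.+1 | j != i) Gam i j <= r%:R + \sum_(j < r.+1 | j != i) del j.
  have -> : r%:R = \sum_(j < r.+1 | j != i) (1 : R).
    by rewrite sum_neq_const mulr1 -natr1 addrK.
  rewrite -big_split /=; apply: ler_sum => j ji.
  by apply: (expR_add_le (hD i j _)); rewrite 1?eq_sym.
(* Only the pairs starting at [i] carry information; all others are bounded by 1. *)
have h2 : \sum_(a < r.+1 | a != i) \sum_(b < r.+1 | b != a) Gam a b <= r%:R * r%:R.
  have e : \sum_(a < r.+1 | a != i) r%:R = r%:R * r%:R :> R.
    by rewrite sum_neq_const -natr1 addrK.
  rewrite -e; apply: ler_sum => a _.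
  apply: le_trans (_ : \sum_(j < r.+1 | j != a) 1 <= _); first by apply: ler_sum.
  by rewrite sum_neq_const mulr1 -natr1 addrK.
move: hS hP; rewrite (bigD1 i) //= [\sum_(i < r.+1) del i](bigD1 i) //= -natr1 => hS hP.
have rr0 : 0 <= r%:R :> R by rewrite ler0n.
rewrite -natr1 in htau.
have t0 : 0 <= tau by lra.
have h3 : r%:R * (100 * (r%:R + 1)) >= r%:R * r%:R :> R by apply: ler_wpM2l => //; lra.
have h4 : (r%:R + 1) * (40 * tau) <= (r%:R + 1) * ell by apply: ler_wpM2l => //; lra.
lra.
Qed.

(** For g = -2 ell - d, the excess g - 1 is exactly the increment that [gap_log] forces between
    successive heights. *)
Lemma ln1p_expR_le (R : realType) (g : R) :
  ln (1 + expR g) <= 3 + (if 2 <= g then g - 1 else 0).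
Proof.
have e0 := expR_gt0 g.
have e2 := expR1_ge2 R.
have key (a : R) : expR a + expR a <= expR (a + 1).
  by rewrite expRD; have := ler_wpM2l (expR_ge0 a) e2; lra.
have p1 : 0 < 1 + expR g by lra.
rewrite -[leRHS]expRK ler_ln ?posrE ?expR_gt0 ?p1 //.
case: (lerP 2 g) => hg.
  have h1 : 1 <= expR g by rewrite -[leLHS](expR0 R) ler_expR; lra.
  rewrite (_ : 3 + (g - 1) = g + 1 + 1); last by ring.
  have := key g; have := key (g + 1); have := expR_gt0 (g + 1); lra.
rewrite addr0 (_ : 3 = 2 + 1 :> R); last by ring.
have h1 : expR g <= expR 2 by rewrite ler_expR ltW.
have h2 : 1 <= expR 2 :> R by rewrite -[leLHS](expR0 R) ler_expR.
have := key 2; lra.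
Qed.

(** The term of the higher point is at most e^(-2) <= 1/3, so the term of the lower one exceeds 1/2
    >= e^(-1). *)
Lemma gap_log (R : realType) (ell ell' d d' : R) :
  1 <= expR (ell + ell' + d) + expR (ell + ell' + d') ->
  2 <= - 2 * ell' - d' -> ell <= ell' -> ell + (- 2 * ell - d - 1) <= ell'.
Proof.
move=> h h2 hl.
have h3 : expR (ell + ell' + d') <= 3^-1 by apply: expR_le_third; lra.
have h4 : - 1 <= ell + ell' + d.
  rewrite -ler_expR expRN; apply: le_trans (_ : 2^-1 <= _); last by lra.
  by rewrite lef_pV2 ?posrE ?expR_gt0 //; exact: expR1_ge2.
lra.
Qed.

Lemma size_uniq_le1 (T : eqType) (l : seq T) :
  uniq l -> {in l &, forall x y, x = y} -> (size l <= 1)%N.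
Proof.
case: l => [|x [|y l]] //= /andP[xl _] h.
by move: xl; rewrite (h x y) ?inE ?eqxx ?orbT.
Qed.

(** Every point needs a sum of logarithms of at least tau - 1, whereas for a fixed factor the
    excesses telescope in the heights and total O(y0). Only the last point that is close to a given
    factor has no successor to bound its excess; such points are set aside for the factors in [S],
    one for each, and give the term #|S|. *)
Lemma small_count (R : realType) (T : eqType) r (l : seq T) (ell : T -> R)
    (del : T -> 'I_r -> R) (S : {set 'I_r}) (tau e y0 : R) :
  (1 <= r)%N -> uniq l -> {in l, forall x, 0 <= ell x <= y0} ->
  {in l, forall x, tau - 1 <= \sum_(i < r) ln (1 + expR (- 2 * ell x - del x i))} ->
  {in l &, forall x x', x != x' -> forall i,
     1 <= expR (ell x + ell x' + del x i) + expR (ell x + ell x' + del x' i)} ->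
  {in l, forall x i, exists2 j, j \in S & del x j <= e + del x i} ->
  0 <= e -> e <= y0 -> 1 <= y0 -> 99 / 2 * r%:R <= tau ->
  (size l)%:R <= #|S|%:R + 4 * (r%:R * y0) / tau.
Proof.
move=> r1 ul hl hA hG hcov e0 ey y1 htau.
have rr : 1 <= r%:R :> R by rewrite ler1n.
pose g x i := - 2 * ell x - del x i.
pose c x i : R := if 2 <= g x i then g x i - 1 else 0.
have gap x x' i : x \in l -> x' \in l -> x != x' -> 2 <= g x' i ->
    ell x <= ell x' -> ell x + (g x i - 1) <= ell x'.
  by move=> xl xl' xx hg hle; apply: (gap_log (hG x x' xl xl' xx i)).
pose last x j := (2 <= g x j) &&
   all (fun x' => [|| x' == x, ~~ (2 <= g x' j) | ell x' < ell x]) l.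
pose pl x := [exists j in S, last x j].
have sz : (size l = size [seq x <- l | pl x] + size [seq x <- l | ~~ pl x])%N.
  by rewrite !size_filter count_predC.
have h1 : (size [seq x <- l | pl x] <= #|S|)%N.
  apply: leq_trans (size_le_cover (S := S) (P := last) _) _.
    by move=> x; rewrite mem_filter => /andP[/exists_inP].
  rewrite -sum1_card; apply: leq_sum => j _; apply: size_uniq_le1.
    by rewrite !filter_uniq.
  move=> x y; rewrite !mem_filter => /andP[/andP[gx /allP hx] /andP[_ xl]].
  move=> /andP[/andP[gy /allP hy] /andP[_ yl]].
  have := hx y yl; have := hy x xl; rewrite gx gy /= => /orP[/eqP //|hxy].
  move=> /orP[/eqP ->//|hyx].
  by have := lt_trans hxy hyx; rewrite ltxx.
set l2 := [seq x <- l | ~~ pl x] in sz.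
have ul2 : uniq l2 by rewrite filter_uniq.
have l2l x : x \in l2 -> x \in l by rewrite mem_filter => /andP[].
(* A point that is not last for [j] has a successor of height at most [y0]. *)
have hgS x j : x \in l2 -> j \in S -> g x j <= y0 + 1.
  rewrite mem_filter => /andP[/exists_inPn hx xl] jS.
  have := hx j jS; rewrite negb_and => /orP[|/allPn[x' xl']].
    rewrite -ltNge; lra.
  rewrite !negb_or negbK -leNgt => /and3P[xx hg' hle].
  have := gap x x' j xl xl' _ hg' hle; rewrite eq_sym => /(_ xx).
  by have /andP[_] := hl x' xl'; have /andP[] := hl x xl; lra.
have hc x i : x \in l2 -> 0 <= c x i <= e + y0.
  move=> xl2; have [j jS hj] := hcov x (l2l x xl2) i.
  have := hgS x j xl2 jS; rewrite /c; case: (lerP 2 (g x i)) => hg hgj.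
    by apply/andP; split; [lra|move: hgj; rewrite /g; lra].
  by rewrite lexx /=; lra.
have hcost i : \sum_(x <- l2) c x i <= 3 * y0.
  apply: le_trans (_ : (e + y0) + y0 <= _); last by lra.
  apply: (@cost_chain _ _ (fun x => c x i) ell); rewrite ?addr_ge0 //; try lra.
  - by move=> x /l2l; exact: hl.
  - by move=> x xl2; exact: hc.
  - move=> x x' /l2l xl /l2l xl' xx; rewrite /c.
    case: (lerP 2 (g x i)) => [hg _|_]; last by rewrite ltxx.
    case: (lerP 2 (g x' i)) => [hg' _|_]; last by rewrite ltxx.
    exact: gap.
have h2 : (size l2)%:R * (tau - 1) <= 3 * r%:R * (size l2)%:R + 3 * r%:R * y0.
  have -> : (size l2)%:R * (tau - 1) = \sum_(x <- l2) (tau - 1).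
    by rewrite big_const_seq count_predT iter_addr_0 mulr_natl.
  apply: le_trans (_ : \sum_(x <- l2) \sum_(i < r) (3 + c x i) <= _).
    rewrite big_seq [leRHS]big_seq; apply: ler_sum => x /l2l xl.
    apply: le_trans (hA x xl) _; apply: ler_sum => i _; exact: ln1p_expR_le.
  rewrite exchange_big /=.
  apply: le_trans (_ : \sum_(i < r) ((size l2)%:R * 3 + 3 * y0) <= _).
    apply: ler_sum => i _; rewrite big_split /=; apply: lerD => //.
    by rewrite big_const_seq count_predT iter_addr_0 mulr_natl.
  by rewrite sum_const_ord; lra.
have t0 : 0 < tau by lra.
have s0 : 0 <= (size l2)%:R :> R by rewrite ler0n.
have h3 : (size l2)%:R <= 4 * (r%:R * y0) / tau.
  (* As tau >= 99 r / 2, the loss 1 + 3 r is at most tau / 4. *)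
  rewrite ler_pdivlMr //.
  have := ler_wpM2l s0 (_ : 3 / 4 * tau <= tau - 1 - 3 * r%:R); lra.
by rewrite sz natrD; apply: lerD => //; rewrite ler_nat.
Qed.

Lemma medium_chain (R : realType) (T : eqType) (l : seq T) (ell d : T -> R) (e lo hi : R) :
  uniq l -> 0 <= e -> e + 2 <= lo ->
  {in l, forall x, lo <= ell x <= hi /\ d x <= e - 4 * ell x} ->
  {in l &, forall x x', x != x' ->
     1 <= expR (ell x + ell x' + d x) + expR (ell x + ell x' + d x')} ->
  (size l)%:R * lo <= Num.max hi 0.
Proof.
move=> ul e0 elo hl hG.
have [->|l0] := eqVneq l [::]; first by rewrite mul0r le_max lexx orbT.
have gr : {in l &, forall a b, a != b -> ell a <= ell b -> 2 * ell a <= ell b}.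
  move=> a b al bl ab hab.
  have [/andP[la _] da] := hl a al; have [/andP[lb _] db] := hl b bl.
  by have := gap_log (hG a b al bl ab) (_ : 2 <= - 2 * ell b - d b) hab; lra.
have [x [y [xl yl hxy]]] := growth_chain (ler0n _ 2) ul gr l0.
have [/andP[lx _] _] := hl x xl; have [/andP[_ ly] _] := hl y yl.
have hs : (size l)%:R <= 2 ^+ (size l).-1 :> R.
  rewrite -natrX ler_nat; case: (size l) => // n.
  by rewrite /= ltn_expl.
rewrite le_max; apply/orP; left; apply: le_trans ly; apply: le_trans hxy.
by apply: ler_pM => //; lra.
Qed.

Lemma large_gap (R : realType) (r ell ell' d d' : R) :
  100 <= r -> 1 <= ell -> ell <= ell' ->
  d <= - (47 / 50 * (r * ell)) -> d' <= - (47 / 50 * (r * ell')) ->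
  1 <= expR (ell + ell' + d) + expR (ell + ell' + d') -> (r - 1) / 2 * ell <= ell'.
Proof.
move=> hr h1 hle hd hd' hG.
have h2 : 100 * ell <= r * ell by apply: ler_wpM2r => //; lra.
have h3 : 100 * ell' <= r * ell' by apply: ler_wpM2r => //; lra.
have := gap_log hG (_ : 2 <= - 2 * ell' - d') hle; lra.
Qed.

Lemma large_chain (R : realType) (T : eqType) (l : seq T) (ell d : T -> R) (r lo K : R) :
  uniq l -> 257 <= r -> 1 <= lo -> 1 <= K ->
  {in l, forall x, lo <= ell x <= 6 * r * K * lo /\ d x <= - (47 / 50 * (r * ell x))} ->
  {in l &, forall x x', x != x' ->
     1 <= expR (ell x + ell x' + d x) + expR (ell x + ell x' + d x')} ->
  (size l)%:R <= 10 / 3 + 2 * (ln K / ln (r - 1)).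
Proof.
move=> ul hr hlo hK hl hG.
have e1 := expR1_ge2 R.
(* e^4 <= 4^4 = 256, whence the bound 257 on r. *)
have om4 : 4 <= ln (r - 1).
  rewrite -[leLHS]expRK ler_ln ?posrE ?expR_gt0 //; last by lra.
  rewrite (_ : 4 = 4%:R * 1); last by rewrite mulr1.
  rewrite expRM_natl; apply: le_trans (_ : 4 ^+ 4 <= _).
    by apply: lerXn2r; rewrite ?nnegrE ?expR_ge0 //; exact: expR1_le4.
  by rewrite -natrX; lra.
set om := ln (r - 1) in om4 *.
have lK : 0 <= ln K by exact: ln_ge0.
have Kom : 0 <= ln K / om by rewrite divr_ge0 //; lra.
have [->|l0] := eqVneq l [::]; first by rewrite /=; lra.
have q0 : 0 <= (r - 1) / 2 by lra.
have gr : {in l &, forall a b, a != b -> ell a <= ell b -> (r - 1) / 2 * ell a <= ell b}.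
  move=> a b al bl ab hab.
  have [/andP[la _] da] := hl a al; have [_ db] := hl b bl.
  by apply: (large_gap _ _ hab da db (hG a b al bl ab)); lra.
have [x [y [xl yl hxy]]] := growth_chain q0 ul gr l0.
have [/andP[lx _] _] := hl x xl; have [/andP[_ ly] _] := hl y yl.
have h1 : ((r - 1) / 2) ^+ (size l).-1 * lo <= 6 * r * K * lo.
  apply: le_trans ly; apply: le_trans hxy; apply: ler_wpM2l => //; exact: exprn_ge0.
have lo0 : 0 < lo by lra.
rewrite ler_pM2r // in h1.
have q1 : 0 < (r - 1) / 2 by lra.
have lnq : 3 / 4 * om <= ln ((r - 1) / 2).
  rewrite ln_div ?posrE //; try lra.
  have : ln 2 <= 1 :> R by rewrite -[leRHS]expRK ler_ln ?posrE ?expR_gt0.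
  by rewrite -/om; lra.
have h2 : (size l).-1%:R * ln ((r - 1) / 2) <= 3 + om + ln K.
  have -> : (size l).-1%:R * ln ((r - 1) / 2) = ln (((r - 1) / 2) ^+ (size l).-1).
    by rewrite lnXn // mulr_natl.
  have K0 : 0 < K by lra.
  have -> : 3 + om + ln K = ln (expR 3 * (r - 1) * K).
    by rewrite !lnM ?posrE ?mulr_gt0 ?expR_gt0 ?expRK //; lra.
  rewrite ler_ln ?posrE ?exprn_gt0 ?mulr_gt0 ?expR_gt0 //; try lra.
  apply: le_trans h1 _; apply: ler_wpM2r; first by lra.
  have e3 : 7 <= expR 3 :> R.
    have -> : expR 3 = expR 1 ^+ 3 :> R by rewrite -expRM_natl mulr1.
    apply: le_trans (_ : 2 ^+ 3 <= _); first by rewrite -natrX; lra.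
    by apply: lerXn2r; rewrite ?nnegrE ?expR_ge0.
  apply: le_trans (_ : 7 * (r - 1) <= _); first lra.
  by apply: ler_wpM2r => //; lra.
(* Division by (3/4) om, with 3 <= (3/4) om, gives 7/3 + (4/3) ln K / om; the first point adds 1. *)
have h3 : (size l).-1%:R * (3 / 4 * om) <= 3 + om + ln K.
  by apply: le_trans h2; apply: ler_wpM2l => //; exact: ler0n.
have e : ln K = ln K / om * om by rewrite divfK //; lra.
have h4 : (size l).-1%:R * (3 / 4 * om) <= (7 / 4 + ln K / om) * om.
  by rewrite [leRHS]mulrDl -e; lra.
have h5 : (size l).-1%:R <= 7 / 3 + 4 / 3 * (ln K / om).
  rewrite -(ler_pM2r (_ : 0 < 3 / 4 * om)); last by lra.
  apply: le_trans h4 _; rewrite le_eqVlt; apply/orP; left; apply/eqP; field.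
  by rewrite gt_eqF //; lra.
apply: le_trans (_ : (size l).-1%:R + 1 <= _); last by lra.
by rewrite natr1 ler_nat; exact: leqSpred.
Qed.

(** Three points would span two gaps, hence a ratio of at least ((r - 1) / 2)^2, which exceeds the
    ratio 11 (r + 1) that Thue's method allows. *)
Lemma huge_chain (R : realType) (T : eqType) (l : seq T) (ell d : T -> R) (r lo : R) :
  uniq l -> 100 <= r -> 1 <= lo ->
  {in l, forall x, lo <= ell x /\ d x <= - (47 / 50 * (r * ell x))} ->
  {in l &, forall x x', x != x' ->
     1 <= expR (ell x + ell x' + d x) + expR (ell x + ell x' + d x')} ->
  {in l &, forall x x', ell x' < 11 * (r + 1) * ell x} ->
  (size l <= 2)%N.
Proof.
move=> ul hr hlo hl hG hT.
have [->//|l0] := eqVneq l [::].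
have q0 : 0 <= (r - 1) / 2 by lra.
have gr : {in l &, forall a b, a != b -> ell a <= ell b -> (r - 1) / 2 * ell a <= ell b}.
  move=> a b al bl ab hab.
  have [la da] := hl a al; have [_ db] := hl b bl.
  by apply: (large_gap _ _ hab da db (hG a b al bl ab)); lra.
have [x [y [xl yl hxy]]] := growth_chain q0 ul gr l0.
have [lx _] := hl x xl.
rewrite leqNgt; apply/negP => h3.
have h2 : ((r - 1) / 2) ^+ 2 <= ((r - 1) / 2) ^+ (size l).-1.
  by apply: ler_weXn2l; [lra|rewrite -ltnS prednK // (leq_trans _ h3)].
have h4 : ((r - 1) / 2) ^+ (size l).-1 * ell x < 11 * (r + 1) * ell x.
  by apply: le_lt_trans hxy (hT x y xl yl).
rewrite ltr_pM2r in h4; last by lra.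
have : 11 * (r + 1) <= ((r - 1) / 2) ^+ 2.
  rewrite expr2; have h : 99 / 2 * ((r - 1) / 2) <= (r - 1) / 2 * ((r - 1) / 2).
    by apply: ler_wpM2r; lra.
  lra.
by move=> h; have := le_lt_trans h (le_lt_trans h2 h4); rewrite ltxx.
Qed.

Lemma size_le_cover_const (R : realFieldType) (T : eqType) (I : finType) (S : {set I})
    (P : T -> I -> bool) (l : seq T) (c : R) :
  (forall x, x \in l -> exists2 j, j \in S & P x j) ->
  (forall j, j \in S -> (size [seq x <- l | P x j])%:R <= c) ->
  (size l)%:R <= #|S|%:R * c.
Proof.
move=> h hc; apply: le_trans (_ : (\sum_(j in S) size [seq x <- l | P x j])%N%:R <= _).
  by rewrite ler_nat; exact: size_le_cover.
rewrite natr_sum mulr_natl -sumr_const; exact: ler_sum.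
Qed.

Lemma size_split (T : Type) (p : pred T) (l : seq T) :
  (size l = size [seq x <- l | p x] + size [seq x <- l | ~~ p x])%N.
Proof. by rewrite !size_filter count_predC. Qed.

(* l_x plays the role of log max(|x|, |y|), del_i that of the logarithm of the
   normalised i-th linear factor and Gam_ij that of the logarithm of the
   normalised resultant of the i-th and j-th factors. *)
Lemma abstract_count (R : realType) (T : eqType) (r s : nat) (l : seq T) (ell : T -> R)
    (del : T -> 'I_r -> R) (Gam : 'I_r -> 'I_r -> R) (S : {set 'I_r})
    (tau eta e Lam w : R) :
  (1000 <= r)%N -> (1 <= s)%N -> 15 * 15 <= w -> w ^+ 2 = (s * r)%:R ->
  0 <= e -> e <= 5 * r%:R -> e + 2 <= 40 * w -> 0 <= eta -> eta <= Lam -> 1 <= Lam ->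
  (#|S| <= 12 * s.+1)%N -> uniq l ->
  (forall i j, Gam i j <= 1) ->
  (r%:R - 1) * (100 * r%:R - 2 * tau) <= \sum_(i < r) \sum_(j < r | j != i) Gam i j ->
  {in l, forall x, 0 <= ell x} ->
  {in l, forall x i j, i != j -> expR (Gam i j) <= expR (del x i) + expR (del x j)} ->
  {in l, forall x, \sum_(i < r) del x i <= - tau - r%:R * ell x} ->
  {in l, forall x, tau - 1 <= \sum_(i < r) ln (1 + expR (- 2 * ell x - del x i))} ->
  {in l &, forall x x', x != x' -> forall i,
     1 <= expR (ell x + ell x' + del x i) + expR (ell x + ell x' + del x' i)} ->
  {in l, forall x i, exists2 j, j \in S & del x j <= e + del x i} ->
  {in l &, forall x x' j,
     del x j <= - (9 / 10 * (r%:R * ell x)) -> del x' j <= - (9 / 10 * (r%:R * ell x')) ->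
     1 <= ell x -> 1 <= ell x' ->
     200 * r%:R * (5 + r%:R + tau + r%:R * eta) <= ell x ->
     ell x' < 11 * (r%:R + 1) * ell x} ->
  (size l)%:R <= 1000 * w + 48 * s%:R * (15 + ln Lam / ln (r%:R - 1)).
Proof.
move=> r1000 s1 hw w2 e0 e5 ew eta0 etaL L1 cS ul hC hS hl0 hD hP hA hG hcov hT.
have rr : 100 <= r%:R :> R by rewrite (ler_nat _ 100); apply: leq_trans r1000.
have ss : 1 <= s%:R :> R by rewrite ler1n.
have r2 : (2 <= r)%N by apply: leq_trans r1000.
have r56 : (56 <= r)%N by apply: leq_trans r1000.
have r1 : (1 <= r)%N by apply: leq_trans r1000.
have htau := tau_lower_bound r2 hC hS.
have t0 : 0 < tau by clear - htau rr; lra.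
have w0 : 0 < w by clear - hw; lra.
have r0 : 0 < r%:R :> R by clear - rr; lra.
(* The balancing height: small points number about 4 r y0 / tau = 4 w, and medium ones at most #|S|
   * 40 tau / y0 = #|S| * 40 r / w, which is O(w) since w^2 = s r. *)
pose y0 := w * tau / r%:R.
have y0w : 99 / 2 * w <= y0.
  rewrite /y0 ler_pdivlMr //.
  by have := ler_wpM2l (ltW w0) htau; clear; lra.
have ry0 : r%:R * y0 = w * tau by rewrite /y0 mulrC divfK // gt_eqF.
have y0p : 0 < y0 by clear - y0w w0; lra.
have ey2 : e + 2 <= y0 by clear - y0w w0 ew; lra.
have ey : e <= y0 by clear - ey2; lra.
have y01 : 1 <= y0 by clear - ey2 e0; lra.
(* The height at which Thue's method starts; 5 + r + tau + r eta bounds the logarithm of 16 times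
   the coefficients of the restricted form. *)
pose T0 := 200 * r%:R * (5 + r%:R + tau + r%:R * eta).
have sS : #|S|%:R <= 24 * s%:R :> R.
  apply: le_trans (_ : (12 * s.+1)%N%:R <= _); first by rewrite ler_nat.
  by rewrite natrM -natr1; clear - ss; lra.
set lr := ln Lam / ln (r%:R - 1).
have lr0 : 0 <= lr by rewrite divr_ge0 // ln_ge0 //; clear - rr; lra.
have med x : x \in l -> y0 < ell x -> exists2 j, j \in S & del x j <= e - 4 * ell x.
  move=> xl h1.
  have l0 : 0 < ell x by exact: lt_trans h1.
  have h2 : 225 * tau <= r%:R * ell x.
    have := ler_wpM2l (ltW r0) (ltW h1); rewrite ry0.
    by have := ler_wpM2r (ltW t0) hw; clear; lra.
  have [i hi] := medium_close r56 hC hS (hD x xl) (hP x xl) (ltW t0) l0 h2.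
  by have [j jS hj] := hcov x xl i; exists j => //; clear - hi hj; lra.
have t40 : 5 * 100 <= 40 * tau by clear - htau rr; lra.
have large x : x \in l -> 40 * tau < ell x ->
    exists2 j, j \in S & del x j <= - (47 / 50 * (r%:R * ell x)).
  move=> xl hx; have [i hi] := large_close r2 hC hS (hD x xl) (hP x xl) htau (ltW hx).
  have [j jS hj] := hcov x xl i; exists j => //.
  (* Since ell >= 500, the loss e <= 5 r is at most r ell / 100, and 19/20 - 1/100 = 47/50. *)
  have h1 : r%:R * (5 * 100) <= r%:R * ell x.
    by apply: ler_wpM2l; [exact: ltW|exact: le_trans t40 (ltW hx)].
  by clear - h1 hi hj e5; lra.
clear hC hS hD hP.
pose p1 x := ell x <= y0; pose p2 x := ell x <= 40 * tau; pose p3 x := ell x <= T0.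
set l1 := [seq x <- l | p1 x]; set m1 := [seq x <- l | ~~ p1 x].
set l2 := [seq x <- m1 | p2 x]; set m2 := [seq x <- m1 | ~~ p2 x].
set l3 := [seq x <- m2 | p3 x]; set l4 := [seq x <- m2 | ~~ p3 x].
have szl : (size l = size l1 + (size l2 + (size l3 + size l4)))%N.
  by rewrite (size_split p1) (size_split p2 m1) (size_split p3 m2).
have in2 x : x \in l2 -> [/\ x \in l, y0 < ell x & ell x <= 40 * tau].
  by rewrite !mem_filter -ltNge => /andP[? /andP[? ?]].
have in3 x : x \in l3 -> [/\ x \in l, 40 * tau < ell x & ell x <= T0].
  by rewrite !mem_filter -!ltNge => /andP[? /andP[? /andP[_ ?]]].
have in4 x : x \in l4 -> [/\ x \in l, 40 * tau < ell x & T0 < ell x].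
  by rewrite !mem_filter -!ltNge => /andP[? /andP[? /andP[_ ?]]].
have u2 : uniq l2 by rewrite !filter_uniq.
have u3 : uniq l3 by rewrite !filter_uniq.
have u4 : uniq l4 by rewrite !filter_uniq.
have b1 : (size l1)%:R <= 24 * s%:R + 4 * w.
  have -> : 4 * w = 4 * (r%:R * y0) / tau.
    by rewrite ry0; field; rewrite gt_eqF.
  apply: le_trans (_ : #|S|%:R + 4 * (r%:R * y0) / tau <= _); last by rewrite lerD2r.
  have in1 x : x \in l1 -> x \in l by rewrite mem_filter => /andP[].
  apply: (small_count (ell := ell) (del := del) (e := e)) => //.
  - by rewrite filter_uniq.
  - by move=> x; rewrite mem_filter => /andP[h xl]; rewrite hl0.
  - by move=> x /in1; exact: hA.
  - by move=> x x' /in1 xl /in1 xl'; exact: hG.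
  - by move=> x /in1; exact: hcov.
clear hA hcov.
have b2 : (size l2)%:R <= 960 * w.
  apply: le_trans (_ : #|S|%:R * (40 * r%:R / w) <= _); last first.
    apply: le_trans (_ : 24 * s%:R * (40 * r%:R / w) <= _).
      apply: ler_wpM2r => //; apply: divr_ge0; last exact: ltW.
      by apply: mulr_ge0; [clear; lra|exact: ltW].
    by rewrite mulrA ler_pdivrMr //; move: w2; rewrite expr2 natrM; clear; lra.
  apply: (@size_le_cover_const _ _ _ S (fun x j => del x j <= e - 4 * ell x)).
    by move=> x /in2[xl h1 _]; exact: med.
  move=> j jS; rewrite ler_pdivlMr //.
  have h : (size [seq x <- l2 | del x j <= e - 4 * ell x])%:R * y0 <= Num.max (40 * tau) 0.
    apply: (@medium_chain _ _ _ ell (fun x => del x j) e) => //; rewrite ?filter_uniq //.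
    - by move=> x; rewrite mem_filter => /andP[hd /in2[_ h1 h2]]; rewrite h2 (ltW h1).
    - by move=> x x'; rewrite mem_filter (mem_filter _ x') => /andP[_ /in2[xl _ _]] /andP[_ /in2[xl' _ _]] xx; exact: hG.
  rewrite max_l in h; last by clear - t0; lra.
  rewrite -(ler_pM2r t0) -mulrA -ry0 mulrCA [_ * tau]mulrAC -mulrA.
  by have := ler_wpM2l (ltW r0) h; clear; lra.
(* As r <= (2/99) tau, the start of Thue's method exceeds 40 tau by a factor of size O(r Lam) only;
   this factor is the source of the log log term. *)
have T0le : T0 <= 6 * r%:R * Lam * (40 * tau).
  have h2 : r%:R * eta <= 2 / 99 * tau * Lam.
    by apply: ler_pM => //; clear - htau; lra.
  have h3 : tau * 1 <= tau * Lam by apply: ler_wpM2l => //; exact: ltW.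
  have h1 : 5 + r%:R + tau + r%:R * eta <= 6 / 5 * (tau * Lam).
    by clear - h2 h3 htau rr; lra.
  have h4 := ler_wpM2l (ltW r0) h1.
  by rewrite /T0; clear - h4; lra.
have lo1 : 1 <= 40 * tau by clear - t40; lra.
have b3 : (size l3)%:R <= 24 * s%:R * (10 / 3 + 2 * lr).
  apply: le_trans (_ : #|S|%:R * (10 / 3 + 2 * lr) <= _).
    apply: (@size_le_cover_const _ _ _ S (fun x j => del x j <= - (47 / 50 * (r%:R * ell x)))).
      by move=> x /in3[xl h1 _]; exact: large.
    move=> j jS; apply: (@large_chain _ _ _ ell (fun x => del x j) _ (40 * tau)) => //; rewrite ?filter_uniq //.
    - by rewrite (ler_nat _ 257); apply: leq_trans r1000.
    - move=> x; rewrite mem_filter => /andP[hd /in3[_ h1 h2]]; rewrite (ltW h1) hd; split=> //.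
      exact: le_trans h2 T0le.
    - by move=> x x'; rewrite mem_filter (mem_filter _ x') => /andP[_ /in3[xl _ _]] /andP[_ /in3[xl' _ _]] xx; exact: hG.
  by apply: ler_wpM2r => //; clear - lr0; lra.
have b4 : (size l4)%:R <= 24 * s%:R * 2 :> R.
  apply: le_trans (_ : #|S|%:R * 2 <= _); last by apply: ler_wpM2r.
  apply: (@size_le_cover_const _ _ _ S (fun x j => del x j <= - (47 / 50 * (r%:R * ell x)))).
    by move=> x /in4[xl h1 _]; exact: large.
  move=> j jS; rewrite (ler_nat _ _ 2).
  apply: (@huge_chain _ _ _ ell (fun x => del x j) r%:R (40 * tau)) => //; rewrite ?filter_uniq //.
  - by move=> x; rewrite mem_filter => /andP[hd /in4[_ h1 _]]; rewrite (ltW h1).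
  - by move=> x x'; rewrite mem_filter (mem_filter _ x') => /andP[_ /in4[xl _ _]] /andP[_ /in4[xl' _ _]] xx; exact: hG.
  - have wk z : 40 * tau < ell z -> del z j <= - (47 / 50 * (r%:R * ell z)) ->
        1 <= ell z /\ del z j <= - (9 / 10 * (r%:R * ell z)).
      move=> hz hd; have z1 : 1 <= ell z by exact: le_trans lo1 (ltW hz).
      have : 0 <= r%:R * ell z by apply: mulr_ge0; [exact: ltW|exact: le_trans ler01 z1].
      by move=> h; split=> //; clear - h hd; lra.
    move=> x x'; rewrite mem_filter (mem_filter _ x') => /andP[hd /in4[xl h1 h2]] /andP[hd' /in4[xl' h1' h2']].
    have [z1 d1] := wk x h1 hd; have [z1' d1'] := wk x' h1' hd'.
    by apply: (hT x x' xl xl' j) => //; exact: ltW.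
have slr : 0 <= s%:R * lr by apply: mulr_ge0 => //; exact: ler0n.
(* In all, 964 w + (24 + 80 + 48) s + 48 s lr. *)
by rewrite szl !natrD; clear - b1 b2 b3 b4 slr ss w0; lra.
Qed.

(** * Solutions of a restricted form *)

Lemma ln_prod (R : realType) (I : Type) (s : seq I) (P : pred I) (F : I -> R) :
  (forall i, P i -> 0 < F i) ->
  ln (\prod_(i <- s | P i) F i) = \sum_(i <- s | P i) ln (F i).
Proof.
move=> F0; elim: s => [|x s IH]; first by rewrite !big_nil ln1.
rewrite !big_cons; case: ifP => // Px.
by rewrite lnM ?IH // posrE ?F0 // prodr_gt0.
Qed.

Lemma ln_le_expR (R : realType) (x y : R) : 0 < x -> x <= expR y -> ln x <= y.
Proof. by move=> x0 h; rewrite -[leRHS]expRK ler_ln ?posrE ?expR_gt0. Qed.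

Lemma ln2_le1 (R : realType) : ln 2 <= 1 :> R.
Proof. by apply: ln_le_expR => //; exact: expR1_ge2. Qed.

(** The form restricted to the lattice spanned by [e] and [g]. It is not expanded in this basis, so
    that [f] remains the sparse polynomial. *)
Definition form_at (r : nat) (f : {poly int}) (e g x : int * int) : int :=
  hom r f (e.1 * x.1 + g.1 * x.2) (e.2 * x.1 + g.2 * x.2).

Lemma hom_linear_factors (K : comNzRingType) r (f : {poly K}) (a0 : K) (al : 'I_r -> K) x y :
  f = a0 *: \prod_(i < r) ('X - (al i)%:P) ->
  hom r f x y = a0 * \prod_(i < r) (x - al i * y).
Proof.
move=> ->; have := hom_prodXsubC [seq al i | i <- enum 'I_r] a0 x y.
by rewrite size_map size_enum_ord big_map big_enum big_map big_enum.
Qed.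

Definition root_line (R : rcfType) (a : R[i]) (e g : int * int) : R[i] * R[i] :=
  lcomp (1, - a) e g.

Lemma normc_form_at (R : rcfType) r (f : {poly int}) (a0 : int) (al : 'I_r -> R[i]) e g x :
  map_poly intr f = a0%:~R *: \prod_(i < r) ('X - (al i)%:P) ->
  `|form_at r f e g x|%:~R = `|a0|%:~R * \prod_(i < r) evz (root_line (al i) e g) x.
Proof.
move=> hf; rewrite -!normc_int /form_at hom_rmorph /= (hom_linear_factors _ _ hf).
rewrite Normc.normcM normc_prod; congr (_ * _); apply: eq_bigr => i _.
rewrite /evz /root_line /lcomp /lin /=; congr normc.
rewrite !rmorphD !rmorphM /=; ring.
Qed.

(** Taken over all ordered pairs, this is the factor m^(r(r-1)) gained by the discriminant on a
    sublattice of index m. *)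
Lemma crs_root_line (R : rcfType) (a b : R[i]) e g :
  crs (root_line a e g) (root_line b e g) = `|detz e g|%:~R * normc (a - b).
Proof.
rewrite crs_lcomp; congr (_ * _); rewrite /crs /=; congr normc; ring.
Qed.

Lemma size_prod_linear (S : comNzRingType) (I : Type) (s : seq I) (L : I -> S * S) :
  (size (\prod_(i <- s) ((L i).1 *: 'X + (L i).2%:P)%R)%R <= (size s).+1)%N.
Proof.
elim: s => [|i s IH]; first by rewrite big_nil size_poly1.
rewrite big_cons; apply: leq_trans (size_polyMleq _ _) _.
have h2 : (size ((L i).1 *: 'X + (L i).2%:P)%R <= 2)%N.
  apply: leq_trans (size_polyD _ _) _; rewrite geq_max; apply/andP; split.
    by apply: leq_trans (size_scale_leq _ _) _; rewrite size_polyX.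
  by apply: leq_trans (size_polyC_leq1 _) _.
by rewrite -subn1 leq_subLR; apply: leq_trans (leq_add h2 IH) _; rewrite add1n.
Qed.

(** The sum of the moduli of the coefficients is submultiplicative, and a linear factor contributes
    at most twice its height. *)
Lemma prod_poly_coef_le (R : rcfType) (I : Type) (s : seq I) (L : I -> R[i] * R[i]) k :
  normc (\prod_(i <- s) ((L i).1 *: 'X + (L i).2%:P))`_k <= \prod_(i <- s) (2 * hgt (L i)).
Proof.
apply: le_trans (_ : \sum_(k < (size s).+1)
    normc (\prod_(i <- s) ((L i).1 *: 'X + (L i).2%:P))`_k <= _).
  have [hk|hk] := ltnP k (size s).+1.
    by rewrite (bigD1 (Ordinal hk)) //= lerDl sumr_ge0 // => i _; exact: normc_ge0.
  rewrite nth_default ?Normc.normc0; last by apply: leq_trans hk; exact: size_prod_linear.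
  by rewrite sumr_ge0 // => i _; exact: normc_ge0.
elim: s {k} => [|i s IH].
  by rewrite !big_nil big_ord1 coef1 eqxx mulr1n Normc.normc1.
rewrite !big_cons /=; set P := \prod_(j <- s) _ in IH *.
have hP0 : 0 <= \prod_(j <- s) (2 * hgt (L j)).
  by rewrite prodr_ge0 // => j _; rewrite mulr_ge0 ?hgt_ge0.
apply: le_trans (_ : \sum_(k < (size s).+2) (hgt (L i) * normc (if (k == 0 :> nat)%N then 0 else P`_k.-1)
    + hgt (L i) * normc P`_k) <= _).
  apply: ler_sum => k _; rewrite mulrDl coefD -scalerAl coefZ coefXM mul_polyC coefZ.
  apply: le_trans (normc_le_add _ _) _; rewrite !Normc.normcM.
  by apply: lerD; apply: ler_wpM2r; rewrite ?normc_ge0 ?normc_hgt1 ?normc_hgt2.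
rewrite big_split /= -!mulr_sumr.
have -> : \sum_(k < (size s).+2) normc (if (k == 0 :> nat)%N then 0 else P`_k.-1) =
    \sum_(k < (size s).+1) normc P`_k.
  rewrite big_ord_recl [X in X + _](_ : _ = 0) ?add0r; last exact: Normc.normc0.
  by apply: eq_bigr => k _; rewrite lift0.
have -> : \sum_(k < (size s).+2) normc P`_k = \sum_(k < (size s).+1) normc P`_k.
  rewrite big_ord_recr /= nth_default ?Normc.normc0 ?addr0 //.
  exact: size_prod_linear.
have := ler_wpM2l (hgt_ge0 (L i)) IH; lra.
Qed.

(** With u_i = |L_i(1, 0)| and v_i the heights, it shows that no root of the restricted form exceeds
    M in modulus. *)
Lemma factor_le_prod (R : realFieldType) (I : finType) (c : R) (u v : I -> R) j :
  0 <= c -> (forall i, 0 <= u i <= v i) -> 1 <= c * \prod_i u i ->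
  v j <= c * \prod_i v i * u j.
Proof.
move=> c0 huv h; have v0 i : 0 <= v i by case/andP: (huv i) => /le_trans; apply.
apply: le_trans (_ : v j * (c * \prod_i u i) <= _); first by rewrite ler_peMr.
rewrite (bigD1 j) //= (bigD1 j (F := v)) //=.
rewrite [leLHS](_ : _ = c * (v j * u j) * \prod_(i | i != j) u i); last by ring.
rewrite [leRHS](_ : _ = c * (v j * u j) * \prod_(i | i != j) v i); last by ring.
have u0 : 0 <= u j by case/andP: (huv j).
by apply: ler_wpM2l; [rewrite !mulr_ge0|exact: ler_prod].
Qed.

(** From projective to affine closeness. As the root is at most M in modulus, |x.2| is at least
    max(|x.1|, |x.2|) / (2 M); dividing by x.2 and by L.1 costs 2 M and M. *)
Lemma close_ratio (R : realType) (L : R[i] * R[i]) (x : int * int) (M d : R) :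
  1 <= M -> hgt L <= M * normc L.1 -> 0 < hgt L -> x != (0, 0) ->
  evz L x <= d * (hgt L * (maxz x)%:~R) -> 2 * M * d <= 1 ->
  x.2 != 0 /\ normc (x.1%:~R / x.2%:~R - - (L.2 / L.1)) <= 2 * M ^+ 2 * d.
Proof.
move=> M1 hM h0 x0 hx hd.
have X0 : 0 < (maxz x)%:~R :> R by rewrite ltr0z maxz_gt0.
have M0 : 0 < M by lra.
have L10 : 0 < normc L.1.
  by rewrite -(pmulr_rgt0 _ M0); apply: lt_le_trans hM.
have L1C : L.1 != 0 by rewrite -normc_gt0.
have d0 : 0 <= d.
  have hX : 0 < hgt L * (maxz x)%:~R by rewrite mulr_gt0.
  by rewrite -(pmulr_lge0 _ hX); apply: le_trans (evz_ge0 _ _) hx.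
have key : (maxz x)%:~R <= 2 * M * `|x.2|%:~R.
  rewrite /maxz in X0 hx *; case: (leP `|x.1| `|x.2|) X0 hx => h12 X0 hx.
    by rewrite ler_peMl ?ler0z //; lra.
  have h1 : normc L.1 * `|x.1|%:~R <= hgt L * `|x.2|%:~R + d * (hgt L * `|x.1|%:~R).
    rewrite -{1}normc_int -Normc.normcM.
    have -> : L.1 * x.1%:~R = lin L x.1%:~R x.2%:~R - L.2 * x.2%:~R by rewrite /lin; ring.
    apply: le_trans (le_normcB _ _) _; rewrite addrC; apply: lerD => //.
    by rewrite Normc.normcM normc_int; apply: ler_wpM2r; rewrite ?normc_hgt2 ?ler0z.
  have h2 : hgt L * `|x.1|%:~R <= M * (hgt L * `|x.2|%:~R + d * (hgt L * `|x.1|%:~R)).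
    apply: le_trans (ler_wpM2l (ltW M0) h1); rewrite mulrA.
    by apply: ler_wpM2r => //; exact: ltW.
  rewrite -(ler_pM2l h0).
  have h3 : M * d * (hgt L * `|x.1|%:~R) <= 2^-1 * (hgt L * `|x.1|%:~R).
    by apply: ler_wpM2r; [rewrite mulr_ge0 // ltW|clear - hd; lra].
  by clear - h2 h3; lra.
have x20 : x.2 != 0.
  by apply/eqP => e; move: key; rewrite e normr0 mulr0 leNgt X0.
have x2p : 0 < `|x.2|%:~R :> R by rewrite ltr0z normr_gt0.
split=> //.
have x2C : (x.2%:~R : R[i]) != 0 by rewrite intr_eq0.
have -> : x.1%:~R / x.2%:~R - - (L.2 / L.1) = lin L x.1%:~R x.2%:~R / (L.1 * x.2%:~R).
  rewrite /lin; move: (L.1) L1C (L.2) (x.1) (x.2) x2C => p p0 q m n n0.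
  by field; rewrite p0 n0.
rewrite Normc.normcM Normc.normcV Normc.normcM normc_int ler_pdivrMr ?mulr_gt0 //.
apply: le_trans hx _.
have h1 : hgt L * (maxz x)%:~R <= M * normc L.1 * (2 * M * `|x.2|%:~R).
  by apply: ler_pM => //; apply: ltW.
by have := ler_wpM2l d0 h1; rewrite expr2; clear; lra.
Qed.

Lemma form_at_neq0 r (f : {poly int}) e g x :
  (forall u v, (u, v) != (0, 0) -> hom r f u v != 0) -> detz e g != 0 ->
  x != (0, 0) -> form_at r f e g x != 0.
Proof.
move=> hnz hd x0; apply: hnz; apply: contraNneq x0 => -[h1 h2].
have e1 : detz e g * x.1 = 0.
  transitivity ((e.1 * x.1 + g.1 * x.2) * g.2 - (e.2 * x.1 + g.2 * x.2) * g.1); last by rewrite h1 h2 !mul0r subrr.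
  by rewrite /detz; move: (e.1) (e.2) (g.1) (g.2) (x.1) (x.2) => *; ring.
have e2 : detz e g * x.2 = 0.
  transitivity ((e.2 * x.1 + g.2 * x.2) * e.1 - (e.1 * x.1 + g.1 * x.2) * e.2); last by rewrite h1 h2 !mul0r subrr.
  by rewrite /detz; move: (e.1) (e.2) (g.1) (g.2) (x.1) (x.2) => *; ring.
move/eqP: e1; move/eqP: e2; rewrite !mulf_eq0 (negbTE hd) /= => /eqP h /eqP h'.
by rewrite [x]surjective_pairing h h'.
Qed.

Lemma form_poly (R : realType) r (f : {poly int}) (a0 : int) (al : 'I_r -> R[i]) e g :
  map_poly intr f = a0%:~R *: \prod_(i < r) ('X - (al i)%:P) -> a0 != 0 ->
  injective al -> detz e g != 0 ->
  let L i := root_line (al i) e g in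
  let M := `|a0|%:~R * \prod_(i < r) hgt (L i) in
  (forall i, (L i).1 != 0) ->
  exists fG : {poly int}, [/\ size fG = r.+1, forall k, `|fG`_k|%:~R <= 2 ^+ r * M &
    exists als : seq R[i], [/\ als = [seq - ((L i).2 / (L i).1) | i <- enum 'I_r], uniq als &
      forall b, b \in als -> root (map_poly intr fG) b]].
Proof.
move=> hf a00 ial hd L M hL.
pose fG := hom r (map_poly polyC f) (e.1 *: 'X + g.1%:P) (e.2 *: 'X + g.2%:P).
have hG : map_poly intr fG = a0%:~R *: \prod_(i < r) ((L i).1 *: 'X + (L i).2%:P).
  rewrite /fG (hom_linear_roots _ _ _ _ hf); congr (_ *: _); apply: eq_bigr => i _.
  by rewrite /L /root_line /lcomp /lin /= !mul1r !mulNr.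
pose be i := - ((L i).2 / (L i).1).
have hG' : map_poly intr fG =
    (a0%:~R * \prod_(i < r) (L i).1) *: \prod_(b <- [seq be i | i <- enum 'I_r]) ('X - b%:P).
  rewrite hG -scalerA; congr (_ *: _); rewrite big_map big_enum -scaler_prod /=.
  apply: eq_bigr => i _; rewrite scalerBr /be polyCN scalerN opprK; congr (_ + _).
  by rewrite -mul_polyC -polyCM mulrCA divff ?mulr1 ?hL.
have c0 : a0%:~R * \prod_(i < r) (L i).1 != 0.
  by rewrite mulf_neq0 ?intr_eq0 //; apply/prodf_neq0 => i _; exact: hL.
exists fG; split.
- have <- : size (map_poly intr fG : {poly R[i]}) = size fG.
    by rewrite size_map_inj_poly //; apply: intr_inj.
  by rewrite hG' size_scale // size_prod_XsubC size_map size_enum_ord.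
- move=> k; rewrite -(normc_int R) -coef_map /= hG coefZ Normc.normcM normc_int.
  apply: le_trans (_ : `|a0|%:~R * \prod_(i < r) (2 * hgt (L i)) <= _).
    by apply: ler_wpM2l; [rewrite ler0z|exact: prod_poly_coef_le].
  by rewrite big_split /= prodr_const card_ord /M mulrCA.
exists [seq be i | i <- enum 'I_r]; split=> //.
  rewrite map_inj_uniq ?enum_uniq // => i j /oppr_inj /eqP.
  rewrite eqr_div // => /eqP h; apply/eqP/contraT => ij.
  have : crs (L i) (L j) = 0.
    by rewrite /crs h mulrC subrr Normc.normc0.
  rewrite crs_root_line => /eqP; rewrite mulf_eq0 intr_eq0 normr_eq0 (negbTE hd) /=.
  by rewrite normc_eq0 subr_eq0 => /eqP /ial /eqP; rewrite (negbTE ij).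
move=> b hb; rewrite hG' rootZ // root_prod_XsubC //.
Qed.

(** The passage from 9/10 to 17/20 pays for 2 M^2, because r t / 20 exceeds 1 + 2 mu. *)
Lemma thue_exponents (R : realType) (r M mu t : R) :
  100 <= r -> M = expR mu -> 0 <= mu -> 200 * r * (5 + r + mu) <= t ->
  2 * M * expR (- (9 / 10 * (r * t))) <= 1 /\
  2 * M ^+ 2 * expR (- (9 / 10 * (r * t))) <= expR (- (17 / 20 * r * t)).
Proof.
move=> r1 -> m0 ht; have e2 := expR1_ge2 R.
have h1 : 200 * 100 * (5 + mu) <= 200 * r * (5 + r + mu).
  by apply: ler_pM; lra.
have rt : 100 * t <= r * t by apply: ler_wpM2r; lra.
split.
  apply: le_trans (_ : expR 1 * expR mu * expR (- (9 / 10 * (r * t))) <= _).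
    by rewrite !ler_wpM2r ?expR_ge0.
  by rewrite -!expRD expR_le1; lra.
apply: le_trans (_ : expR 1 * expR mu ^+ 2 * expR (- (9 / 10 * (r * t))) <= _).
  by rewrite !ler_wpM2r ?exprn_ge0 ?expR_ge0.
by rewrite expr2 -!expRD ler_expR; lra.
Qed.

(** Siegel's lemma needs an integral bound on the coefficients: 2^r M is rounded up, and 16 * 2 <=
    e^5 accounts for the 5. *)
Lemma natural_height (R : realType) r (M mu : R) :
  M = expR mu -> 0 <= mu -> exists H : nat,
  [/\ (1 <= H)%N, 2 ^+ r * M <= H%:R & ln (16 * H)%:R <= 5 + r%:R + mu].
Proof.
move=> -> m0; set B := 2 ^+ r * _.
have p1 : 1 <= 2 ^+ r :> R by apply: exprn_ege1; lra.
have B1 : 1 <= B.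
  by rewrite -[leLHS]mulr1; apply: ler_pM => //; rewrite -[leLHS](expR0 R) ler_expR.
have /andP[h1 h2] := truncn_itv (le_trans ler01 B1).
exists (Num.truncn B).+1; split=> //; first exact: ltW.
apply: ln_le_expR; first by rewrite ltr0n.
apply: le_trans (_ : 2 ^+ 5 * B <= _).
  have -> : 2 ^+ 5 = 16 * 2 :> R by ring.
  by rewrite natrM -natr1; lra.
have e5 : expR (5 + r%:R) = expR 1 ^+ (5 + r) :> R by rewrite -expRM_natl mulr1 natrD.
rewrite /B mulrA -exprD expRD e5.
by apply: ler_wpM2r; [exact: expR_ge0|apply: lerXn2r; rewrite ?nnegrE ?expR_ge0 ?expR1_ge2].
Qed.

Lemma close_solutions_gap (R : realType) r (f : {poly int}) (a0 : int) (al : 'I_r -> R[i])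
    e g (x x' : int * int) (j : 'I_r) (mu : R) :
  (100 <= r)%N ->
  map_poly intr f = a0%:~R *: \prod_(i < r) ('X - (al i)%:P) -> a0 != 0 ->
  injective al -> (forall u v, (u, v) != (0, 0) -> hom r f u v != 0) -> detz e g != 0 ->
  let L i := root_line (al i) e g in
  let ell z : R := ln (maxz z)%:~R in
  let close z := evz (L j) z <= expR (- (9 / 10 * (r%:R * ell z))) * (hgt (L j) * (maxz z)%:~R) in
  `|a0|%:~R * \prod_(i < r) hgt (L i) = expR mu -> x != (0, 0) -> x' != (0, 0) ->
  close x -> close x' -> 1 <= ell x -> 1 <= ell x' ->
  200 * r%:R * (5 + r%:R + mu) <= ell x -> ell x' < 11 * (r%:R + 1) * ell x.
Proof.
move=> r100 hf a00 ial hnz hd L ell close hM x0 x0' hx hx' l1 l1' hl.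
have rr : 100 <= r%:R :> R by rewrite (ler_nat _ 100).
have [hlt|hlt] := lerP (ell x') (ell x).
  apply: le_lt_trans hlt _; rewrite ltr_pMl; [clear - rr; lra|clear - l1; lra].
have a01 : 1 <= `|a0|%:~R :> R by rewrite ler1z -gtz0_ge1 normr_gt0.
have evL z : z != (0, 0) -> 1 <= `|a0|%:~R * \prod_(i < r) evz (L i) z.
  by move=> z0; rewrite -(normc_form_at e g z hf) ler1z -gtz0_ge1 normr_gt0 form_at_neq0.
have ev0 i z : z != (0, 0) -> evz (L i) z != 0.
  move=> z0; have := evL z z0; rewrite (bigD1 i) //=; apply: contraTneq => ->.
  by rewrite mul0r mulr0 ler10.
(* The form takes a non-zero integral value at (1, 0): no factor loses its first coefficient, and
   the roots are bounded by M. *)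
have e10 : ((1, 0) : int * int) != (0, 0) by [].
have evz10 i : evz (L i) (1, 0) = normc (L i).1 by rewrite /evz /lin mulr1 mulr0 addr0.
have L1 i : (L i).1 != 0 by rewrite -normc_eq0 -evz10 ev0.
set M := _ * _ in hM.
have hMj i : hgt (L i) <= M * normc (L i).1.
  rewrite -evz10; apply: (@factor_le_prod _ _ `|a0|%:~R (fun i => evz (L i) (1, 0)) (fun i => hgt (L i))).
  - exact: le_trans ler01 a01.
  - by move=> k; rewrite evz_ge0 evz10 normc_hgt1.
  - exact: evL.
have M1 : 1 <= M.
  apply: le_trans (evL (1, 0) e10) _; apply: ler_wpM2l; first exact: le_trans ler01 a01.
  by apply: ler_prod => i _; rewrite evz_ge0 evz10 normc_hgt1.
have mu0 : 0 <= mu by rewrite -(ler_expR (0 : R)) expR0 -hM.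
have [fG [sG cG [als [alsE uals rals]]]] := form_poly hf a00 ial hd L1.
have [Hf [H1 HM Hln]] := natural_height r hM mu0.
have hl' : 200 * r%:R * (5 + r%:R + mu) <= ell x' by apply: le_trans hl (ltW hlt).
have hj0 : 0 < hgt (L j) by rewrite hgt_gt0.
have [b1 c1] := thue_exponents rr hM mu0 hl.
have [b2 c2] := thue_exponents rr hM mu0 hl'.
have [y1 d1] := close_ratio M1 (hMj j) hj0 x0 hx b1.
have [y2 d2] := close_ratio M1 (hMj j) hj0 x0' hx' b2.
have p2 : 1 <= 2 ^+ r :> R by apply: exprn_ege1; rewrite ler1n.
apply: (@thue_gap R fG r Hf als (- ((L j).2 / (L j).1)) x.1 x.2 x'.1 x'.2) => //.
- move=> k; rewrite -(ler_int R); apply: le_trans (cG k) _; exact: HM.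
- by rewrite alsE size_map size_enum_ord.
(* A rational root v / u would be an integral zero (v, u) of the restricted form. *)
- move=> b u v; rewrite alsE => /mapP[i _ ->] u0.
  have : evz (L i) (v, u) != 0 by rewrite ev0 // xpair_eqE (negbTE u0) andbF.
  rewrite /evz normc_eq0 /lin /=; apply: contraNneq => e1.
  by rewrite -e1 mulrN mulrCA mulrN mulrA mulrCA divff ?mulr1 ?L1 // mulrC addNr.
- by rewrite alsE; apply/mapP; exists j; rewrite ?mem_enum.
- rewrite normc_opp Normc.normcM Normc.normcV ler_pdivrMr ?normc_gt0 ?L1 //.
  apply: le_trans (normc_hgt2 _) _; apply: le_trans (hMj j) _.
  apply: ler_wpM2r; first exact: normc_ge0.
  by apply: le_trans HM; rewrite ler_peMl // (le_trans ler01).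
- by rewrite lnK ?maxz2 // posrE ltr0z maxz_gt0.
- by rewrite lnK ?maxz2 // posrE ltr0z maxz_gt0.
- exact: le_trans d1 c1.
- exact: le_trans d2 c2.
- by apply: le_trans hl; apply: ler_wpM2l => //; rewrite mulr_ge0 // ler0n.
Qed.

Lemma ln_le1 (R : realType) (t : R) : t <= 2 -> ln t <= 1.
Proof.
move=> t2; have [t0|t0] := lerP t 0; first by rewrite ln0.
by apply: ln_le_expR => //; apply: le_trans t2 (expR1_ge2 R).
Qed.

Lemma ln_le_id (R : realType) (t : R) : 0 < t -> ln t <= t.
Proof. by move=> t0; apply: ln_le_expR => //; apply: le_trans (expR_ge1Dx t); rewrite lerDr. Qed.

(** 5 ln r is the logarithm of the loss r^5 in [few_close_factors]; it is compared with w through ln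
    r <= ln(w^2) <= 2 w. *)
Lemma cover_exponent (R : realType) (r s : nat) (w : R) :
  (1000 <= r)%N -> (1 <= s)%N -> 1 <= w -> w ^+ 2 = (s * r)%:R ->
  [/\ 0 <= 5 * ln r%:R :> R, 5 * ln r%:R <= 5 * r%:R :> R & 5 * ln r%:R + 2 <= 40 * w].
Proof.
move=> r1 s1 w1 w2.
have r0 : 0 < r%:R :> R by rewrite ltr0n; apply: leq_trans r1.
have h1 : ln r%:R <= r%:R :> R by apply: ln_le_id.
have h2 : ln r%:R <= 2 * w.
  have w0 : 0 < w by lra.
  apply: le_trans (_ : ln (w ^+ 2) <= _).
    by rewrite ler_ln ?posrE ?exprn_gt0 // w2 ler_nat leq_pmull.
  rewrite lnXn // -mulr_natl.
  by have := ln_le_id w0; lra.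
have h0 : 0 <= ln r%:R :> R by rewrite ln_ge0 // ler1n; apply: leq_trans r1.
by split; lra.
Qed.

(** [w] stands for the square root of s r; its lower bound 225 is what [medium_close] requires at
    heights above w tau / r. *)
Definition sparse_form (R : realType) r s (f : {poly int}) (a0 : int) (al : 'I_r -> R[i])
    (w : R) : Prop :=
  [/\ (1000 <= r)%N /\ (1 <= s)%N, 15 * 15 <= w /\ w ^+ 2 = (s * r)%:R,
      [/\ map_poly intr f = a0%:~R *: \prod_(i < r) ('X - (al i)%:P), a0 != 0 & injective al],
      forall u v, (u, v) != (0, 0) -> hom r f u v != 0 & (nterms r.+1 f <= s.+1)%N].

(** The logarithm of |D(F)|: summing over ordered pairs accounts for the squares. *)
Definition log_disc (R : realType) r (a0 : int) (al : 'I_r -> R[i]) : R :=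
  2 * (r%:R - 1) * ln `|a0|%:~R + \sum_(i < r) \sum_(j < r | j != i) ln (normc (al i - al j)).

(** Bounds the primitive solutions, up to sign, in one sublattice; 1000 = 40 * 25 matches the last
    factor of the final bound. *)
Definition prim_bound (R : realType) (r s : nat) (w Lam : R) : R :=
  1000 * w + 48 * s%:R * (15 + ln Lam / ln (r%:R - 1)).

Lemma sum_offdiag_add (R : realFieldType) r (u : 'I_r -> R) :
  \sum_(i < r) \sum_(j < r | j != i) (u i + u j) = 2 * (r%:R - 1) * \sum_(i < r) u i.
Proof.
have inner (i : 'I_r) : \sum_(j < r | j != i) (u i + u j) = (r%:R - 2) * u i + \sum_(j < r) u j.
  by rewrite big_split /= sum_neq_const [in RHS](bigD1 i) //=; ring.
under eq_bigr do rewrite inner.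
rewrite big_split /= -mulr_sumr sumr_const card_ord -mulr_natl; ring.
Qed.

(** The dictionary for [abstract_count]: [mu] is the logarithm of M, tau = mu - r ln H and eta = ln
    H. The powers of H^2 in the condition on the discriminant cancel against the r ln H in tau. *)
Lemma reduced_count (R : realType) r s (f : {poly int}) (a0 : int) (al : 'I_r -> R[i])
    e g (l : seq (int * int)) (H Lam w : R) :
  sparse_form s f a0 al w -> detz e g != 0 -> 1 <= H -> ln H <= Lam -> 1 <= Lam ->
  let L i := root_line (al i) e g in
  (forall x y, detz x y = 1 ->
     \prod_(i < r) hgt (L i) <= 2 * \prod_(i < r) hgt (lcomp (L i) x y)) ->
  r%:R * (r%:R - 1) * (100 + 2 * ln H) <= r%:R * (r%:R - 1) * ln `|detz e g|%:~R +
    log_disc a0 al ->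
  uniq l -> {in l, forall x, coprimez x.1 x.2} ->
  {in l, forall x, `|form_at r f e g x|%:~R <= H ^+ r} ->
  {in l &, forall x x', x != x' -> detz x x' != 0} ->
  (size l)%:R <= prim_bound r s w Lam.
Proof.
move=> [[r1000 s1] [hw w2] [hf a00 ial] hnz nf] hd H1 HL L1 L red hK ul cl bl pl.
have r0 : (0 < r)%N by apply: leq_trans r1000.
have rr : 100 <= r%:R :> R by rewrite (ler_nat _ 100); apply: leq_trans r1000.
have a01 : 1 <= `|a0|%:~R :> R by rewrite ler1z -gtz0_ge1 normr_gt0.
have Hp : 0 < H by exact: lt_le_trans H1.
have a0p : 0 < `|a0|%:~R :> R by apply: lt_le_trans a01.
have nz x : coprimez x.1 x.2 -> x != (0, 0) by case: x => u v c; apply: contraTneq c => -[-> ->].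
have evL z : z != (0, 0) -> 0 < `|a0|%:~R * \prod_(i < r) evz (L i) z.
  by move=> z0; rewrite -(normc_form_at e g z hf) ltr0z normr_gt0 form_at_neq0.
have ev0 i z : z != (0, 0) -> 0 < evz (L i) z.
  move=> z0; rewrite lt_def evz_ge0 andbT; have := evL z z0; rewrite (bigD1 i) //=.
  by apply: contraTneq => ->; rewrite mul0r mulr0 ltxx.
have L1' i : (L i).1 != 0.
  by have := ev0 i (1, 0) isT; rewrite /evz /lin mulr1 mulr0 addr0 normc_gt0.
have L2' i : (L i).2 != 0.
  by have := ev0 i (0, 1) isT; rewrite /evz /lin mulr1 mulr0 add0r normc_gt0.
have h0 i : 0 < hgt (L i) by rewrite hgt_gt0.
have X1 z : z != (0, 0) -> 1 <= (maxz z)%:~R :> R by move=> /maxz_gt0; rewrite ler1z gtz0_ge1.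
have X0 z : z != (0, 0) -> 0 < (maxz z)%:~R :> R by move=> /X1; apply: lt_le_trans.
pose ell z : R := ln (maxz z)%:~R.
pose del z i := ln (evz (L i) z / (hgt (L i) * (maxz z)%:~R)).
pose Gam i j := ln (crs (L i) (L j) / (hgt (L i) * hgt (L j))).
pose sh := \sum_(i < r) ln (hgt (L i)).
pose mu := ln `|a0|%:~R + sh.
have eell z : z != (0, 0) -> expR (ell z) = (maxz z)%:~R by move=> /X0 z0; rewrite lnK.
have edel z i : z != (0, 0) -> expR (del z i) = evz (L i) z / (hgt (L i) * (maxz z)%:~R).
  by move=> z0; rewrite lnK // posrE divr_gt0 ?mulr_gt0 ?ev0 ?h0 ?X0.
have crs0 i j : i != j -> 0 < crs (L i) (L j).
  move=> ij; rewrite crs_root_line mulr_gt0 ?ltr0z ?normr_gt0 // normc_gt0 subr_eq0.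
  by apply: contra ij => /eqP /ial ->.
have eGam i j : i != j -> expR (Gam i j) = crs (L i) (L j) / (hgt (L i) * hgt (L j)).
  by move=> ij; rewrite lnK // posrE divr_gt0 ?mulr_gt0 ?crs0.
have ldel z i : z != (0, 0) -> del z i = ln (evz (L i) z) - ln (hgt (L i)) - ell z.
  by move=> z0; rewrite /del ln_div ?lnM ?posrE ?mulr_gt0 ?ev0 ?X0 // opprD addrA.
have sdel z : z != (0, 0) -> \sum_(i < r) del z i = \sum_(i < r) ln (evz (L i) z) - sh - r%:R * ell z.
  move=> z0; under eq_bigr do rewrite ldel //.
  by rewrite !big_split /= !sumrN sumr_const card_ord -(mulr_natl (ell z)).
have sev z : z \in l -> ln `|a0|%:~R + \sum_(i < r) ln (evz (L i) z) <= r%:R * ln H.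
  move=> zl; have z0 := nz _ (cl _ zl).
  rewrite -ln_prod; last by move=> i _; exact: ev0.
  rewrite -lnM ?posrE ?prodr_gt0 //; last by move=> i _; exact: ev0.
  rewrite -(normc_form_at e g z hf) mulr_natl -lnXn //.
  have f0 : 0 < `|form_at r f e g z|%:~R :> R by rewrite ltr0z normr_gt0 form_at_neq0.
  by rewrite ler_ln ?posrE ?f0 ?exprn_gt0 //; exact: bl.
have w1 : 1 <= w by clear - hw; lra.
have [e0 e5 ew] := cover_exponent r1000 s1 w1 w2.
have [S [cS hS]] : exists S : {set 'I_r}, (#|S| <= 12 * s.+1)%N /\
    forall x i, x != (0, 0) -> exists2 j, j \in S & del x j <= 5 * ln r%:R + del x i.
  pose fR : {poly R} := map_poly intr f.
  have hfR : map_poly (real_complex R) fR = a0%:~R *: \prod_(i < r) ('X - (al i)%:P).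
    rewrite -hf -map_poly_comp; apply: eq_map_poly => z /=; by rewrite rmorph_int.
  have sf : (size fR <= r.+1)%N.
    rewrite -(size_map_inj_poly (fmorph_inj (real_complex R))) ?rmorph0 // hfR.
    apply: leq_trans (size_scale_leq _ _) _.
    by rewrite -(big_enum _ _ xpredT) -(big_map al xpredT (fun z => 'X - z%:P)) /= size_prod_XsubC size_map size_enum_ord.
  have nfR : (nterms r.+1 fR <= s.+1)%N.
    apply: leq_trans nf; apply: leq_sum => i _.
    by rewrite coef_map /= intr_eq0.
  have dR : (e.1%:~R * g.2%:~R - g.1%:~R * e.2%:~R : R) != 0.
    by rewrite -!rmorphM -rmorphB intr_eq0 /= mulrC [g.1 * _]mulrC mulrC.
  have hl (i : 'I_r) : (real_complex R e.1%:~R - al i * real_complex R e.2%:~R,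
              real_complex R g.1%:~R - al i * real_complex R g.2%:~R) = L i.
    by rewrite /L /root_line /lcomp /lin /= !mul1r !mulNr !rmorph_int.
  have [] := few_close_factors _ sf nfR hfR _ dR.
  - by apply: leq_trans r1000.
  - by rewrite intr_eq0.
  - by move=> i; rewrite hl.
  move=> S [cS hS]; exists S; split=> // x i x0.
  have [j jS hj] := hS x.1%:~R x.2%:~R i; exists j => //.
  move: hj; rewrite !hl !rmorph_int -!/(evz _ _) => hj.
  have e1 : 5 * ln r%:R = ln (r%:R ^+ 5) :> R by rewrite lnXn ?ltr0n // mulr_natl.
  have r5 : 0 < r%:R ^+ 5 :> R by rewrite exprn_gt0 // ltr0n.
  rewrite e1 !ldel //.
  have : ln (evz (L j) x * hgt (L i)) <= ln (r%:R ^+ 5 * evz (L i) x * hgt (L j)).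
    by rewrite ler_ln ?posrE ?mulr_gt0 ?mulr_gt0 ?ev0 ?h0 ?r5 // ltr0n.
  rewrite !lnM ?posrE ?mulr_gt0 ?ev0 ?h0 ?r5 ?ltr0n //; clear; lra.
apply: (@abstract_count R _ r s l ell del Gam S (mu - r%:R * ln H) (ln H) (5 * ln r%:R)) => //.
- by rewrite ln_ge0.
- move=> i j; apply: ln_le1; rewrite ler_pdivrMr ?mulr_gt0 //; exact: crs_le.
- have inner (i : 'I_r) : \sum_(j < r | j != i) Gam i j =
      (r%:R - 1) * ln `|detz e g|%:~R + \sum_(j < r | j != i) ln (normc (al i - al j))
      - \sum_(j < r | j != i) (ln (hgt (L i)) + ln (hgt (L j))).
    rewrite -(sum_neq_const i) -big_split /= -sumrB; apply: eq_bigr => j; rewrite eq_sym => ij.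
    rewrite /Gam ln_div ?posrE ?mulr_gt0 ?crs0 ?h0 // crs_root_line.
    have na : 0 < normc (al i - al j).
      by rewrite normc_gt0 subr_eq0; apply: contra ij => /eqP /ial ->.
    by rewrite !lnM ?posrE ?ltr0z ?normr_gt0 ?h0.
  under eq_bigr do rewrite inner.
  rewrite sumrB big_split /= sumr_const card_ord -[_ *+ r]mulr_natl.
  rewrite sum_offdiag_add -/sh.
  move: hK; rewrite /log_disc /mu; clear; nra.
- by move=> x /cl /nz /X1 hx; rewrite ln_ge0.
- move=> x /cl /nz x0 i j ij; rewrite eGam // !edel // ler_pdivrMr ?mulr_gt0 //.
  have := crs_maxz_le (L i) (L j) x; have := X0 _ x0; have := h0 i; have := h0 j.
  move: (hgt (L j)) (hgt (L i)) (maxz x)%:~R => p q X p0 q0 Xp h.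
  rewrite [leRHS](_ : _ = (evz (L i) x * p + evz (L j) x * q) / X); last first.
    by field; rewrite !gt_eqF.
  by rewrite ler_pdivlMr.
- by move=> x xl; rewrite sdel ?nz ?cl //; have := sev x xl; rewrite /mu; clear; lra.
- move=> x xl; have x0 := nz _ (cl _ xl).
  have [y dy hy] := complete_basis R (cl _ xl).
  have q0 i : 0 < 1 + expR (- 2 * ell x - del x i) by rewrite addr_gt0 ?expR_gt0.
  (* With X = max(|x.1|, |x.2|), exp(-2 ell - del_i) = hgt(L_i) / (X |L_i(x)|), so the right side is
     the bound |L_i(x)| + hgt(L_i) / X of [complete_basis]. *)
  have hxy i : hgt (lcomp (L i) x y) <= evz (L i) x * (1 + expR (- 2 * ell x - del x i)).
    apply: le_trans (hy _) _; rewrite expRB edel // mulNr expRN mulr_natl mulr2n expRD eell //.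
    have := X0 _ x0; have := h0 i; have := ev0 i _ x0; move: (hgt _) (evz _ _) (maxz x)%:~R.
    move=> h E X E0 hp Xp; rewrite le_eqVlt; apply/orP; left; apply/eqP.
    by field; rewrite !gt_eqF.
  have h1 : \prod_(i < r) hgt (L i) <=
      2 * (\prod_(i < r) evz (L i) x * \prod_(i < r) (1 + expR (- 2 * ell x - del x i))).
    apply: le_trans (red x y dy) _; apply: ler_wpM2l => //.
    by rewrite -big_split; apply: ler_prod => i _; rewrite hgt_ge0 hxy.
  (* The factor 2 in near-minimality costs ln 2 <= 1, hence tau - 1 in place of tau. *)
  have h2 : sh <= 1 + (\sum_(i < r) ln (evz (L i) x) + \sum_(i < r) ln (1 + expR (- 2 * ell x - del x i))).
    rewrite /sh -!ln_prod //; last by move=> i _; exact: ev0.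
    have p1 : 0 < \prod_(i < r) evz (L i) x by apply: prodr_gt0 => i _; exact: ev0.
    have p2 : 0 < \prod_(i < r) (1 + expR (- 2 * ell x - del x i)) by apply: prodr_gt0.
    have p3 : 0 < \prod_(i < r) hgt (L i) by apply: prodr_gt0.
    apply: le_trans (_ : ln (2 * (\prod_(i < r) evz (L i) x * \prod_(i < r) (1 + expR (- 2 * ell x - del x i)))) <= _).
      by rewrite ler_ln ?posrE ?mulr_gt0 ?mulr_gt0.
    by rewrite !lnM ?posrE ?mulr_gt0 // lerD2r ln2_le1.
  by have := sev x xl; rewrite /mu; clear - h2; lra.
- move=> x x' xl xl' xx i; have x0 := nz _ (cl _ xl); have x0' := nz _ (cl _ xl').
  rewrite !expRD !eell // !edel //.
  have := detz_hgt_le (L i) x x'; have d1 : 1 <= `|detz x x'|%:~R :> R by rewrite ler1z -gtz0_ge1 normr_gt0 pl.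
  have := X0 _ x0; have := X0 _ x0'; have := h0 i; move: (hgt _) (maxz x)%:~R (maxz x')%:~R => h X X' hp Xp Xp' hd1.
  rewrite [leRHS](_ : _ = (evz (L i) x * X' + evz (L i) x' * X) / h); last first.
    by field; rewrite !gt_eqF.
  rewrite ler_pdivlMr // mul1r; apply: le_trans hd1.
  by rewrite ler_peMl // ltW.
- by move=> x i j; apply: hS; apply: nz; apply: cl.
- move=> x x' xl xl' j hx hx' l1 l1' hl; have x0 := nz _ (cl _ xl); have x0' := nz _ (cl _ xl').
  have hc z : z != (0, 0) -> del z j <= - (9 / 10 * (r%:R * ell z)) ->
      evz (L j) z <= expR (- (9 / 10 * (r%:R * ell z))) * (hgt (L j) * (maxz z)%:~R).
    by move=> z0 hz; rewrite -ler_pdivrMr ?mulr_gt0 ?X0 // -edel // ler_expR.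
  apply: (close_solutions_gap (mu := mu) (j := j) _ hf a00 ial hnz hd) => //.
  + by apply: leq_trans r1000.
  + rewrite /mu expRD lnK // expR_sum; congr (_ * _); apply: eq_bigr => i _; by rewrite lnK ?posrE ?h0.
  + exact: (hc _ x0 hx).
  + exact: (hc _ x0' hx').
  + by move: hl; rewrite -addrA subrK.
Qed.

Definition comb (b c x : int * int) : int * int :=
  (b.1 * x.1 + c.1 * x.2, b.2 * x.1 + c.2 * x.2).

Definition coords (b c u : int * int) : int * int := (u.1 * c.2 - u.2 * c.1, b.1 * u.2 - b.2 * u.1).

Lemma coordsK b c : detz b c = 1 -> cancel (coords b c) (comb b c).
Proof.
case: b c => b1 b2 [c1 c2]; rewrite /detz /= => d [u1 u2]; rewrite /comb /coords /=; congr (_, _).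
  rewrite -[RHS]mul1r -d; ring.
rewrite -[RHS]mul1r -d; ring.
Qed.

Lemma detz_comb b c x y : detz (comb b c x) (comb b c y) = detz b c * detz x y.
Proof. by rewrite /detz /comb /=; ring. Qed.

Lemma form_at_comb r f e g b c x :
  form_at r f (comb e g b) (comb e g c) x = form_at r f e g (comb b c x).
Proof. by rewrite /form_at /comb /=; congr (hom _ _ _ _); ring. Qed.

Lemma coprime_coords b c u : detz b c = 1 -> coprimez u.1 u.2 ->
  coprimez (coords b c u).1 (coords b c u).2.
Proof.
move=> d /coprimezP[[p q] h]; apply/coprimezP.
have := coordsK d u; case: (coords b c u) => x y; rewrite /comb => hu.
exists (p * b.1 + q * b.2, p * c.1 + q * c.2); rewrite -{}h -hu /=; ring.
Qed.

(** A nearly minimal basis is chosen inside the sublattice; the unimodular change of coordinates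
    preserves index, values and primitivity. *)
Lemma sublattice_count (R : realType) r s (f : {poly int}) (a0 : int) (al : 'I_r -> R[i])
    e g (l : seq (int * int)) (H Lam w : R) :
  sparse_form s f a0 al w -> detz e g != 0 -> 1 <= H -> ln H <= Lam -> 1 <= Lam ->
  r%:R * (r%:R - 1) * (100 + 2 * ln H) <= r%:R * (r%:R - 1) * ln `|detz e g|%:~R +
    log_disc a0 al ->
  uniq l -> {in l, forall x, coprimez x.1 x.2} ->
  {in l, forall x, `|form_at r f e g x|%:~R <= H ^+ r} ->
  {in l &, forall x x', x != x' -> detz x x' != 0} ->
  (size l)%:R <= prim_bound r s w Lam.
Proof.
move=> spf hd H1 HL L1 hK ul cl bl pl; have [[r1000 s1] [hw w2] [hf a00 ial] hnz nf] := spf.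
have r2 : (2 <= r)%N by apply: leq_trans r1000.
have [i j ij|b [c [dbc hbc]]] := @reduced_basis R r (fun i => root_line (al i) e g) r2.
  rewrite crs_root_line mulr_gt0 ?ltr0z ?normr_gt0 // normc_gt0 subr_eq0.
  by apply: contra ij => /eqP /ial ->.
have rlE i : root_line (al i) (comb e g b) (comb e g c) = lcomp (root_line (al i) e g) b c.
  by rewrite /root_line lcomp_comp.
rewrite -(size_map (coords b c) l).
have dE : detz (comb e g b) (comb e g c) = detz e g by rewrite detz_comb dbc mulr1.
apply: (@reduced_count R r s f a0 al (comb e g b) (comb e g c) _ H Lam w) => //.
- by rewrite dE.
- move=> x y dxy; rewrite (eq_bigr (fun i => hgt (lcomp (root_line (al i) e g) b c))) => [|i _]; last by rewrite rlE.
  rewrite [in leRHS](eq_bigr (fun i => hgt (lcomp (root_line (al i) e g) (comb b c x) (comb b c y)))).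
    by apply: hbc; rewrite detz_comb dbc dxy.
  by move=> i _; rewrite rlE lcomp_comp.
- by rewrite dE.
- by rewrite map_inj_uniq //; exact: can_inj (coordsK dbc).
- by move=> _ /mapP[u ul' ->]; apply: coprime_coords => //; exact: cl.
- by move=> _ /mapP[u ul' ->]; rewrite form_at_comb coordsK //; exact: bl.
- move=> _ _ /mapP[u ul' ->] /mapP[v vl ->] uv.
  have <- : detz u v = detz (coords b c u) (coords b c v).
    by rewrite -{1}(coordsK dbc u) -{1}(coordsK dbc v) detz_comb dbc mul1r.
  by apply: pl => //; apply: contra uv => /eqP ->.
Qed.

(** * Sublattices *)

Lemma primitive_colinear x y : coprimez x.1 x.2 -> coprimez y.1 y.2 -> detz x y = 0 ->
  y = x \/ y = (- x.1, - x.2).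
Proof.
case: x y => x1 x2 [y1 y2]; rewrite /detz /= => /coprimezP[[p q] /= h] /coprimezP[[p' q'] /= h'].
move/eqP; rewrite subr_eq0 => /eqP d.
pose t := p * y1 + q * y2.
have e1 : y1 = t * x1.
  by rewrite -[LHS]mul1r -h /t !mulrDl -!mulrA [y2 * x1]mulrC d; ring.
have e2 : y2 = t * x2.
  by rewrite -[LHS]mul1r -h /t !mulrDl -!mulrA [y1 * x2]mulrC -d; ring.
have : (p' * x1 + q' * x2) * t = 1 by rewrite -h' e1 e2; ring.
move=> /(congr1 absz); rewrite abszM => /eqP; rewrite muln_eq1 => /andP[_].
rewrite -eqz_nat abszE eqr_norml => /andP[/orP[] /eqP et _].
  by left; rewrite e1 e2 et !mul1r.
by right; rewrite e1 e2 et !mulN1r.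
Qed.

Lemma exists_residue (m : nat) (x y : int) : (0 < m)%N -> coprimez x m ->
  exists c : 'I_m, (m%:Z %| y - c%:Z * x)%Z.
Proof.
move=> m0 /coprimezP[[u v] /= h].
have mz : (m%:Z : int) != 0 by rewrite eqz_nat -lt0n.
have c0 : 0 <= (y * u %% m)%Z by exact: modz_ge0.
have cm : (`|(y * u %% m)%Z| < m)%N by rewrite -ltz_nat gez0_abs // ltz_pmod // ltz_nat.
exists (Ordinal cm); rewrite /= gez0_abs //.
apply/dvdzP; exists (y * v + (y * u %/ m)%Z * x).
have := divz_eq (y * u) m; set q := (_ %/ _)%Z; set c := (_ %% _)%Z => e.
have -> : c = y * u - q * m by rewrite e; ring.
rewrite -[X in X - _]mulr1 -h; ring.
Qed.

Lemma coprime_pow2 (x : int * int) k : coprimez x.1 x.2 ->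
  coprimez x.1 (2 ^ k)%N \/ coprimez x.2 (2 ^ k)%N.
Proof.
move=> cx; have [x1even|x1even] := boolP (2 %| `|x.1|)%N; last first.
  by left; rewrite coprimezE coprime_sym coprimeXl // prime_coprime.
right; rewrite coprimezE coprime_sym coprimeXl // prime_coprime //.
apply: contraL cx => x2even; rewrite coprimezE /coprime; apply/eqP => g1.
have : (2 %| gcdn `|x.1| `|x.2|)%N by rewrite dvdn_gcd x1even.
by rewrite g1.
Qed.

Lemma power_of_two_approx (R : realType) (X : R) : 1 < X ->
  exists k, X <= (2 ^ k)%:R < 2 * X.
Proof.
move=> X1; have hex : exists k, X <= (2 ^ k)%N%:R.
  have X0 : 0 <= X by lra.
  exists (Num.bound X); apply: ltW; apply: lt_trans (archi_boundP X0) _.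
  by rewrite ltr_nat ltn_expl.
case: (ex_minnP hex) => -[|k] hk hmin; first by move: hk; rewrite expn0; lra.
exists k.+1; rewrite hk /= expnS natrM ltr_pM2l // ltNge.
by apply/negP => /hmin; rewrite ltnn.
Qed.

Lemma lattice_count (R : realType) r s (f : {poly int}) (a0 : int) (al : 'I_r -> R[i])
    e g (psi : int * int -> int * int) (l : seq (int * int)) (H Lam w : R) :
  sparse_form s f a0 al w -> detz e g != 0 -> 1 <= H -> ln H <= Lam -> 1 <= Lam ->
  r%:R * (r%:R - 1) * (100 + 2 * ln H) <= r%:R * (r%:R - 1) * ln `|detz e g|%:~R +
    log_disc a0 al ->
  uniq l -> {in l, forall x, coprimez x.1 x.2} ->
  {in l, forall x, `|hom r f x.1 x.2|%:~R <= H ^+ r} ->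
  {in l &, forall x x', x != x' -> detz x x' != 0} ->
  {in l, forall x, comb e g (psi x) = x} ->
  (size l)%:R <= prim_bound r s w Lam.
Proof.
move=> spf hd H1 HL L1 hK ul cl bl pl hpsi.
rewrite -(size_map psi l).
apply: (@sublattice_count R r s f a0 al e g _ H Lam w) => //.
- rewrite map_inj_in_uniq // => x y xl yl hxy.
  by rewrite -(hpsi x xl) -(hpsi y yl) hxy.
- move=> _ /mapP[x xl ->]; have /coprimezP[[p q] /= h] := cl x xl; apply/coprimezP.
  move: (hpsi x xl) h; case: (psi x) => u v <- /= h.
  by exists (p * e.1 + q * e.2, p * g.1 + q * g.2); rewrite /= -h; ring.
- by move=> _ /mapP[x xl ->]; rewrite /form_at; have := bl x xl; rewrite -{1 2}(hpsi x xl).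
- move=> _ _ /mapP[x xl ->] /mapP[y yl ->] xy.
  have := pl x y xl yl; rewrite -{2}(hpsi x xl) -{2}(hpsi y yl) detz_comb mulf_eq0 negb_or.
  by case/(_ _)/andP => //; apply: contra xy => /eqP ->.
Qed.

Lemma count_bound_ge0 (R : realType) (r s : nat) (w Lam : R) :
  (1000 <= r)%N -> 15 * 15 <= w -> 1 <= Lam ->
  0 <= prim_bound r s w Lam.
Proof.
move=> r1 hw L1.
have r2 : 1 <= r%:R - 1 :> R.
  have : 2 <= r%:R :> R by rewrite (ler_nat _ 2); apply: leq_trans r1.
  by clear; lra.
have q0 : 0 <= s%:R * (ln Lam / ln (r%:R - 1)).
  by apply: mulr_ge0 => //; apply: divr_ge0; exact: ln_ge0.
have s0 : 0 <= s%:R :> R by exact: ler0n.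
by rewrite /prim_bound; clear - hw q0 s0; lra.
Qed.

(* One coordinate of a primitive point is invertible modulo a power of two m, so
   that 2 m sublattices of index m cover the primitive points. *)
Lemma primitive_count (R : realType) r s (f : {poly int}) (a0 : int) (al : 'I_r -> R[i])
    (l : seq (int * int)) (H Lam w X : R) :
  sparse_form s f a0 al w -> 1 <= H -> ln H <= Lam -> 1 <= Lam -> 0 < X ->
  r%:R * (r%:R - 1) * (100 + 2 * ln H) <= r%:R * (r%:R - 1) * ln X +
    log_disc a0 al ->
  uniq l -> {in l, forall x, coprimez x.1 x.2} ->
  {in l, forall x, `|hom r f x.1 x.2|%:~R <= H ^+ r} ->
  {in l &, forall x x', x != x' -> detz x x' != 0} ->
  (size l)%:R <= (1 + 4 * X) * prim_bound r s w Lam.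
Proof.
move=> spf H1 HL L1 X0 hK ul cl bl pl.
have [[r1000 s1] [hw w2] [hf a00 ial] hnz nf] := spf; set B := prim_bound _ _ _ _.
have B0 : 0 <= B by exact: count_bound_ge0.
have r1 : 0 <= r%:R * (r%:R - 1) :> R.
  by rewrite mulr_ge0 // subr_ge0 ler1n; apply: leq_trans r1000.
have mono Y : X <= Y -> r%:R * (r%:R - 1) * (100 + 2 * ln H) <= r%:R * (r%:R - 1) * ln Y +
    log_disc a0 al.
  move=> XY; apply: le_trans hK _; rewrite lerD2r; apply: ler_wpM2l => //.
  by rewrite ler_ln ?posrE // (lt_le_trans X0).
(* For X <= 1 the full lattice already qualifies, which explains the 1 in the bound; otherwise m < 2
   X and the 2 m sublattices give 4 X. *)
have [X1|X1] := lerP X 1.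
  apply: le_trans (_ : B <= _); last by rewrite ler_peMl // lerDl mulr_ge0 // ltW.
  apply: (@lattice_count R r s f a0 al (1, 0) (0, 1) id l H Lam w) => //.
    by rewrite /detz /= mulr1 mul0r subr0 normr1; exact: mono.
  by move=> [x1 x2] _; rewrite /comb /= !mul1r !mul0r addr0 add0r.
have [k /andP[k1 k2]] := power_of_two_approx X1.
set m := (2 ^ k)%N in k1 k2.
have m0 : (0 < m)%N by rewrite expn_gt0.
pose P (x : int * int) (bc : bool * 'I_m) :=
  if bc.1 then (m%:Z %| x.2 - bc.2%:Z * x.1)%Z else (m%:Z %| x.1 - bc.2%:Z * x.2)%Z.
apply: le_trans (_ : #|[set: bool * 'I_m]%SET|%:R * B <= _); last first.
  apply: ler_wpM2r => //; rewrite cardsT card_prod card_bool card_ord natrM.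
  by clear - k2; lra.
apply: (@size_le_cover_const _ _ _ _ P).
  move=> x xl; case: (coprime_pow2 k (cl x xl)) => h.
    by have [c hc] := exists_residue x.2 m0 h; exists (true, c).
  by have [c hc] := exists_residue x.1 m0 h; exists (false, c).
move=> [b c] _; pose l' := [seq x <- l | P x (b, c)]; rewrite -/l'.
have l'l x : x \in l' -> x \in l by rewrite mem_filter => /andP[].
have mz : (m%:Z : int) != 0 by rewrite eqz_nat -lt0n.
have hm : X <= `|m%:Z|%:~R by rewrite -[X in X%:~R]abszE.
pose e : int * int := if b then (1, c%:Z) else (c%:Z, 1).
pose g : int * int := if b then (0, m%:Z) else (m%:Z, 0).
pose psi (x : int * int) := if b then (x.1, ((x.2 - c%:Z * x.1) %/ m)%Z)
                                 else (x.2, ((x.1 - c%:Z * x.2) %/ m)%Z).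
have dE : `|detz e g| = `|m%:Z|.
  by rewrite /detz /e /g; case: b {l' l'l e g psi}; rewrite /= ?mul1r ?mulr0 ?mul0r ?subr0 ?sub0r ?normrN.
apply: (@lattice_count R r s f a0 al e g psi l' H Lam w) => //.
- by rewrite -normr_gt0 dE normr_gt0.
- by rewrite dE; exact: mono.
- by rewrite filter_uniq.
- by move=> x /l'l; exact: cl.
- by move=> x /l'l; exact: bl.
- by move=> x y /l'l xl /l'l; exact: pl.
move=> [x1 x2]; rewrite mem_filter => /andP[h _]; move: h; rewrite /P /e /g /psi /comb /=.
case: b {l' l'l e g psi dE} => /= /divzK h; rewrite mul1r mul0r addr0.
  by rewrite [m%:Z * _]mulrC h addrC subrK.
by rewrite [m%:Z * _]mulrC h addrC subrK.
Qed.

(** Selects one point of each opposite pair: two distinct primitive points in the same class are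
    never collinear. *)
Definition zpos (x : int * int) : bool := (0 < x.1) || ((x.1 == 0) && (0 < x.2)).

Lemma zposN x : x != (0, 0) -> zpos (- x.1, - x.2) = ~~ zpos x.
Proof.
case: x => u v; rewrite xpair_eqE /zpos /= oppr_eq0 !oppr_gt0.
by case: (ltrgtP u 0); case: (ltrgtP v 0).
Qed.

Definition zscale (d : nat) (x : int * int) : int * int := (d%:Z * x.1, d%:Z * x.2).

Lemma eq_gcdn0 m n : (gcdn m n == 0)%N = (m == 0)%N && (n == 0)%N.
Proof. by rewrite eqn0Ngt gcdn_gt0 negb_or -!eqn0Ngt. Qed.

Lemma zscaleP x : exists2 y, coprimez y.1 y.2 \/ x = (0, 0) &
  x = zscale (gcdn `|x.1| `|x.2|) y.
Proof.
case: x => u v; set d := gcdn _ _ => /=.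
have [d0|d0] := posnP d.
  exists (0, 0); rewrite /zscale ?mulr0; last first.
    by move/eqP: d0; rewrite /d /= eq_gcdn0 !absz_eq0 => /andP[/eqP-> /eqP->].
  by right; move/eqP: d0; rewrite /d /= eq_gcdn0 !absz_eq0 => /andP[/eqP-> /eqP->].
have du : (d%:Z %| u)%Z by rewrite dvdzE; exact: dvdn_gcdl.
have dv : (d%:Z %| v)%Z by rewrite dvdzE; exact: dvdn_gcdr.
have [u' eu] := dvdzP du; have [v' ev] := dvdzP dv.
exists (u', v'); last by rewrite /zscale /= ![d%:Z * _]mulrC -eu -ev.
left; rewrite /= coprimezE /coprime -(eqn_pmul2r d0) mul1n muln_gcdl.
have -> : (`|u'| * d)%N = `|u|%N by rewrite eu abszM.
by have -> : (`|v'| * d)%N = `|v|%N by rewrite ev abszM.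
Qed.

(** The induction carries the sharper bound 2 - 1/n. *)
Lemma sum_inv_squares (R : realFieldType) n : \sum_(d < n) (d.+1%:R ^+ 2)^-1 <= 2 :> R.
Proof.
case: n => [|n]; first by rewrite big_ord0.
apply: le_trans (_ : 2 - n.+1%:R^-1 <= _); last by rewrite gerBl invr_ge0.
elim: n => [|n IH]; first by rewrite big_ord_recr big_ord0 /= add0r expr1n invr1; lra.
rewrite big_ord_recr /=.
have n0 : 0 < n.+1%:R :> R by rewrite ltr0n.
have -> : n.+2%:R = n.+1%:R + 1 :> R by rewrite natr1.
move: n0 IH; move: (n.+1%:R) => t t0 IH.
suff : ((t + 1) ^+ 2)^-1 <= t^-1 - (t + 1)^-1 by lra.
have -> : t^-1 - (t + 1)^-1 = (t * (t + 1))^-1 by field; rewrite !gt_eqF ?addr_gt0.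
by rewrite lef_pV2 ?posrE ?exprn_gt0 ?mulr_gt0 ?addr_gt0 // expr2 ler_pM2r ?addr_gt0 // lerDl.
Qed.

Lemma ln_scaled_modulus (R : realType) (c H D d : R) : 0 < H -> 0 < D -> 0 < d ->
  ln (expR c * H ^+ 2 / D / d ^+ 2) = c + 2 * ln (H / d) - ln D.
Proof.
move=> H0 D0 d0; have H2 : 0 < H ^+ 2 by rewrite exprn_gt0.
have d2 : 0 < d ^+ 2 by rewrite exprn_gt0.
have e0 : 0 < expR c * H ^+ 2 by rewrite mulr_gt0 ?expR_gt0.
have e1 : 0 < expR c * H ^+ 2 / D by rewrite divr_gt0.
rewrite !ln_div ?posrE // lnM ?posrE ?expR_gt0 // !lnXn // expRK; ring.
Qed.

(** [D] is |D(F)|^(1/(r(r-1))). For gcd d the parameter H drops to H/d and the required index to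
    X/d^2, so the sum over d <= H is at most H + 8 X, doubled for the two signs. *)
Lemma solution_count (R : realType) r s (f : {poly int}) (a0 : int) (al : 'I_r -> R[i])
    (l : seq (int * int)) (h : nat) (H Lam w D : R) :
  sparse_form s f a0 al w -> 1 <= H -> H ^+ r = h%:R -> ln H <= Lam -> 1 <= Lam -> 0 < D ->
  r%:R * (r%:R - 1) * ln D =
    log_disc a0 al ->
  uniq l -> {in l, forall x, x != (0, 0) /\ `|hom r f x.1 x.2| <= h%:Z} ->
  (size l)%:R <= 2 * (H + 8 * (expR 100 * H ^+ 2 / D)) *
    prim_bound r s w Lam.
Proof.
move=> spf H1 Hh HL L1 D0 hD ul hl; have [[r1000 s1] [hw w2] [hf a00 ial] hnz nf] := spf.
set B := prim_bound _ _ _ _; set X := expR 100 * _ / _.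
have B0 : 0 <= B by exact: count_bound_ge0.
have Hp : 0 < H by apply: lt_le_trans H1.
have X0 : 0 < X by rewrite divr_gt0 ?mulr_gt0 ?expR_gt0 ?exprn_gt0.
pose gc (x : int * int) := gcdn `|x.1| `|x.2|.
pose N := Num.truncn H.
have /andP[N1 N2] := truncn_itv (ltW Hp).
pose pr (x : int * int) := ((x.1 %/ gc x)%Z, (x.2 %/ gc x)%Z).
have prP x : x \in l -> [/\ (0 < gc x)%N, coprimez (pr x).1 (pr x).2 & x = zscale (gc x) (pr x)].
  move=> xl; have [x0 _] := hl x xl.
  have g0 : (0 < gc x)%N.
    rewrite lt0n eq_gcdn0 !absz_eq0; apply: contra x0 => /andP[/eqP a /eqP b].
    by rewrite [x]surjective_pairing a b.
  have gz : (gc x)%:Z != 0 by rewrite eqz_nat -lt0n.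
  have [y [cy|/eqP]] := zscaleP x; last by rewrite (negbTE x0).
  rewrite -/(gc x) => e.
  suff -> : pr x = y by [].
  rewrite /pr; move: gz e; move: (gc x) => d dz ->.
  by rewrite /zscale /= !mulKz // -surjective_pairing.
have homE x : x \in l -> `|hom r f x.1 x.2| = (gc x)%:Z ^+ r * `|hom r f (pr x).1 (pr x).2|.
  move=> xl; have [_ _ e] := prP x xl.
  by rewrite {1 2}e /zscale /= hom_scale normrM normrX.
(* The value at the primitive point is a non-zero integer, so the r-th power of the gcd is at most
   H^r. *)
have gcH x : x \in l -> (gc x <= N)%N /\ `|hom r f (pr x).1 (pr x).2|%:~R <= (H / (gc x)%:R) ^+ r.
  move=> xl; have [_ hx] := hl x xl; have [g0 cx _] := prP x xl.
  have gR : 0 < (gc x)%:R :> R by rewrite ltr0n.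
  have hx' : (gc x)%:R ^+ r * `|hom r f (pr x).1 (pr x).2|%:~R <= H ^+ r :> R.
    have : `|hom r f x.1 x.2|%:~R <= h%:Z%:~R :> R by rewrite ler_int.
    by rewrite homE // rmorphM rmorphXn /= Hh.
  have p0 : pr x != (0, 0).
    by apply: contraTneq cx => ->.
  have h1 : 1 <= `|hom r f (pr x).1 (pr x).2|%:~R :> R.
    by rewrite ler1z -gtz0_ge1 normr_gt0 hnz // -surjective_pairing.
  split; last by rewrite expr_div_n ler_pdivlMr ?exprn_gt0 // mulrC.
  rewrite -ltnS -(ltr_nat R); apply: le_lt_trans N2.
  have r0 : (0 < r)%N by apply: leq_trans r1000.
  rewrite -(ler_pXn2r r0) ?nnegrE ?(ltW Hp) ?(ltW gR) //; apply: le_trans hx'.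
  by rewrite ler_peMr // ltW // exprn_gt0.
have fixed (d : nat) (b : bool) (l' : seq (int * int)) : (0 < d)%N -> uniq l' -> {subset l' <= l} ->
    {in l', forall x, gc x = d /\ zpos (pr x) = b} -> (size l')%:R <= (1 + 4 * (X / d%:R ^+ 2)) * B.
  move=> d0 ul' sub gl'; have dR : 0 < d%:R :> R by rewrite ltr0n.
  rewrite -(size_map pr l').
  case: l' ul' sub gl' => [|y l'] ul' sub gl'.
    by rewrite /= mulr_ge0 // addr_ge0 // mulr_ge0 // divr_ge0 ?exprn_ge0 ?ltW.
  have dH : d%:R <= H.
    have yl : y \in y :: l' by rewrite mem_head.
    have [<- _] := gl' y yl; have [h1 _] := gcH y (sub y yl).
    by apply: le_trans N1; rewrite ler_nat.
  have Hd1 : 1 <= H / d%:R by rewrite ler_pdivlMr // mul1r.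
  apply: (@primitive_count R r s f a0 al _ (H / d%:R) Lam w) => //.
  - apply: le_trans HL; rewrite ler_ln ?posrE ?divr_gt0 // ler_pdivrMr //.
    by rewrite ler_peMr ?(ltW Hp) ?ler1n.
  - by rewrite divr_gt0 ?exprn_gt0.
  (* The index X/d^2 is chosen to make this an equality. *)
  - rewrite -hD -mulrDr; apply: ler_wpM2l.
      by rewrite mulr_ge0 // subr_ge0 ler1n; apply: leq_trans r1000.
    by rewrite ln_scaled_modulus // subrK.
  - rewrite map_inj_in_uniq // => x z xl zl e; have [_ _ ->] := prP x (sub x xl).
    have [gx _] := gl' x xl; have [gz _] := gl' z zl.
    by rewrite e gx -gz; have [_ _ <-] := prP z (sub z zl).
  - by move=> _ /mapP[x xl ->]; have [] := prP x (sub x xl).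
  - move=> _ /mapP[x xl ->]; have [_ ] := gcH x (sub x xl).
    by have [-> _] := gl' x xl.
  - move=> _ _ /mapP[x xl ->] /mapP[z zl ->]; apply: contra => /eqP e.
    have [_ cx _] := prP x (sub x xl); have [_ cz _] := prP z (sub z zl).
    have [_ px] := gl' x xl; have [_ pz] := gl' z zl.
    have [->//|ez] := primitive_colinear cx cz e.
    have p0 : pr x != (0, 0) by apply: contraTneq cx => ->.
    by move: pz; rewrite ez zposN // px; case: (b).
apply: le_trans (_ : \sum_(j in [set: 'I_N]%SET) (size [seq x <- l | gc x == j.+1])%:R <= _).
  rewrite -natr_sum ler_nat; apply: (@size_le_cover _ _ _ (fun x (j : 'I_N) => gc x == j.+1)).
  move=> x xl; have [g0 _ _] := prP x xl; have [gN _] := gcH x xl.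
  have gN' : ((gc x).-1 < N)%N by rewrite prednK.
  by exists (Ordinal gN'); rewrite ?finset.in_setT //= prednK.
apply: le_trans (_ : \sum_(j < N) (2 * (1 + 4 * (X / j.+1%:R ^+ 2)) * B) <= _).
  rewrite (eq_bigl xpredT); last by move=> j; rewrite finset.in_setT.
  apply: ler_sum => j _; rewrite (size_split (fun x => zpos (pr x))) natrD.
  set lj := [seq x <- l | gc x == j.+1].
  have half (b : bool) (p : pred (int * int)) : (forall x, p x -> zpos (pr x) = b) ->
      (size [seq x <- lj | p x])%:R <= (1 + 4 * (X / j.+1%:R ^+ 2)) * B.
    move=> hp; apply: (fixed j.+1 b) => //; first by rewrite !filter_uniq.
      by move=> x; rewrite !mem_filter => /andP[_ /andP[]].
    by move=> x; rewrite !mem_filter => /andP[/hp ? /andP[/eqP ? _]].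
  rewrite -mulrA mulr_natl mulr2n; apply: lerD.
    exact: (half true (fun x => zpos (pr x)) (fun x => id)).
  exact: (half false (fun x => ~~ zpos (pr x)) (fun x => @negbTE _)).
rewrite -mulr_suml; apply: ler_wpM2r => //.
rewrite -mulr_sumr ler_pM2l // big_split /= sumr_const card_ord -mulr_sumr -mulr_sumr.
have := ler_wpM2l (ltW X0) (sum_inv_squares R N).
by move: N1; rewrite -/N; clear; lra.
Qed.

(** * Forms as multivariate polynomials *)

Definition binmon (r j : nat) : 'X_{1..2} :=
  (U_(ord0 : 'I_2) *+ j + U_(ord_max : 'I_2) *+ (r - j))%MM.

Definition dehom (S : comNzRingType) (r : nat) (F : {mpoly S[2]}) : {poly S} :=
  \poly_(j < r.+1) F@_(binmon r j).

Lemma binmon0 r j : binmon r j ord0 = j.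
Proof. by rewrite mnmDE !mulmnE !mnm1E /= mul1n mul0n addn0. Qed.

Lemma binmon_max r j : binmon r j ord_max = (r - j)%N.
Proof. by rewrite mnmDE !mulmnE !mnm1E /= mul1n mul0n. Qed.

Lemma ord2P (i : 'I_2) : i = ord0 \/ i = ord_max.
Proof. by case: i => -[|[|i]] //= h; [left|right]; apply: val_inj. Qed.

Lemma mdeg2 (m : 'X_{1..2}) : mdeg m = (m ord0 + m ord_max)%N.
Proof.
rewrite mdegE big_ord_recl big_ord1; congr (_ + m _)%N; exact: val_inj.
Qed.

Lemma binmon_inj r j k : binmon r j = binmon r k -> j = k.
Proof. by move/(congr1 (fun m : 'X_{1..2} => m ord0)); rewrite !binmon0. Qed.

Lemma mdeg_eq_binmon r (m : 'X_{1..2}) : mdeg m = r -> m = binmon r (m ord0).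
Proof.
rewrite mdeg2 => h; apply/mnmP => i; case: (ord2P i) => ->; rewrite ?binmon0 ?binmon_max //.
by rewrite -h addKn.
Qed.

Lemma coef_dehom (S : comNzRingType) r (F : {mpoly S[2]}) j : (j <= r)%N ->
  (dehom r F)`_j = F@_(binmon r j).
Proof. by move=> jr; rewrite coef_poly ltnS jr. Qed.

Lemma binary_form_decomp (S : comNzRingType) r (F : {mpoly S[2]}) : F \is r.-homog ->
  F = \sum_(j < r.+1) F@_(binmon r j) *: 'X_[binmon r j].
Proof.
move=> hF; apply/mpolyP => m; rewrite raddf_sum /=.
have [hm|hm] := eqVneq (mdeg m) r; last first.
  rewrite (dhomog_nemf_coeff hF) // big1 // => j _.
  rewrite mcoeffZ mcoeffX; case: eqP => [e|_]; rewrite ?mulr0 //.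
  by move: hm; rewrite -e mdeg2 binmon0 binmon_max subnKC ?eqxx // -ltnS.
have m0 : (m ord0 < r.+1)%N by rewrite ltnS -hm mdeg2 leq_addr.
rewrite (bigD1 (Ordinal m0)) //= big1 ?addr0 => [|j jm].
  by rewrite -(mdeg_eq_binmon hm) mcoeffZ mcoeffX eqxx mulr1.
rewrite mcoeffZ mcoeffX; case: eqP => [e|_]; rewrite ?mulr0 //.
by case/eqP: jm; apply: val_inj; rewrite /= -e binmon0.
Qed.

Lemma mmap_binary_form (S T : comNzRingType) (h : {rmorphism S -> T}) r (F : {mpoly S[2]})
    (v : 'I_2 -> T) :
  F \is r.-homog -> mmap h v F = hom r (map_poly h (dehom r F)) (v ord0) (v ord_max).
Proof.
move=> hF; rewrite {1}(binary_form_decomp hF) raddf_sum /=.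
apply: eq_bigr => j _; rewrite mmapZ mmapX /mmap1 big_ord_recl big_ord1 coef_map /=.
rewrite coef_dehom -1?ltnS // -mulrA; congr (_ * (_ * _)); first by rewrite binmon0.
have -> : lift ord0 ord0 = ord_max :> 'I_2 by apply: val_inj.
by rewrite binmon_max.
Qed.

Lemma meval_binary_form (S : comNzRingType) r (F : {mpoly S[2]}) x y :
  F \is r.-homog -> F.@[xy_val x y] = hom r (dehom r F) x y.
Proof.
move=> hF; rewrite /meval (mmap_binary_form idfun _ hF).
by rewrite map_poly_id.
Qed.

Lemma hom_X1 (S : comNzRingType) r (p : {poly S}) : (size p <= r.+1)%N ->
  hom r (map_poly polyC p) 'X 1 = p.
Proof.
move=> sp; rewrite hom1r; last by apply: leq_trans (size_poly _ _) sp.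
exact: comp_polyXr.
Qed.

Lemma form_x1E (R : realType) r (F : {mpoly int[2]}) : F \is r.-homog ->
  form_x1 R F = map_poly intr (dehom r F).
Proof.
move=> hF; rewrite /form_x1 (mmap_binary_form intr _ hF).
rewrite -[RHS](@hom_X1 _ r); last by apply: leq_trans (size_poly _ _) (size_poly _ _).
rewrite -map_poly_comp; congr (hom r _ _ _); apply: eq_map_poly => z /=.
by rewrite rmorph_int.
Qed.

Lemma nterms_dehom r (F : {mpoly int[2]}) : (nterms r.+1 (dehom r F) <= nb_coeffs F)%N.
Proof.
have e : nterms r.+1 (dehom r F) = size [seq binmon r (i : 'I_r.+1) | i <- enum [pred i : 'I_r.+1 | F@_(binmon r i) != 0]].
  rewrite size_map -cardE /nterms -sum1_card [RHS]big_mkcond; apply: eq_bigr => i _.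
  by rewrite coef_dehom -1?ltnS // inE; case: eqP.
rewrite e; apply: uniq_leq_size.
  by rewrite map_inj_uniq ?enum_uniq // => i j /binmon_inj /val_inj.
by move=> _ /mapP[i hi ->]; move: hi; rewrite mem_enum inE mcoeff_msupp.
Qed.

Definition homogenize (K : fieldType) (d : nat) (p : {poly K}) : {mpoly K[2]} :=
  hom d (map_poly (@mpolyC 2 K) p) 'X_ord0 'X_ord_max.

Lemma homogenizeM (K : fieldType) d e (p q : {poly K}) : (size p <= d.+1)%N -> (size q <= e.+1)%N ->
  homogenize (d + e) (p * q) = homogenize d p * homogenize e q.
Proof.
move=> sp sq; rewrite /homogenize rmorphM homM //.
  by apply: leq_trans (size_poly _ _) sp.
by apply: leq_trans (size_poly _ _) sq.
Qed.

Lemma mmap_homogenize (K : fieldType) d (p : {poly K}) (x y : {poly K}) :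
  mmap polyC (xy_val x y) (homogenize d p) = hom d (map_poly polyC p) x y.
Proof.
rewrite /homogenize hom_rmorph /= -map_poly_comp !mmapX !mmap1U; congr (hom d _ _ _).
by apply: eq_map_poly => c /=; rewrite mmapC.
Qed.

Lemma homogenizeK (K : fieldType) d (p : {poly K}) : (size p <= d.+1)%N ->
  mmap polyC (xy_val 'X 1) (homogenize d p) = p.
Proof. by move=> sp; rewrite mmap_homogenize hom_X1. Qed.

Lemma size_mmap_unit (K : fieldType) (u : {mpoly K[2]}) (v : 'I_2 -> {poly K}) :
  u \is a GRing.unit -> (size (mmap polyC v u) <= 1)%N.
Proof. by case/andP => /eqP -> _; rewrite mmapC size_polyC_leq1. Qed.

Lemma map_mpoly_homogenize r (F : {mpoly int[2]}) : F \is r.-homog ->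
  map_mpoly intr F = homogenize r (map_poly intr (dehom r F) : {poly rat}).
Proof.
move=> hF; rewrite /map_mpoly (mmap_binary_form (GRing.RMorphism.clone _ _ ((@mpolyC 2 rat) \o intr) _) _ hF).
by rewrite /homogenize -map_poly_comp.
Qed.

(** If a_0 were 0, then y would divide F, and the irreducible F would be a multiple of y, of degree
    1. *)
Lemma size_dehom r (F : {mpoly int[2]}) : (2 <= r)%N -> F \is r.-homog -> irreducible_form F ->
  size (dehom r F) = r.+1.
Proof.
move=> r2 hF Firr; pose fq : {poly rat} := map_poly intr (dehom r F).
have size_fq_leq : (size fq <= r.+1)%N by apply: leq_trans (size_poly _ _) (size_poly _ _).
rewrite -(size_map_inj_poly (@intr_inj rat)) // -/fq.
apply/eqP; rewrite eqn_leq size_fq_leq ltnNge; apply/negP => sf.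
have [F0 _ hab] := Firr.
have e1 : map_mpoly intr F = homogenize 1 (1 : {poly rat}) * homogenize r.-1 fq.
  have r0 : (0 < r)%N by apply: leq_trans r2.
  by rewrite (map_mpoly_homogenize hF) -/fq -homogenizeM ?size_poly1 ?prednK // mul1r add1n prednK.
have X1 : homogenize 1 (1 : {poly rat}) = 'X_ord_max.
  rewrite /homogenize rmorph1 /hom big_ord_recl big_ord1 /= !coef1 /= mul1r expr0 mul1r.
  by rewrite mul0r mul0r addr0 expr1.
case: (hab _ _ e1) => [u1|].
  have := size_mmap_unit (xy_val 1 'X) u1.
  by rewrite X1 mmapX mmap1U /xy_val /= size_polyX.
case/andP => /eqP eu _; move: e1; rewrite {}eu X1 mulrC mul_mpolyC => e1.
have h1 : (map_mpoly intr F : {mpoly rat[2]}) \is 1.-homog.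
  by rewrite e1; apply: dhomogZ; rewrite dhomogX /= mdeg1.
have hr : (map_mpoly intr F : {mpoly rat[2]}) \is r.-homog.
  apply/dhomogP => m; rewrite mcoeff_msupp mcoeff_map_mpoly /= intr_eq0 => h.
  by apply: (dhomog_mf hF); rewrite mcoeff_msupp.
by move: r2; rewrite (dhomog_uniq F0 hr h1).
Qed.

(** A factorisation of F(x, 1) homogenises to one of F, since F(x, 1) has full degree r. *)
Lemma dehom_irreducible r (F : {mpoly int[2]}) : (2 <= r)%N -> F \is r.-homog ->
  irreducible_form F -> irreducible_poly (map_poly intr (dehom r F) : {poly rat}).
Proof.
move=> r2 hF Firr; set fq : {poly rat} := map_poly intr (dehom r F).
have sf : size fq = r.+1 by rewrite size_map_inj_poly ?size_dehom //; apply: intr_inj.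
split; first by rewrite sf ltnS (leq_trans _ r2).
move=> q sq1 /dvdpP[p e].
have f0 : fq != 0 by rewrite -size_poly_gt0 sf.
have [p0 q0] : p != 0 /\ q != 0.
  by move: f0; rewrite e mulf_eq0 negb_or => /andP.
have sz : (size p + size q = r.+2)%N.
  have := size_mul p0 q0; rewrite -e sf => h.
  move: h p0 q0; rewrite -!size_poly_gt0; move: (size p) (size q) => a b; clear; lia.
have [_ _ hab] := Firr.
have pp : (0 < size p)%N by rewrite size_poly_gt0.
have qp : (0 < size q)%N by rewrite size_poly_gt0.
have e1 : map_mpoly intr F = homogenize (size p).-1 p * homogenize (size q).-1 q.
  rewrite (map_mpoly_homogenize hF) -/fq -homogenizeM ?prednK // e.
  by have -> : r = ((size p).-1 + (size q).-1)%N by lia.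
case: (hab _ _ e1) => /(size_mmap_unit (xy_val 'X 1)); rewrite homogenizeK ?prednK // => s1.
  rewrite /eqp e dvdp_mull //= .
  have /size_poly1P[c c0 ->] : size p == 1%N by rewrite eqn_leq s1.
  by rewrite mul_polyC dvdpZl // dvdpp.
by move: sq1; rewrite eqn_leq s1 qp.
Qed.

Lemma irreducible_separable (p : {poly rat}) : irreducible_poly p -> separable_poly p.
Proof.
move=> [p1 irr]; rewrite unlock; case: (boolP (coprimep p p^`())) => //.
rewrite coprimep_def => g1; exfalso.
have p0 : p != 0 by rewrite -size_poly_gt0 ltnW.
have e := irr _ g1 (dvdp_gcdl _ _).
have pd : p %| p^`() by rewrite -(eqp_dvdl _ e) dvdp_gcdr.
have d0 : p^`() != 0.
  apply/eqP => /(congr1 (fun q : {poly rat} => q`_(size p).-2)); rewrite coef0 coef_deriv.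
  rewrite prednK -?subn1 ?subn_gt0 // subn1 -lead_coefE => /eqP.
  by rewrite mulrn_eq0 lead_coef_eq0 (negbTE p0) orbF -subn1 subn_eq0 leqNgt p1.
by have := dvdp_leq d0 pd; rewrite leqNgt lt_size_deriv.
Qed.

(** An integral zero with v != 0 gives a rational root, hence a linear factor; for v = 0 the value
    is a_0 u^r. *)
Lemma dehom_no_zero r (F : {mpoly int[2]}) (u v : int) : (2 <= r)%N -> F \is r.-homog ->
  irreducible_form F -> (u, v) != (0, 0) -> hom r (dehom r F) u v != 0.
Proof.
move=> r2 hF Firr uv; have sf := size_dehom r2 hF Firr.
have [p1 irr] := dehom_irreducible r2 hF Firr; set fq := map_poly intr _ in p1 irr.
have sfq : size fq = r.+1 by rewrite size_map_inj_poly //; apply: intr_inj.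
apply: contraNneq uv => /(congr1 (intr : int -> rat)); rewrite rmorph0 hom_rmorph -/fq => h.
have [v0|v0] := eqVneq v 0.
  move: h; rewrite v0 rmorph0 /hom big_ord_recr /= subnn expr0 mulr1 big1 ?add0r; last first.
    by move=> i _; rewrite expr0n subn_eq0 leqNgt ltn_ord mulr0.
  move/eqP; rewrite mulf_eq0 expf_eq0 intr_eq0 => /orP[|/andP[_ /eqP->]]; last by rewrite eqxx.
  have -> : fq`_r = lead_coef fq by rewrite lead_coefE sfq.
  by rewrite lead_coef_eq0 -size_poly_eq0 sfq.
have vq : (v%:~R : rat) != 0 by rewrite intr_eq0.
move/eqP: h; rewrite hom_field ?sfq // mulf_eq0 expf_eq0 (negbTE vq) andbF /= => h.
have := irr ('X - (u%:~R / v%:~R)%:P); rewrite size_XsubC dvdp_XsubCl => /(_ isT h) /eqp_size.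
by rewrite size_XsubC sfq => -[e]; move: r2; rewrite -e.
Qed.

Lemma form_roots_spec (R : realType) r (F : {mpoly int[2]}) : (2 <= r)%N -> F \is r.-homog ->
  irreducible_form F ->
  [/\ injective (fun i : 'I_r => (form_roots R F)`_i), form_a0 r F != 0 &
    map_poly intr (dehom r F) =
      (form_a0 r F)%:~R *: \prod_(i < r) ('X - ((form_roots R F)`_i)%:P) :> {poly R[i]}].
Proof.
move=> r2 hF Firr; have sf := size_dehom r2 hF Firr.
have a0E : form_a0 r F = lead_coef (dehom r F).
  rewrite lead_coefE sf coef_dehom // /form_a0; congr mcoeff.
  by apply/mnmP => i; rewrite /binmon subnn mnmDE !mulmnE muln0 addn0.
have a00 : form_a0 r F != 0 by rewrite a0E lead_coef_eq0 -size_poly_eq0 sf.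
have lE : lead_coef (form_x1 R F) = (form_a0 r F)%:~R.
  by rewrite (form_x1E R hF) lead_coef_map_inj ?a0E //; apply: intr_inj.
have := svalP (closed_field_poly_normal (form_x1 R F)); rewrite -/(form_roots R F) lE => e.
have c0 : (form_a0 r F)%:~R != 0 :> R[i] by rewrite intr_eq0.
have szr : size (form_roots R F) = r.
  have : size (form_x1 R F) = r.+1.
    by rewrite (form_x1E R hF) size_map_inj_poly //; apply: intr_inj.
  by rewrite e size_scale // size_prod_XsubC => -[].
have ur : uniq (form_roots R F).
  rewrite -separable_prod_XsubC.
  have := irreducible_separable (dehom_irreducible r2 hF Firr).
  rewrite -(separable_map (ratr : rat -> R[i])) -map_poly_comp.
  rewrite (eq_map_poly (g := intr)) -?(form_x1E R hF) ?e; last by move=> z /=; rewrite ratr_int.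
  by rewrite -(eqp_separable (eqp_scale _ c0)).
split=> //.
  by move=> i j /eqP; rewrite nth_uniq ?szr // => /eqP /val_inj.
by rewrite -(form_x1E R hF) {1}e -{1}(mkseq_nth 0 (form_roots R F)) szr big_map -{1}val_enum_ord big_map big_enum.
Qed.

Lemma sum_offdiag_sym (R : realFieldType) r (u : 'I_r -> 'I_r -> R) : (forall i j, u i j = u j i) ->
  \sum_(i < r) \sum_(j < r | j != i) u i j = \sum_(i < r) \sum_(j < r | (i < j)%N) 2 * u i j.
Proof.
move=> us; under [RHS]eq_bigr => i _ do (under eq_bigr do rewrite mulr_natl mulr2n; rewrite big_split /=).
rewrite big_split /= [X in _ = _ + X](exchange_big_dep xpredT) //= -big_split /=.
apply: eq_bigr => i _; rewrite (bigID (fun j : 'I_r => (i < j)%N)) /=; congr (_ + _).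
  by apply: eq_bigl => j; rewrite -(inj_eq val_inj) /=; case: ltngtP.
apply: eq_big => [j|j _]; last exact: us.
by rewrite -(inj_eq val_inj) /=; case: ltngtP.
Qed.

Lemma ln_form_disc (R : realType) r (F : {mpoly int[2]}) : (2 <= r)%N -> F \is r.-homog ->
  irreducible_form F ->
  0 < form_disc_abs R r F /\ ln (form_disc_abs R r F) =
    2 * (r%:R - 1) * ln `|form_a0 r F|%:~R +
    \sum_(i < r) \sum_(j < r | j != i) ln (normc ((form_roots R F)`_i - (form_roots R F)`_j)).
Proof.
move=> r2 hF Firr; have [ial a00 _] := form_roots_spec R r2 hF Firr.
set al := form_roots R F in ial *; set a0 := form_a0 r F in a00 *.
have a0p : 0 < `|a0|%:~R :> R by rewrite ltr0z normr_gt0.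
have pos (i j : 'I_r) : (i < j)%N -> 0 < normc (al`_i - al`_j).
  move=> ij; rewrite normc_gt0 subr_eq0; apply/eqP => /ial e.
  by move: ij; rewrite e ltnn.
have dE : form_disc_abs R r F = `|a0|%:~R ^+ (2 * r - 2) *
    \prod_(i < r) \prod_(j < r | (i < j)%N) normc (al`_i - al`_j) ^+ 2.
  rewrite /form_disc_abs /form_disc Normc.normcM normcX normc_int normc_prod; congr (_ * _).
  apply: eq_bigr => i _; rewrite normc_prod; apply: eq_bigr => j _; exact: normcX.
have p2 (i : 'I_r) : 0 < \prod_(j < r | (i < j)%N) normc (al`_i - al`_j) ^+ 2.
  by apply: prodr_gt0 => j ij; rewrite exprn_gt0 // pos.
have p1 : 0 < \prod_(i < r) \prod_(j < r | (i < j)%N) normc (al`_i - al`_j) ^+ 2.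
  by apply: prodr_gt0.
rewrite dE; split; first by rewrite mulr_gt0 ?exprn_gt0.
rewrite lnM ?posrE ?exprn_gt0 // lnXn // ln_prod //; congr (_ + _).
  rewrite -[LHS]mulr_natl natrB ?natrM; last by lia.
  by congr (_ * _); ring.
rewrite sum_offdiag_sym => [|i j]; last by rewrite normcBC.
apply: eq_bigr => i _; rewrite ln_prod => [|j ij]; last by rewrite exprn_gt0 // pos.
by apply: eq_bigr => j ij; rewrite lnXn ?pos // mulr_natl.
Qed.

(** * Assembling the bound *)

(** Bounding all duplicate-free lists also yields finiteness: an infinite set contains finite
    subsets larger than [c]. *)
Lemma counting_le (T : choiceType) (R : realType) (A : set T) (c : R) :
  (forall l : seq T, uniq l -> {in l, forall x, A x} -> (size l)%:R <= c) ->
  (counting A <= c%:E)%E.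
Proof.
move=> h; rewrite /counting; case: asboolP => [fA|iA].
  rewrite lee_fin; apply: h => [|x]; first exact: finmap.fset_uniq.
  by rewrite in_fset_set // inE.
have [B BA cB] := infinite_set_fset (Num.bound c).+1 iA.
have c0 : 0 <= c by apply: (h [::]).
exfalso; have : (size (finmap.enum_fset B))%:R <= c.
  by apply: h => [|x xB]; [exact: finmap.fset_uniq|exact: BA].
apply/negP; rewrite -ltNge; apply: lt_le_trans (archi_boundP c0) _.
by rewrite ler_nat; apply: leq_trans cB.
Qed.

Lemma logstar_ge1 (R : realType) (x : R) : 1 <= logstar x.
Proof.
rewrite /logstar; case: ifP => // /negbT; rewrite -ltNge => h.
rewrite -[leLHS](expRK (1 : R)) ler_ln ?posrE ?expR_gt0 //; first exact: ltW.
exact: lt_trans (expR_gt0 _) h.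
Qed.

Lemma ln_le_logstar (R : realType) (x : R) : 0 < x -> ln x <= logstar x.
Proof. by rewrite /logstar; case: ifP => // h x0; exact: ln_le_expR. Qed.

Lemma zfun_ge0 (R : realType) r : (1 <= r)%N -> 0 <= zfun R r.
Proof.
move=> r1; have l0 : 0 <= ln r%:R :> R by rewrite ln_ge0 // ler1n.
by rewrite /zfun !addr_ge0 ?mulr_ge0 ?exprn_ge0.
Qed.

(** [X] is e^100 H^2 / D and [E] the discriminant term of the theorem; the comparison is made factor
    by factor. *)
Lemma final_bound (R : realType) (H X E w q z s0 L : R) : 1 <= H -> 0 <= L -> 0 <= X ->
  8 * X <= E -> 0 <= w -> 0 <= q -> 0 <= z -> 0 <= s0 ->
  2 * (H + 8 * X) * (1000 * w + 48 * s0 * (15 + q)) <=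
  2 * (1 + L) * (3 + 4 * H + E) * (1 + 40 * (6 + z + 25 * w) + 48 * s0 * (15 + q)).
Proof.
move=> H1 L0 X0 hE w0 q0 z0 s00.
have t0 : 0 <= 48 * s0 * (15 + q) by rewrite !mulr_ge0 ?addr_ge0.
move: (48 * s0 * _) t0 => t t0.
apply: ler_pM; [lra|lra| |lra].
apply: ler_pM; [lra|lra|lra|lra].
Qed.

Lemma hroot_ge1 (R : realType) (h r : nat) : (1 <= h)%N -> 1 <= hroot R h r.
Proof.
move=> h1; have e : 1 `^ r%:R^-1 = 1 :> R by rewrite powR1.
rewrite /hroot -[leLHS]e; apply: ge0_ler_powR => //.
- by rewrite nnegrE.
- by rewrite nnegrE.
- by rewrite ler1n.
Qed.

Lemma hrootX (R : realType) (h r : nat) : (0 < r)%N -> hroot R h r ^+ r = h%:R.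
Proof.
move=> r0; rewrite /hroot -powR_mulrn ?powR_ge0 // -powRrM mulVf ?powRr1 //.
by rewrite pnatr_eq0 -lt0n.
Qed.

Lemma powR_hroot2 (R : realType) (h r : nat) : h%:R `^ (2 / r%:R) = hroot R h r ^+ 2.
Proof. by rewrite /hroot -powR_mulrn ?powR_ge0 // -powRrM mulrC. Qed.

Lemma expR105_ge (R : realType) : 8 * expR 100 <= expR 105 :> R.
Proof.
have -> : expR 105 = expR 5 * expR 100 :> R by rewrite -expRD; congr expR; ring.
have -> : expR 5 = expR 1 ^+ 5 :> R by rewrite -expRM_natl mulr1.
apply: ler_wpM2r; first exact: expR_ge0.
apply: le_trans (_ : 2 ^+ 5 <= _).
  have -> : 2 ^+ 5 = 32 :> R by ring.
  by lra.
by apply: lerXn2r; rewrite ?nnegrE ?expR_ge0 ?expR1_ge2.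
Qed.

(** 225^2 = 50625 is below 132434. *)
Lemma sqrt_ge_15x15 (R : realType) (r s : nat) : (132 * 1000 + 434 <= r)%N -> (1 <= s)%N ->
  15 * 15 <= Num.sqrt (s * r)%:R :> R.
Proof.
move=> hr hs.
have r1 : 132 * 1000 + 434 <= r%:R :> R.
  by move: hr; rewrite -(ler_nat R) natrD natrM.
have rs : r%:R <= (s * r)%:R :> R by rewrite ler_nat leq_pmull.
have h15 : (15 * 15) ^+ 2 <= (s * r)%:R :> R.
  by apply: le_trans rs; apply: le_trans r1; rewrite expr2; clear; lra.
have p15 : 0 <= 15 * 15 :> R by rewrite mulr_ge0.
by rewrite -(ger0_norm p15) -sqrtr_sqr; exact: ler_wsqrtr.
Qed.

Theorem theorem1p2 (R : realType) (r s h : nat) (F : {mpoly int[2]})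
  (hr : (132 * 1000 + 434 <= r)%N) (hs : (1 <= s)%N) (hh : (1 <= h)%N)
  (Fhomog : F \is r.-homog) (Firr : irreducible_form F)
  (Fcoeffs : (nb_coeffs F <= s + 1)%N) :
  (nb_sol R F h <=
   (2 * (1 + logstar (hroot R h r))
    * (3 + 4 * hroot R h r
       + expR 105 * h%:R `^ (2 / r%:R)
         / form_disc_abs R r F `^ (r%:R * (r%:R - 1))^-1)
    * (1 + 40 * (6 + zfun R r + 25 * (s * r)%:R `^ (1 / 2))
       + 48 * s%:R
         * (15 + 1 / ln (r%:R - 1) * ln (logstar (2 * hroot R h r)))))%:E)%E.
Proof.
have r1000 : (1000 <= r)%N by apply: leq_trans hr; clear; lia.
have r2 : (2 <= r)%N by apply: leq_trans r1000.
have r0 : (0 < r)%N by apply: leq_trans r1000.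
have rR : 2 <= r%:R :> R by rewrite (ler_nat _ 2).
have [ial a00 hf] := form_roots_spec R r2 Fhomog Firr.
have [d0 dln] := ln_form_disc R r2 Fhomog Firr.
set H := hroot R h r; set disc := form_disc_abs R r F in d0 dln *.
set D := disc `^ _; set L := logstar H; set Lam := logstar (2 * H).
have H1 : 1 <= H by exact: hroot_ge1.
have Hp : 0 < H by exact: lt_le_trans H1.
have D0 : 0 < D by exact: powR_gt0.
have w15 := sqrt_ge_15x15 R hr hs.
have rr1 : r%:R * (r%:R - 1) != 0 :> R by rewrite gt_eqF // mulr_gt0; clear - rR; lra.
have HLam : ln H <= Lam.
  apply: le_trans (ln_le_logstar _); last by rewrite mulr_gt0.
  by rewrite ler_ln ?posrE ?mulr_gt0 // ler_peMl ?ler1n // ltW.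
rewrite /nb_sol; apply: counting_le => l ul hl.
have spf : sparse_form s (dehom r F) (form_a0 r F) (fun i : 'I_r => (form_roots R F)`_i)
    (Num.sqrt (s * r)%:R).
  split=> //; first by rewrite sqr_sqrtr.
    by move=> u v; exact: dehom_no_zero.
  by apply: leq_trans (nterms_dehom _ _) _; rewrite -addn1.
apply: le_trans (solution_count (H := H) (Lam := Lam) (D := D) spf H1 _ HLam _ D0 _ ul _) _.
- exact: hrootX.
- exact: logstar_ge1.
- by rewrite /D ln_powR mulrA divff // mul1r dln.
- by move=> x /hl[x0 hx]; rewrite -(meval_binary_form _ _ Fhomog).
have -> : (s * r)%:R `^ (1 / 2) = Num.sqrt (s * r)%:R :> R by rewrite mul1r powR12_sqrt.
have -> : 1 / ln (r%:R - 1) * ln Lam = ln Lam / ln (r%:R - 1) by rewrite mul1r mulrC.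
rewrite powR_hroot2 -/H /prim_bound; apply: final_bound => //.
- by apply: le_trans (logstar_ge1 _); exact: ler01.
- by rewrite divr_ge0 ?mulr_ge0 ?expR_ge0 ?exprn_ge0 ?ltW.
- have HD : 0 <= H ^+ 2 / D by rewrite divr_ge0 ?exprn_ge0 ?ltW.
  by rewrite -!(mulrA (expR _)) mulrA; apply: ler_wpM2r => //; exact: expR105_ge.
- by rewrite divr_ge0 ?ln_ge0 ?logstar_ge1 //; clear - rR; lra.
- exact: zfun_ge0.
Qed.
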